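(* There exists a universal constant $c > 0$ such that, for every continuous Gaussian process $f$ on a domain $D \subseteq \mathbb{R}^d$ with covariance kernel $K(x,y) = \mathrm{Cov}[f(x),f(y)]$, all compact domains $D_1, D_2 \subseteq D$, all increasing events $A_1 \in \sigma(D_1)$ and $A_2 \in \sigma(D_2)$, and all $\varepsilon > 0$, $$(1)\qquad \mathbb{P}[f \in A_1 \cap A_2] - \mathbb{P}[f + \varepsilon \in A_1]\,\mathbb{P}[f + \varepsilon \in A_2] \le \frac{c\, \|K_{D_1,D_2}\|_\infty}{\varepsilon^2},$$ and $$(2)\qquad \mathbb{P}[f - \varepsilon \in A_1]\,\mathbb{P}[f - \varepsilon \in A_2] - \mathbb{P}[f \in A_1 \cap A_2] \le \frac{c\, \|K_{D_1,D_2}\|_\infty}{\varepsilon^2}.$$ Moreover, if $K_{D_1,D_2} \ge 0$ (pointwise) then (1) holds with $c = 1$ and (2) holds with $c = 0$.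
   Context: For $D_1, D_2 \subseteq D$, $K_{D_1,D_2} = (K(x,y))_{x \in D_1, y \in D_2}$ and $\|K_{D_1,D_2}\|_\infty = \sup_{x \in D_1, y \in D_2} |K(x,y)|$. Events are (Borel) measurable sets of continuous functions on $D$. An event $A$ is increasing if $\{f \in A\} \subseteq \{f + v \in A\}$ for every continuous $v : D \to \mathbb{R}$ with $v \ge 0$. It is supported on $D' \subseteq D$, written $A \in \sigma(D')$, if $\{f \in A\} = \{f + v \in A\}$ for every continuous $v : D \to \mathbb{R}$ with $v|_{D'} = 0$. These inclusions and equalities are understood to hold for every realisation of $f$, i.e. for every continuous function on $D$. The constant $c$ does not depend on $d$, $D$ or $f$. *)

(* Defs.v *)
From HB Require Import structures.
From mathcomp Require Import all_boot all_order all_algebra.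
From mathcomp Require Import all_classical all_reals all_analysis.
Set Implicit Arguments.
Unset Strict Implicit.
Unset Printing Implicit Defensive.
Import Order.TTheory GRing.Theory Num.Theory.
Import numFieldNormedType.Exports.
Local Open Scope classical_set_scope.
Local Open Scope ring_scope.

Section ContinuousFunctions.
Context {R : realType} {X : topologicalType}.
Implicit Types (g v : continuousType X R)
  (A : set (continuousType X R)) (S : set X).

Lemma contfun_add_subproof g v : continuous (fun x : X => g x + v x).
Proof.
have gc : continuous g by apply: cts_fun.
have vc : continuous v by apply: cts_fun.
by move=> x; apply: cvgD; [exact: gc|exact: vc].
Qed.

Definition contfun_add g v : continuousType X R :=
  mkcts (@contfun_add_subproof g v).

Definition contfun_shift g (e : R) : continuousType X R := contfun_add g (cst e).

(* Borel sigma-algebra of the compact-open topology, i.e. of uniform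
   convergence on compact subsets of X. *)
Definition event A : Prop :=
  <<s @open (initial_topology
               (id : continuousType X R -> {compact-open, X -> R})) >> A.

Definition increasing A : Prop :=
  forall g v, (forall x, 0 <= v x) -> A g -> A (contfun_add g v).

Definition supported A S : Prop :=
  forall g v, (forall x, S x -> v x = 0) -> (A g <-> A (contfun_add g v)).

End ContinuousFunctions.

Section GaussianProcesses.
Context {R : realType} {dO : measure_display} {Omega : measurableType dO}.
Implicit Types P : probability Omega R.

(* Degenerate (constant) Gaussians are included; they are treated apart because
   normal_prob m 0 is not the Dirac mass at m but a default value. *)
Definition gaussian_rv P (Y : Omega -> R) : Prop :=
  measurable_fun setT Y /\
  exists m s : R, forall B : set R, measurable B ->
    P (Y @^-1` B) = if s == 0 then \d_m B else normal_prob m s B.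

Context {X : topologicalType}.
Implicit Types (f : Omega -> continuousType X R) (D : set X)
  (A : set (continuousType X R)) (eps c : R).

(* The process need not be centred. *)
Definition gaussian_process P f : Prop :=
  forall (k : nat) (x : 'I_k -> X) (a : 'I_k -> R),
    gaussian_rv P (fun w => \sum_(i < k) a i * f w (x i)).

Definition cov_kernel P f (x y : X) : \bar R :=
  covariance P (fun w => f w x) (fun w => f w y).

Local Open Scope ereal_scope.

(* The maximum with 0 only matters when D1 or D2 is empty: the supremum is
   taken among nonnegative numbers. *)
Definition kernel_norm P f D1 D2 : \bar R :=
  maxe 0 (ereal_sup [set `|cov_kernel P f x y| | x in D1 & y in D2]).

Definition sprinkled_upper P f D1 D2 A1 A2 eps c : Prop :=
  P [set w | A1 (f w) /\ A2 (f w)]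
  - P [set w | A1 (contfun_shift (f w) eps)]
    * P [set w | A2 (contfun_shift (f w) eps)]
  <= (c / eps ^+ 2)%:E * kernel_norm P f D1 D2.

Definition sprinkled_lower P f D1 D2 A1 A2 eps c : Prop :=
  P [set w | A1 (contfun_shift (f w) (- eps))]
    * P [set w | A2 (contfun_shift (f w) (- eps))]
  - P [set w | A1 (f w) /\ A2 (f w)]
  <= (c / eps ^+ 2)%:E * kernel_norm P f D1 D2.

End GaussianProcesses.

(* Main.v *)
Require Import Defs.
From mathcomp Require Import all_boot all_order all_algebra.
From mathcomp Require Import all_classical all_reals all_analysis.
From mathcomp Require Import measurable_realfun ring lra.
Import Order.TTheory GRing.Theory Num.Theory.
Import numFieldNormedType.Exports.
Local Open Scope classical_set_scope.
Local Open Scope ring_scope.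
Set Implicit Arguments.
Unset Strict Implicit.
Unset Printing Implicit Defensive.

(** For an increasing event [A] supported on a compact set, let [level A eps g]
be the length of the set of heights [s] in [0, eps] such that [g + s] lies in
[A]. As [A] is increasing, this functional lies between [eps] times the
indicator of [A] at [g] and [eps] times the indicator of [A] at [g + eps], and
it is nondecreasing and 1-Lipschitz for the uniform norm on the support. With
[U_i = level A_i eps f] this gives
[eps ^+ 2 * P(f in A1 and A2) <= E(U_1 U_2) = E(U_1) E(U_2) + Cov(U_1, U_2)],
where [E(U_i) <= eps * P(f + eps in A_i)]; the second inequality follows in the
same way from the functionals at [f - eps]. Both are therefore consequences,
with [c = 1], of the covariance inequality [gaussian_cov_inequality]: if the
kernel lies between [lo <= 0] and [hi >= 0] on the two compact sets, then so
does the covariance of two functionals that are nondecreasing and 1-Lipschitz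
for the uniform norms on these sets. For a nonnegative kernel one takes
[lo = 0].

The reason for the covariance inequality is that the covariance of [g(X)] and
[h(Y)], for a Gaussian vector [(X, Y)], is an average of
[sum_(i, j) p_i q_j Cov(X_i, Y_j)] where [p] and [q] are values of the gradients
of [g] and [h]; these have nonnegative entries with sum at most 1. The argument
below replaces Gaussian interpolation by an iteration. A centred Gaussian vector
has the law of [(Z_1 + Z_2) / sqrt 2] for independent copies [Z_1] and [Z_2].
Conditioning on [Z_1] expresses the covariance of [g] and [h] as the mean of two
covariances of functions whose second-order Taylor error is smaller by the
factor [sqrt 2] ([cov_halving]). After many steps the functions are practically
linear, and the covariance of linear functions is the sum above
([cov_smooth_base], [cov_smooth]).

The equality in law of [Z] and [(Z_1 + Z_2) / sqrt 2] comes from characteristic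
functions. Those of Gaussian variables are computed from Stein's identity
([gaussian_char]), and they determine the expectations of bounded Lipschitz
functions because such functions are limits of trigonometric polynomials, of
Bernstein type in each coordinate ([law_identity]).

A contractive functional of [f] is an iterated monotone limit of lattice
polynomials, maxima of minima of finitely many values of [f]
([envelope_approximation]), and these are limits of smooth functions of the same
values, with maxima and minima smoothed by square roots
([gaussian_lattice_cov]). The same separability yields the measurability of the
events [f in A] ([measurable_event]): an extension operator from the compact
support reduces an open set of functions to countably many values of [f]. *)

(** * Expectations of bounded random variables *)

Section BoundedExpectation.
Context {R : realType}.

Definition bounded_rv {d} {T : measurableType d} (X : T -> R) : Prop :=
  measurable_fun setT X /\ exists M : R, forall w, `|X w| <= M.

Definition mean {d} {T : measurableType d} (P : probability T R) (X : T -> R) : R :=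
  Rintegral P setT X.

Section OneSpace.
Context {d} {T : measurableType d} (P : probability T R).
Implicit Types X Y : T -> R.

Lemma bounded_rv_integrable X : bounded_rv X -> P.-integrable setT (EFin \o X).
Proof.
move=> [mX [M XM]]; apply: measurable_bounded_integrable => //.
  exact: (le_lt_trans (probability_le1 P measurableT) (ltry 1)).
by exists M; split; [exact: num_real|move=> x Mx w _; exact: le_trans (XM w) (ltW Mx)].
Qed.

Lemma bounded_rv_cst c : bounded_rv (fun _ : T => c).
Proof. by split; [exact: measurable_cst|exists `|c|]. Qed.

Lemma bounded_rvD X Y : bounded_rv X -> bounded_rv Y -> bounded_rv (fun w => X w + Y w).
Proof.
move=> [mX [M XM]] [mY [N YN]]; split; first exact: measurable_funD.
by exists (M + N) => w; apply: le_trans (ler_normD _ _) _; exact: lerD.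
Qed.

Lemma bounded_rvM X Y : bounded_rv X -> bounded_rv Y -> bounded_rv (fun w => X w * Y w).
Proof.
move=> [mX [M XM]] [mY [N YN]]; split; first exact: measurable_funM.
by exists (M * N) => w; rewrite normrM; apply: ler_pM.
Qed.

Lemma bounded_rvZ c X : bounded_rv X -> bounded_rv (fun w => c * X w).
Proof. by apply: bounded_rvM; exact: bounded_rv_cst. Qed.

Lemma bounded_rvB X Y : bounded_rv X -> bounded_rv Y -> bounded_rv (fun w => X w - Y w).
Proof.
move=> [mX [M XM]] [mY [N YN]]; split; first exact: measurable_funB.
by exists (M + N) => w; apply: le_trans (ler_normB _ _) _; exact: lerD.
Qed.

Lemma eq_mean X Y : X =1 Y -> mean P X = mean P Y.
Proof. by move=> XY; rewrite /mean; apply: eq_Rintegral => w _; exact: XY. Qed.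

Lemma mean_cst c : mean P (fun=> c) = c.
Proof.
rewrite /mean Rintegral_cst//; apply: etrans (mulr1 c).
exact: (congr1 (fun x => c * fine x) (probability_setT P)).
Qed.

Lemma integrable_scale k X : P.-integrable setT (EFin \o X) ->
  P.-integrable setT (EFin \o (fun w => k * X w)).
Proof. by move=> iX; exact: (integrableZl measurableT k iX). Qed.

Lemma integrable_add X Y : P.-integrable setT (EFin \o X) -> P.-integrable setT (EFin \o Y) ->
  P.-integrable setT (EFin \o (fun w => X w + Y w)).
Proof. by move=> iX iY; exact: (integrableD measurableT iX iY). Qed.

Lemma integrable_sub X Y : P.-integrable setT (EFin \o X) -> P.-integrable setT (EFin \o Y) ->
  P.-integrable setT (EFin \o (fun w => X w - Y w)).
Proof. by move=> iX iY; exact: (integrableB measurableT iX iY). Qed.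

Lemma integrable_meanD X Y : P.-integrable setT (EFin \o X) -> P.-integrable setT (EFin \o Y) ->
  mean P (fun w => X w + Y w) = mean P X + mean P Y.
Proof. by move=> iX iY; rewrite /mean RintegralD. Qed.

Lemma integrable_meanB X Y : P.-integrable setT (EFin \o X) -> P.-integrable setT (EFin \o Y) ->
  mean P (fun w => X w - Y w) = mean P X - mean P Y.
Proof. by move=> iX iY; rewrite /mean RintegralB. Qed.

Lemma integrable_meanZ c X : P.-integrable setT (EFin \o X) ->
  mean P (fun w => c * X w) = c * mean P X.
Proof. by move=> iX; rewrite /mean RintegralZl. Qed.

Lemma integrable_mean_le X Y : P.-integrable setT (EFin \o X) -> P.-integrable setT (EFin \o Y) ->
  (forall w, X w <= Y w) -> mean P X <= mean P Y.
Proof. by move=> iX iY XY; rewrite /mean le_Rintegral. Qed.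

Lemma integrable_mean_sum (I : Type) (r : seq I) (F : I -> T -> R) :
  (forall i, P.-integrable setT (EFin \o F i)) ->
  P.-integrable setT (EFin \o (fun w => \sum_(i <- r) F i w)) /\
  mean P (fun w => \sum_(i <- r) F i w) = \sum_(i <- r) mean P (F i).
Proof.
move=> iF; elim: r => [|i r [iS eS]].
  split; last by rewrite big_nil -[RHS]mean_cst; apply: eq_mean => w; rewrite big_nil.
  by under eq_fun do rewrite big_nil; apply: bounded_rv_integrable; exact: bounded_rv_cst.
split; last first.
  by rewrite big_cons -eS -integrable_meanD//; apply: eq_mean => w; rewrite big_cons.
by under eq_fun do rewrite big_cons; exact: integrable_add.
Qed.

Lemma meanD X Y : bounded_rv X -> bounded_rv Y ->
  mean P (fun w => X w + Y w) = mean P X + mean P Y.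
Proof. by move=> bX bY; rewrite integrable_meanD//; exact: bounded_rv_integrable. Qed.

Lemma meanB X Y : bounded_rv X -> bounded_rv Y ->
  mean P (fun w => X w - Y w) = mean P X - mean P Y.
Proof. by move=> bX bY; rewrite integrable_meanB//; exact: bounded_rv_integrable. Qed.

Lemma meanZ c X : bounded_rv X -> mean P (fun w => c * X w) = c * mean P X.
Proof. by move=> bX; rewrite integrable_meanZ//; exact: bounded_rv_integrable. Qed.

Lemma mean_le X Y : bounded_rv X -> bounded_rv Y -> (forall w, X w <= Y w) ->
  mean P X <= mean P Y.
Proof. by move=> bX bY XY; apply: integrable_mean_le => //; exact: bounded_rv_integrable. Qed.

Lemma mean_itv X a b : bounded_rv X -> (forall w, a <= X w <= b) -> a <= mean P X <= b.
Proof.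
move=> bX Xab; apply/andP; split.
  rewrite -(mean_cst a); apply: mean_le => // [|w]; first exact: bounded_rv_cst.
  by case/andP: (Xab w).
rewrite -(mean_cst b); apply: mean_le => // [|w]; first exact: bounded_rv_cst.
by case/andP: (Xab w).
Qed.

Lemma le_norm_mean X Y : P.-integrable setT (EFin \o X) -> P.-integrable setT (EFin \o Y) ->
  (forall w, `|X w| <= Y w) -> `|mean P X| <= mean P Y.
Proof.
move=> iX iY XY; apply: le_trans (le_normr_Rintegral measurableT iX) _.
apply: le_Rintegral => //; exact: integrable_norm iX.
Qed.

Lemma bounded_cvg (X_ : nat -> T -> R) X (M : R) :
  (forall n, measurable_fun setT (X_ n)) -> (forall n w, `|X_ n w| <= M) ->
  (forall w, X_ ^~ w @ \oo --> X w) -> bounded_rv X.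
Proof.
move=> mX XM cX; split; first by apply: (measurable_fun_cvg mX) => w _; exact: cX.
exists M => w; rewrite -(cvg_lim _ (cvg_norm (cX w)))//.
by apply: limr_le; [apply: cvgP; exact: cvg_norm (cX w)|exact: nearW].
Qed.

Lemma mean_cvg (X_ : nat -> T -> R) X (M : R) :
  (forall n, measurable_fun setT (X_ n)) -> (forall n w, `|X_ n w| <= M) ->
  (forall w, X_ ^~ w @ \oo --> X w) -> mean P (X_ n) @[n --> \oo] --> mean P X.
Proof.
move=> mX XM cX; have bX := bounded_cvg mX XM cX.
have := @dominated_convergence _ _ _ P setT measurableT (fun n => EFin \o X_ n) (EFin \o X) (cst M%:E).
case.
- by move=> n; apply/measurable_EFinP.
- by apply/measurable_EFinP; case: bX.
- by apply: aeW => w _; apply: cvg_EFin; [exact: nearW|exact: cX].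
- have := bounded_rv_integrable (bounded_rv_cst M); exact.
- by apply: aeW => w n _; rewrite lee_fin.
move=> _ _ h; rewrite /mean/Rintegral; apply: fine_cvg.
rewrite fineK; first exact: h.
by apply: integrable_fin_num => //; exact: (bounded_rv_integrable bX).
Qed.

End OneSpace.

Section TwoSpaces.
Context {d1 d2} {T1 : measurableType d1} {T2 : measurableType d2}
  (P1 : probability T1 R) (P2 : probability T2 R).

Lemma bounded_rv_slice (F : T1 * T2 -> R) x : bounded_rv F -> bounded_rv (fun y => F (x, y)).
Proof.
move=> [mF [M FM]]; split; last by exists M.
exact: measurableT_comp mF (measurable_pair1 x).
Qed.

Lemma bounded_rv_mean (F : T1 * T2 -> R) : bounded_rv F ->
  bounded_rv (fun x => mean P2 (fun y => F (x, y))).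
Proof.
move=> bF; have [mF [M FM]] := bF; split; last first.
  exists M => x; rewrite ler_norml.
  by apply: mean_itv; [exact: bounded_rv_slice|move=> w; rewrite -ler_norml].
(* Tonelli needs a nonnegative integrand: shift [F] by its bound *)
have -> : (fun x => mean P2 (fun y => F (x, y))) =
    (fun x => mean P2 (fun y => F (x, y) + M) - M).
  apply/funext => x; rewrite meanD ?mean_cst ?addrK//; last exact: bounded_rv_cst.
  exact: bounded_rv_slice.
apply: measurable_funB => //; rewrite /mean /Rintegral; apply: measurableT_comp => //.
apply: (measurable_fun_fubini_tonelli_F (fun z => (F z + M)%:E)) => [|z].
  by apply/measurable_EFinP; exact: measurable_funD.
by rewrite lee_fin; have := FM z; rewrite ler_norml => /andP[? _]; rewrite -lerBlDr sub0r.
Qed.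

Lemma mean_prod (F : T1 * T2 -> R) : bounded_rv F ->
  mean (P1 \x P2)%E F = mean P1 (fun x => mean P2 (fun y => F (x, y))).
Proof.
move=> bF; rewrite /mean/Rintegral; congr fine.
rewrite -integral12_prod_meas1; last exact: (bounded_rv_integrable (P1 \x P2)%E bF).
apply: eq_integral => x _; rewrite fineK//.
apply: integrable_fin_num => //.
exact: (bounded_rv_integrable P2 (bounded_rv_slice x bF)).
Qed.

End TwoSpaces.
End BoundedExpectation.

(** * Equality of laws from equality of characteristic functions *)

Section ElementaryBounds.
Context {R : realType}.

Lemma MVT_between (f df : R -> R) : (forall x : R, is_derive x 1 f (df x)) ->
  forall a b, exists2 c, `|c - a| <= `|b - a| & f b - f a = df c * (b - a).
Proof.
move=> hf.
have cf : continuous f.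
  by move=> x; apply: differentiable_continuous; apply/derivable1_diffP; by have [] := hf x.
have wf (a b : R) : {within `[a, b], continuous f}.
  exact: continuous_subspaceT.
move=> a b; have [ab|ba] := leP a b.
  have [c cab ->] := MVT_segment ab (fun x _ => hf x) (wf a b).
  exists c => //; move: cab; rewrite in_itv/= => /andP[ac cb].
  by rewrite !ger0_norm ?subr_ge0// lerD2r.
have [c cab e] := MVT_segment (ltW ba) (fun x _ => hf x) (wf b a).
exists c; last by rewrite -[LHS]opprB e -mulrN opprB.
move: cab; rewrite in_itv/= => /andP[bc ca].
by rewrite distrC (distrC b) !ger0_norm ?subr_ge0 ?(ltW ba)// lerB.
Qed.

Lemma norm_sin_le (x : R) : `|sin x| <= `|x|.
Proof.
have [c _] := MVT_between (@is_derive_sin R) 0 x.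
rewrite sin0 !subr0 => ->; rewrite normrM ler_piMl//; exact: cos_max.
Qed.

Lemma norm_cosB1_le (x : R) : `|cos x - 1| <= x ^+ 2.
Proof.
have [c] := MVT_between (@is_derive_cos R) 0 x.
rewrite cos0 !subr0 => cx ->; rewrite normrM normrN -real_normK ?num_real// expr2.
by rewrite ler_wpM2r// (le_trans (norm_sin_le c)).
Qed.

Lemma norm_sinB_le (x : R) : `|sin x - x| <= `|x| ^+ 3.
Proof.
have d (y : R) : is_derive y 1 (fun y => sin y - y) (cos y - 1).
  by apply: is_deriveB; exact: is_derive_sin.
have [c] := MVT_between d 0 x.
rewrite sin0 !subr0 => cx ->; rewrite normrM [leRHS]exprSr ler_wpM2r//.
rewrite (le_trans (norm_cosB1_le c))// -real_normK ?num_real//.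
by rewrite lerXn2r ?nnegrE.
Qed.

End ElementaryBounds.

Section RandomWalk.
Context {R : realType}.
Implicit Types (f : R -> R) (dl s a c : R).

(** The mean of [f] at the endpoint of a walk from [a] with [n] steps of length
[dl], where a step goes up with probability [(1 + s) / 2]. *)
Fixpoint walk f dl s n a : R :=
  if n is n'.+1 then
    (1 + s) / 2 * walk f dl s n' (a + dl) + (1 - s) / 2 * walk f dl s n' (a - dl)
  else f a.

Lemma walk_bounded f dl s M : `|s| <= 1 -> (forall y, `|f y| <= M) ->
  forall n a, `|walk f dl s n a| <= M.
Proof.
move=> s1 fM; elim=> [//|n IH] a /=.
move: s1; rewrite ler_norml => /andP[s1 s2].
have := IH (a + dl); have := IH (a - dl); rewrite !ler_norml.
by move=> /andP[? ?] /andP[? ?]; apply/andP; split; nra.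
Qed.

(** The endpoint of the walk has mean [a + n * dl * s] and variance
[n * dl ^+ 2 * (1 - s ^+ 2)], so this is the Chebyshev type estimate behind
Bernstein polynomials: [|y - c| <= (eta + (y - c) ^+ 2 / eta) / 2] has a
right-hand side that is quadratic in [y], and quadratic functions are
averaged exactly by the walk. The induction on [n] verifies this identity
without introducing the walk as a random variable. *)
Lemma walk_error f dl s L eta : `|s| <= 1 -> 0 <= L -> 0 < eta ->
  (forall x y, `|f x - f y| <= L * `|x - y|) ->
  forall n a c, `|walk f dl s n a - f c| <=
    L / 2 * (eta + ((a + n%:R * dl * s - c) ^+ 2 + n%:R * dl ^+ 2 * (1 - s ^+ 2)) / eta).
Proof.
move=> s1 L0 eta0 fL; elim=> [|n IH] a c.
  rewrite /= !mul0r addr0 addr0; apply: le_trans (fL a c) _.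
  rewrite -mulrA ler_wpM2l// -(real_normK (num_real (a - c))) -subr_ge0.
  rewrite [X in 0 <= X](_ : _ = (`|a - c| - eta) ^+ 2 / (2 * eta)).
    by rewrite divr_ge0 ?sqr_ge0// mulr_ge0// ltW.
  by field; exact: lt0r_neq0.
move: s1; rewrite ler_norml => /andP[s1 s2] /=.
have h1 := IH (a + dl) c; have h2 := IH (a - dl) c.
set W1 := walk _ _ _ _ _ in h1 *; set W2 := walk _ _ _ _ _ in h2 *.
rewrite [X in `|X|](_ : _ = (1 + s) / 2 * (W1 - f c) + (1 - s) / 2 * (W2 - f c)); last by field.
have e1 : 0 <= (1 + s) / 2 by lra.
have e2 : 0 <= (1 - s) / 2 by lra.
apply: le_trans (ler_normD _ _) _; rewrite [X in X + _]normrM [X in _ + X]normrM.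
rewrite (ger0_norm e1) (ger0_norm e2).
apply: le_trans (lerD (ler_wpM2l e1 h1) (ler_wpM2l e2 h2)) _.
rewrite le_eqVlt; apply/orP; left; apply/eqP.
rewrite -[n.+1]addn1 natrD; field; exact: lt0r_neq0.
Qed.

End RandomWalk.

Section LawIdentity.
Context {R : realType}.

Definition linform N (th x : nat -> R) : R := \sum_(i < N) th i * x i.

Definition update (x : nat -> R) j y : nat -> R := fun i => if i == j then y else x i.

(** Measurability on a space of sequences, tested on all measurable random
sequences: no sigma-algebra on sequences has to be chosen. *)
Definition measurable_functional (F : (nat -> R) -> R) : Prop :=
  forall d (T : measurableType d) (Z : T -> nat -> R),
    (forall i, measurable_fun setT (Z ^~ i)) -> measurable_fun setT (fun w => F (Z w)).

Definition l1dist N (x y : nat -> R) : R := \sum_(i < N) `|x i - y i|.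

Definition bounded_lipschitz N (F : (nat -> R) -> R) : Prop :=
  [/\ measurable_functional F, exists M : R, forall x, `|F x| <= M &
      exists2 L : R, 0 <= L & forall x y, `|F x - F y| <= L * l1dist N x y].

Lemma measurable_linform N th : measurable_functional (linform N th).
Proof.
move=> d T Z mZ; rewrite /linform.
apply: measurable_sum => i; exact: measurable_funM.
Qed.

Context {d d'} {T : measurableType d} {T' : measurableType d'}
  (P : probability T R) (P' : probability T' R)
  (Z : T -> nat -> R) (Z' : T' -> nat -> R) (N : nat).
Hypothesis mZ : forall i, measurable_fun setT (Z ^~ i).
Hypothesis mZ' : forall i, measurable_fun setT (Z' ^~ i).
Hypothesis char_eq : forall th c,
  mean P (fun w => cos (linform N th (Z w) + c)) =
  mean P' (fun w => cos (linform N th (Z' w) + c)).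

(** The integrals of [F] against all trigonometric characters agree, rather than
the integral of [F] alone: this class is stable under products with cosines,
and therefore contains the trigonometric polynomials and their limits. *)
Definition agree (F : (nat -> R) -> R) : Prop :=
  [/\ bounded_rv (fun w => F (Z w)), bounded_rv (fun w => F (Z' w)) &
    forall th c, mean P (fun w => F (Z w) * cos (linform N th (Z w) + c)) =
                 mean P' (fun w => F (Z' w) * cos (linform N th (Z' w) + c))].

Lemma bounded_rv_cos d0 (T0 : measurableType d0) (Y : T0 -> nat -> R) th c :
  (forall i, measurable_fun setT (Y ^~ i)) ->
  bounded_rv (fun w => cos (linform N th (Y w) + c)).
Proof.
move=> mY; split; last by exists 1 => w; exact: cos_max.
apply: measurableT_comp; first by apply: continuous_measurable_fun; exact: continuous_cos.
by apply: measurable_funD => //; exact: measurable_linform.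
Qed.

Lemma agree_cst k : agree (fun=> k).
Proof.
split; [exact: bounded_rv_cst|exact: bounded_rv_cst|move=> th c].
rewrite !meanZ; [by rewrite char_eq|exact: bounded_rv_cos|exact: bounded_rv_cos].
Qed.

Lemma agree_lin k l F G : agree F -> agree G -> agree (fun x => k * F x + l * G x).
Proof.
move=> [bF bF' eF] [bG bG' eG]; split.
- by apply: bounded_rvD; exact: bounded_rvZ.
- by apply: bounded_rvD; exact: bounded_rvZ.
move=> th c.
have e d0 (T0 : measurableType d0) (P0 : probability T0 R) Y : (forall i, measurable_fun setT (Y ^~ i)) ->
    bounded_rv (fun w => F (Y w)) -> bounded_rv (fun w => G (Y w)) ->
    mean P0 (fun w => (k * F (Y w) + l * G (Y w)) * cos (linform N th (Y w) + c)) =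
    k * mean P0 (fun w => F (Y w) * cos (linform N th (Y w) + c)) +
    l * mean P0 (fun w => G (Y w) * cos (linform N th (Y w) + c)).
  move=> mY b1 b2.
  have b3 := bounded_rvM b1 (bounded_rv_cos th c mY).
  have b4 := bounded_rvM b2 (bounded_rv_cos th c mY).
  rewrite -!meanZ// -meanD; [|exact: bounded_rvZ|exact: bounded_rvZ].
  by apply: eq_mean => w; rewrite mulrDl !mulrA.
by rewrite !e// eF eG.
Qed.

Lemma agree_cos th c F : agree F -> agree (fun x => F x * cos (linform N th x + c)).
Proof.
move=> [bF bF' eF]; split.
- by apply: bounded_rvM => //; exact: bounded_rv_cos.
- by apply: bounded_rvM => //; exact: bounded_rv_cos.
move=> th' c'.
have e d0 (T0 : measurableType d0) (P0 : probability T0 R) Y : (forall i, measurable_fun setT (Y ^~ i)) ->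
    bounded_rv (fun w => F (Y w)) ->
    mean P0 (fun w => F (Y w) * cos (linform N th (Y w) + c) * cos (linform N th' (Y w) + c')) =
    2^-1 * mean P0 (fun w => F (Y w) * cos (linform N (fun i => th i + th' i) (Y w) + (c + c'))) +
    2^-1 * mean P0 (fun w => F (Y w) * cos (linform N (fun i => th i - th' i) (Y w) + (c - c'))).
  move=> mY b1.
  have b3 := bounded_rvM b1 (bounded_rv_cos (fun i => th i + th' i) (c + c') mY).
  have b4 := bounded_rvM b1 (bounded_rv_cos (fun i => th i - th' i) (c - c') mY).
  rewrite -!meanZ// -meanD; [|exact: bounded_rvZ|exact: bounded_rvZ].
  apply: eq_mean => w.
  have -> : linform N (fun i => th i + th' i) (Y w) = linform N th (Y w) + linform N th' (Y w).
    by rewrite /linform -big_split; apply: eq_bigr => i _; rewrite mulrDl.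
  have -> : linform N (fun i => th i - th' i) (Y w) = linform N th (Y w) - linform N th' (Y w).
    by rewrite /linform -sumrB; apply: eq_bigr => i _; rewrite mulrBl.
  set u := linform _ _ _; set v := linform _ _ _.
  rewrite (_ : u + v + (c + c') = (u + c) + (v + c')); last by ring.
  rewrite (_ : u - v + (c - c') = (u + c) - (v + c')); last by ring.
  by move: (u + c) (v + c') => A B; rewrite cosD cosB; field.
by rewrite !e// !eF.
Qed.

Lemma agree_lim (F_ : nat -> (nat -> R) -> R) F M : (forall n, agree (F_ n)) ->
  (forall n x, `|F_ n x| <= M) -> (forall x, F_ ^~ x @ \oo --> F x) -> agree F.
Proof.
move=> aF FM cF.
have b : bounded_rv (fun w => F (Z w)).
  by apply: (@bounded_cvg _ _ _ (fun n w => F_ n (Z w)) _ M) => // n; have [[]] := aF n.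
have b' : bounded_rv (fun w => F (Z' w)).
  by apply: (@bounded_cvg _ _ _ (fun n w => F_ n (Z' w)) _ M) => // n; have [_ []] := aF n.
split => // th c.
have e d0 (T0 : measurableType d0) (P0 : probability T0 R) Y : (forall i, measurable_fun setT (Y ^~ i)) ->
    (forall n, measurable_fun setT (fun w => F_ n (Y w))) ->
    mean P0 (fun w => F_ n (Y w) * cos (linform N th (Y w) + c)) @[n --> \oo] -->
    mean P0 (fun w => F (Y w) * cos (linform N th (Y w) + c)).
  move=> mY mF; apply: (@mean_cvg _ _ _ _ _ _ M).
  - by move=> n; apply: measurable_funM => //; case: (bounded_rv_cos th c mY).
  - move=> n w; rewrite normrM; apply: le_trans (FM n (Y w)).
    by rewrite ler_piMr// cos_max.
  - by move=> w; apply: cvgMl; exact: cF.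
have c1 := e _ _ P Z mZ (fun n => (let: And3 b _ _ := aF n in b).1).
have c2 := e _ _ P' Z' mZ' (fun n => (let: And3 _ b _ := aF n in b).1).
have ce : (fun n => mean P (fun w => F_ n (Z w) * cos (linform N th (Z w) + c))) =
    (fun n => mean P' (fun w => F_ n (Z' w) * cos (linform N th (Z' w) + c))).
  by apply/funext => n; have [_ _] := aF n; apply.
rewrite ce in c1; exact: (cvg_unique _ c1 c2).
Qed.

(** The walk that approximates [G (x j)] has drift [s = sin (xi * x j)], so each
step multiplies by [(1 + s) / 2] and [(1 - s) / 2], and a sine is a cosine
with a shifted phase. *)
Lemma agree_walk j (xi dl : R) (G : R -> (nat -> R) -> R) : (j < N)%N ->
  (forall y, agree (G y)) ->
  forall n a, agree (fun x => walk (G ^~ x) dl (sin (xi * x j)) n a).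
Proof.
move=> jN aG; elim=> [//|n IH] a /=.
pose th i : R := if i == j then xi else 0.
have s x : sin (xi * x j) = cos (linform N th x + - (pi / 2)).
  rewrite cosBpihalf /linform (bigD1 (Ordinal jN))//= /th eqxx big1 ?addr0// => i ij.
  by rewrite ifN ?mul0r//; apply: contraNneq ij => ij; apply/eqP/val_inj.
have h (F : (nat -> R) -> R) : agree F ->
    agree (fun x => (2^-1) * F x + 2^-1 * (F x * sin (xi * x j))).
  move=> aF; apply: agree_lin => //.
  under eq_fun do rewrite s.
  exact: agree_cos.
have h' (F : (nat -> R) -> R) : agree F ->
    agree (fun x => (2^-1) * F x + (- 2^-1) * (F x * sin (xi * x j))).
  move=> aF; apply: agree_lin => //.
  under eq_fun do rewrite s.
  exact: agree_cos.
have := agree_lin 1 1 (h _ (IH (a + dl))) (h' _ (IH (a - dl))).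
by congr agree; apply/funext => x; field.
Qed.

(** The coordinates are replaced by deterministic values one at a time. The
value of coordinate [j] is reached by a random walk whose endpoint has mean
[m * sin (x j / m)] and variance at most [m ^- 2], and which depends on [x j]
only through trigonometric polynomials. As [m] grows the endpoint tends to
[x j]. *)
Lemma bounded_lipschitz_agree j F : (j <= N)%N -> bounded_lipschitz j F -> agree F.
Proof.
elim: j F => [|j IH] F jN [mF [M FM] [L L0 FL]].
  have -> : F = fun=> F (fun=> 0); last exact: agree_cst.
  apply/funext => x; apply/eqP; rewrite -subr_eq0 -normr_le0.
  by apply: le_trans (FL _ _) _; rewrite /l1dist big_ord0 mulr0.
have aG y : agree (fun x => F (update x j y)).
  apply: IH (ltnW jN) _; split.
  - move=> d0 T0 Y mY; apply: (mF _ _ (fun w => update (Y w) j y)) => i.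
    by rewrite /update; case: (i == j) => //; exact: measurable_cst.
  - by exists M.
  - exists L => // x x'; apply: le_trans (FL _ _) _; rewrite ler_wpM2l//.
    rewrite /l1dist big_ord_recr/= /update eqxx subrr normr0 addr0.
    by apply: ler_sum => i _; rewrite ifN ?ltn_eqF.
pose m n : R := n.+1%:R.
pose G n x := walk (fun y => F (update x j y)) (m n ^- 3) (sin ((m n)^-1 * x j)) (n.+1 ^ 4) 0.
have m0 n : 0 < m n by rewrite ltr0n.
apply: (@agree_lim G F M).
- by move=> n; apply: (agree_walk _ _ _ aG).
- move=> n x; apply: walk_bounded => //; exact: sin_max.
move=> x; apply/cvgrPdist_le => e e0.
have FLj y z : `|F (update x j y) - F (update x j z)| <= L * `|y - z|.
  apply: le_trans (FL _ _) _; rewrite ler_wpM2l// /l1dist big_ord_recr/= /update eqxx.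
  by rewrite big1 ?add0r// => i _; rewrite ifN ?ltn_eqF// subrr normr0.
have Fx : F x = F (update x j (x j)).
  by congr F; apply/funext => i; rewrite /update; case: eqP => // ->.
have bd n : `|F x - G n x| <= L * (1 + `|x j| ^+ 3) / m n.
  set s := sin ((m n)^-1 * x j).
  have h1 := walk_error (m n ^- 3) (sin_max ((m n)^-1 * x j) : `|s| <= 1) L0 (_ : 0 < (m n)^-1) FLj (n.+1 ^ 4) 0 (m n * s).
  have {}h1 : `|G n x - F (update x j (m n * s))| <= L / m n.
    apply: le_trans (h1 _) _; first by rewrite invr_gt0.
    have -> : (n.+1 ^ 4)%:R = m n ^+ 4 by rewrite natrX.
    have -> : 0 + m n ^+ 4 * m n ^- 3 * s - m n * s = 0.
      by field; exact: lt0r_neq0.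
    rewrite -mulrA -mulrA ler_wpM2l//.
    rewrite -subr_ge0 [X in 0 <= X](_ : _ = s ^+ 2 / (2 * m n)); last by field; exact: lt0r_neq0.
    by rewrite divr_ge0 ?sqr_ge0// mulr_ge0// ltW.
  have h2 : `|F x - F (update x j (m n * s))| <= L * `|x j| ^+ 3 / m n.
    rewrite Fx; apply: le_trans (FLj _ _) _; rewrite -mulrA ler_wpM2l//.
    rewrite [X in `|X|](_ : _ = - m n * (s - (m n)^-1 * x j)); last by field; exact: lt0r_neq0.
    rewrite normrM normrN (gtr0_norm (m0 n)).
    apply: le_trans (ler_wpM2l (ltW (m0 n)) (norm_sinB_le _)) _.
    rewrite normrM (gtr0_norm (_ : 0 < (m n)^-1)) ?invr_gt0// exprMn mulrA.
    rewrite [leRHS]mulrC ler_wpM2r ?exprn_ge0//.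
    rewrite (_ : _ * _ = (m n)^-1 * (m n)^-1); last by field; exact: lt0r_neq0.
    by rewrite ler_piMr ?invr_ge0 ?(ltW (m0 n))// invf_le1 ?ler1n.
  rewrite (_ : F x - G n x = (F x - F (update x j (m n * s))) - (G n x - F (update x j (m n * s)))); last by ring.
  apply: le_trans (ler_normB _ _) _; apply: le_trans (lerD h2 h1) _.
  by rewrite mulrDr mulr1 mulrDl addrC.
near=> n; apply: le_trans (bd n) _.
set K := L * _; rewrite ler_pdivrMr// mulrC -ler_pdivrMr//.
apply: (@le_trans _ _ n%:R); last by rewrite ler_nat.
by near: n; exact: nbhs_infty_ger.
Unshelve. all: by end_near. Qed.

(** The trivial character is among those tested by [agree]. *)
Lemma law_identity F : bounded_lipschitz N F ->
  mean P (fun w => F (Z w)) = mean P' (fun w => F (Z' w)).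
Proof.
move=> bF; have [_ _] := bounded_lipschitz_agree (leqnn N) bF.
move=> /(_ (fun=> 0) 0).
have l0 x : cos (linform N (fun=> 0) x + 0) = 1.
  by rewrite /linform big1 ?addr0 ?cos0// => i _; rewrite mul0r.
have e d0 (T0 : measurableType d0) (P0 : probability T0 R) Y :
    mean P0 (fun w => F (Y w) * cos (linform N (fun=> 0) (Y w) + 0)) = mean P0 (fun w => F (Y w)).
  by apply: eq_mean => w; rewrite l0 mulr1.
by rewrite !e.
Qed.

End LawIdentity.

(** * Covariances of smooth functions of a Gaussian vector *)

Section SmoothFunctions.
Context {R : realType}.
Implicit Types (x y v : nat -> R) (g : (nat -> R) -> R).

Definition l1norm N x : R := \sum_(i < N) `|x i|.

(** The vector [p x] plays the role of the gradient of [g] at [x]; the bounds on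
it say that [g] is nondecreasing and 1-Lipschitz for the uniform norm. The
constant [C] bounds the deviation from linearity and is the quantity that
the halving argument drives to 0. *)
Definition gradual N (C : R) g : Prop :=
  [/\ measurable_functional g, forall x y, `|g x - g y| <= l1dist N x y &
      exists p : (nat -> R) -> nat -> R,
        [/\ forall i, measurable_functional (fun x => p x i), forall x i, 0 <= p x i,
            forall x, \sum_(i < N) p x i <= 1 &
            forall x v, `|g (fun i => x i + v i) - g x - linform N (p x) v| <= C * l1norm N v ^+ 2]].

Definition smooth N (C : R) g : Prop := gradual N C g /\ exists M : R, forall x, `|g x| <= M.

Lemma smooth_bounded_rv N C g d (T : measurableType d) (Z : T -> nat -> R) :
  (forall i, measurable_fun setT (Z ^~ i)) -> smooth N C g -> bounded_rv (fun w => g (Z w)).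
Proof. by move=> mZ [[mg _ _] [M gM]]; split; [exact: mg|exists M]. Qed.

(** Two independent copies of a centred Gaussian vector have a half mix with the
same law. *)
Definition half_mix x y : nat -> R := fun i => (x i + y i) / Num.sqrt 2.

Lemma sqrt2_gt0 : 0 < Num.sqrt 2 :> R. Proof. by rewrite sqrtr_gt0. Qed.

Lemma sqrt2_sqr : Num.sqrt 2 * Num.sqrt 2 = 2 :> R.
Proof. by rewrite -expr2 sqr_sqrtr. Qed.

Lemma l1dist_half_mix N z x y :
  Num.sqrt 2 * l1dist N (half_mix z x) (half_mix z y) = l1dist N x y.
Proof.
rewrite /l1dist mulr_sumr; apply: eq_bigr => i _.
rewrite -[X in X * _](ger0_norm (ltW sqrt2_gt0)) -normrM /half_mix; congr `|_|.
field; exact: lt0r_neq0 sqrt2_gt0.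
Qed.

Lemma half_mixC x y : half_mix x y = half_mix y x.
Proof. by apply/funext => i; rewrite /half_mix addrC. Qed.

Lemma measurable_half_mix d (T : measurableType d) (Z Y : T -> nat -> R) :
  (forall i, measurable_fun setT (Z ^~ i)) -> (forall i, measurable_fun setT (Y ^~ i)) ->
  forall i, measurable_fun setT (fun w => half_mix (Z w) (Y w) i).
Proof.
by move=> mZ mY i; apply: measurable_funM => //; apply: measurable_funD.
Qed.

(** Rescaling by [sqrt 2] keeps the gradient and divides the second-order
constant by [sqrt 2]. *)
Lemma half_mix_taylor N C g (p : (nat -> R) -> nat -> R) z x v :
  (forall x v, `|g (fun i => x i + v i) - g x - linform N (p x) v| <= C * l1norm N v ^+ 2) ->
  `|Num.sqrt 2 * g (half_mix z (fun i => x i + v i)) - Num.sqrt 2 * g (half_mix z x)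
    - linform N (p (half_mix z x)) v| <= C / Num.sqrt 2 * l1norm N v ^+ 2.
Proof.
move=> gp; have r0 := sqrt2_gt0; set r := Num.sqrt 2 in r0 *.
have := gp (half_mix z x) (fun i => v i / r).
have -> : (fun i => half_mix z x i + v i / r) = half_mix z (fun i => x i + v i).
  by apply/funext => i; rewrite /half_mix -mulrDl addrA.
have -> : linform N (p (half_mix z x)) (fun i => v i / r) = linform N (p (half_mix z x)) v / r.
  by rewrite /linform mulr_suml; apply: eq_bigr => i _; rewrite mulrA.
have -> : l1norm N (fun i => v i / r) = l1norm N v / r.
  rewrite /l1norm mulr_suml; apply: eq_bigr => i _.
  by rewrite normrM (gtr0_norm (_ : 0 < r^-1)) ?invr_gt0.
move=> h; have := ler_wpM2l (ltW r0) h.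
rewrite -{1}(gtr0_norm r0) -normrM; congr (`|_| <= _); first by field; exact: lt0r_neq0.
by field; exact: lt0r_neq0.
Qed.

Lemma smooth_slice N C g z : smooth N C g ->
  smooth N (C / Num.sqrt 2) (fun x => Num.sqrt 2 * g (half_mix z x)).
Proof.
move=> [[mg gL [p [mp p0 p1 gp]]] [M gM]]; split; [split|].
- move=> d T Z mZ; apply: measurable_funM => //; apply: (mg _ _ (fun w => half_mix z (Z w))).
  by apply: (measurable_half_mix (Z := fun=> z)) => // i; exact: measurable_cst.
- move=> x y; rewrite -mulrBr normrM (gtr0_norm sqrt2_gt0) -(l1dist_half_mix N z).
  by rewrite ler_wpM2l// ltW// sqrt2_gt0.
- exists (fun x => p (half_mix z x)); split => //.
    move=> i d T Z mZ; apply: (mp _ _ _ (fun w => half_mix z (Z w))).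
    by apply: (measurable_half_mix (Z := fun=> z)) => // j; exact: measurable_cst.
  by move=> x v; exact: half_mix_taylor.
- exists (Num.sqrt 2 * M) => x; rewrite normrM (gtr0_norm sqrt2_gt0).
  by rewrite ler_wpM2l// ltW// sqrt2_gt0.
Qed.

Lemma mean_linform d (T : measurableType d) (P : probability T R) N (p : T -> nat -> R) v :
  (forall i, bounded_rv (p ^~ i)) ->
  bounded_rv (fun w => linform N (p w) v) /\
  mean P (fun w => linform N (p w) v) = linform N (fun i => mean P (p ^~ i)) v.
Proof.
move=> bp; rewrite /linform; elim: N => [|N [bN eN]].
  split; first by under eq_fun do rewrite big_ord0; exact: bounded_rv_cst.
  by rewrite big_ord0 -[RHS](mean_cst P); apply: eq_mean => w; rewrite big_ord0.
have bv : bounded_rv (fun w => p w N * v N) by apply: bounded_rvM => //; exact: bounded_rv_cst.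
split; first by under eq_fun do rewrite big_ord_recr/=; exact: bounded_rvD.
rewrite big_ord_recr/= -eN mulrC -meanZ// -meanD//; last exact: bounded_rvZ.
by apply: eq_mean => w; rewrite big_ord_recr/= [v N * _]mulrC.
Qed.

(** Averaging over the second copy is an average of slices, and the class of
smooth functions is convex. *)
Lemma smooth_average N C g d (T : measurableType d) (P : probability T R) (Z : T -> nat -> R) :
  (forall i, measurable_fun setT (Z ^~ i)) -> smooth N C g ->
  smooth N (C / Num.sqrt 2) (fun x => Num.sqrt 2 * mean P (fun w => g (half_mix x (Z w)))).
Proof.
move=> mZ sg; have [[mg gL [p [mp p0 p1 gp]]] [M gM]] := sg.
have r0 := sqrt2_gt0.
have mix_cst x i : measurable_fun setT (fun w => half_mix x (Z w) i).
  by apply: (measurable_half_mix (Z := fun=> x)) => // j; exact: measurable_cst.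
have bg x : bounded_rv (fun w => g (half_mix x (Z w))) by exact: smooth_bounded_rv sg.
have bgr x : bounded_rv (fun w => Num.sqrt 2 * g (half_mix x (Z w))) by exact: bounded_rvZ.
have pl1 x i : (i < N)%N -> p x i <= 1.
  move=> iN; apply: le_trans (p1 x); rewrite (bigD1 (Ordinal iN))//= lerDl.
  by apply: sumr_ge0 => j _.
(* only the first [N] entries of [p x] are known to be bounded *)
pose p' x i := if (i < N)%N then p x i else 0.
have p'0 x i : 0 <= p' x i by rewrite /p'; case: ifP.
have mp' i : measurable_functional (fun x => p' x i).
  by rewrite /p'; case: (i < N)%N => // d0 T0 Y _; exact: measurable_cst.
have p'1 x i : `|p' x i| <= 1.
  by rewrite ger0_norm// /p'; case: ifP => // iN; exact: pl1.
have bp x i : bounded_rv (fun w => p' (half_mix x (Z w)) i).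
  by split; [exact: mp'|exists 1].
have mmean (F : (nat -> R) -> R) (K : R) : measurable_functional F -> (forall x, `|F x| <= K) ->
    measurable_functional (fun x => mean P (fun w => F (half_mix x (Z w)))).
  move=> mF FK d0 T0 Y mY.
  have /bounded_rv_mean : bounded_rv (fun z : T0 * T => F (half_mix (Y z.1) (Z z.2))).
    split; last by exists K.
    apply: (mF _ _ (fun z : T0 * T => half_mix (Y z.1) (Z z.2))).
    apply: measurable_half_mix => i.
      exact: (measurableT_comp (mY i) measurable_fst).
    exact: (measurableT_comp (mZ i) measurable_snd).
  by move=> /(_ P) [].
split; [split|].
- by move=> d0 T0 Y mY; apply: measurable_funM => //; exact: (mmean _ _ mg gM _ _ Y mY).
- move=> x y; rewrite -!meanZ// -meanB// ler_norml.
  apply: mean_itv; first exact: bounded_rvB.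
  move=> w; rewrite -ler_norml -mulrBr normrM (gtr0_norm r0) -(l1dist_half_mix N (Z w)).
  by rewrite ler_wpM2l ?(ltW r0)// !(half_mixC (Z w)).
- exists (fun x i => mean P (fun w => p' (half_mix x (Z w)) i)); split.
  + by move=> i; apply: (mmean _ 1 (mp' i)).
  + move=> x i; suff /andP[] : 0 <= mean P (fun w => p' (half_mix x (Z w)) i) <= 1 by [].
    by apply: mean_itv => // w; rewrite p'0 (le_trans (ler_norm _) (p'1 _ _)).
  + move=> x.
    have [b e] := mean_linform P N (fun=> 1) (bp x).
    have -> : \sum_(i < N) mean P (fun w => p' (half_mix x (Z w)) i) =
        linform N (fun i => mean P (fun w => p' (half_mix x (Z w)) i)) (fun=> 1).
      by apply: eq_bigr => i _; rewrite mulr1.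
    rewrite -e -[X in _ <= X](mean_cst P); apply: mean_le; [exact: b|exact: bounded_rv_cst|move=> w].
    apply: le_trans (p1 (half_mix x (Z w))); apply: ler_sum => i _.
    by rewrite mulr1 /p' ltn_ord.
  + move=> x v.
    have [b <-] := mean_linform P N v (bp x).
    rewrite -!meanZ// -meanB// -meanB//; last exact: bounded_rvB.
    rewrite ler_norml; apply: mean_itv; first by apply: bounded_rvB => //; exact: bounded_rvB.
    move=> w; rewrite -ler_norml.
    have -> : linform N (p' (half_mix x (Z w))) v = linform N (p (half_mix x (Z w))) v.
      by apply: eq_bigr => i _; rewrite /p' ltn_ord.
    by rewrite !(half_mixC _ (Z w)); exact: half_mix_taylor.
- exists (Num.sqrt 2 * M) => x; rewrite normrM (gtr0_norm r0) ler_wpM2l ?(ltW r0)//.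
  by rewrite ler_norml; apply: mean_itv => // w; rewrite -ler_norml.
Qed.

End SmoothFunctions.

Section HalvingArgument.
Context {R : realType} {d} {T : measurableType d} (P : probability T R)
  (Z : T -> nat -> R) (N : nat).

Definition tail (x : nat -> R) : nat -> R := fun i => x (N + i)%N.

Definition rvcov (U V : T -> R) : R := mean P (fun w => U w * V w) - mean P U * mean P V.

Let V w := 1 + l1norm N (Z w) + l1norm N (tail (Z w)).

Hypothesis mZ : forall i, measurable_fun setT (Z ^~ i).
Hypothesis V4 : P.-integrable setT (fun w => (V w ^+ 4)%:E).
Hypothesis centred : forall i, mean P (Z ^~ i) = 0.
Hypothesis stable : forall th c,
  mean P (fun w => cos (linform (N + N) th (Z w) + c)) =
  mean (P \x P)%E (fun w => cos (linform (N + N) th (half_mix (Z w.1) (Z w.2)) + c)).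
Variables lo hi : R.
Hypothesis cov_bound : forall p q : nat -> R,
  (forall i, 0 <= p i) -> (forall i, 0 <= q i) ->
  \sum_(i < N) p i <= 1 -> \sum_(i < N) q i <= 1 ->
  lo <= \sum_(i < N) \sum_(j < N) p i * q j * mean P (fun w => Z w i * Z w (N + j)%N) <= hi.

Let mtZ i : measurable_fun setT (fun w => tail (Z w) i).
Proof. exact: mZ. Qed.

Let V_ge1 w : 1 <= V w.
Proof.
by rewrite /V -addrA lerDl addr_ge0// sumr_ge0.
Qed.

Let l1_le_V w : l1norm N (Z w) <= V w.
Proof. by rewrite /V addrAC lerDr addr_ge0// sumr_ge0. Qed.

Let l1t_le_V w : l1norm N (tail (Z w)) <= V w.
Proof. by rewrite /V lerDr addr_ge0// sumr_ge0. Qed.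

Let dominated (F : T -> R) (k : R) : measurable_fun setT F ->
  (forall w, `|F w| <= k * V w ^+ 4) -> P.-integrable setT (EFin \o F).
Proof.
move=> mF FV; apply: (@le_integrable _ _ _ _ _ _ _ (fun w => (k * V w ^+ 4)%:E)) => //.
- exact/measurable_EFinP.
- move=> w _ /=; rewrite lee_fin; apply: le_trans (FV w) _; exact: ler_norm.
- exact: integrable_scale.
Qed.

Let V_le w k : (k <= 4)%N -> V w ^+ k <= V w ^+ 4.
Proof. by move=> k4; rewrite ler_weXn2l. Qed.

Let coord_le w (x : nat -> R) i : l1norm N x <= V w -> (i < N)%N -> `|x i| <= V w.
Proof.
move=> xV iN; apply: le_trans xV; rewrite /l1norm (bigD1 (Ordinal iN))//= lerDl.
exact: sumr_ge0.
Qed.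

Let integrable_coord i : (i < N + N)%N -> P.-integrable setT (EFin \o (Z ^~ i)).
Proof.
move=> iN; apply: (@dominated _ 1) => // w; rewrite mul1r.
apply: le_trans (V_le w (isT : (1 <= 4)%N)); rewrite expr1.
have [i1|i1] := ltnP i N; first exact: coord_le (l1_le_V w) i1.
rewrite -(subnKC i1); apply: (@coord_le w (tail (Z w))) => //.
by rewrite ltn_subLR.
Qed.

Let integrable_coordM i j : (i < N)%N -> (j < N)%N ->
  P.-integrable setT (EFin \o (fun w => Z w i * Z w (N + j)%N)).
Proof.
move=> iN jN; apply: (@dominated _ 1); first exact: measurable_funM.
move=> w; rewrite mul1r; apply: le_trans (V_le w (isT : (2 <= 4)%N)).
rewrite normrM expr2 ler_pM//; first exact: coord_le (l1_le_V w) iN.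
exact: (coord_le (x := tail (Z w))).
Qed.

Let m4 := mean P (fun w => V w ^+ 4).
Let B := 3 * m4 + m4 ^+ 2.

(** For a small second-order constant the two functions are nearly the linear
forms [p] and [q], whose covariance is the one bounded by [cov_bound]; the
error is controlled by the fourth moment of the vector. *)
Lemma cov_smooth_base C g h : 0 <= C <= 1 -> smooth N C g -> smooth N C h ->
  lo - C * B <= rvcov (fun w => g (Z w)) (fun w => h (tail (Z w))) <= hi + C * B.
Proof.
move=> /andP[C0 C1] sg sh; have bg := smooth_bounded_rv mZ sg.
have bh := smooth_bounded_rv mtZ sh.
have [[_ _ [p0 [_ p00 p01 gp]]] _] := sg; have [[_ _ [q0 [_ q00 q01 hq]]] _] := sh.
pose o : nat -> R := fun=> 0.
set p := p0 o; set q := q0 o.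
(* a covariance does not see the constants [g o] and [h o] *)
pose G w := g (Z w) - g o; pose H w := h (tail (Z w)) - h o.
have bG : bounded_rv G by apply: bounded_rvB => //; exact: bounded_rv_cst.
have bH : bounded_rv H by apply: bounded_rvB => //; exact: bounded_rv_cst.
have covE : rvcov (fun w => g (Z w)) (fun w => h (tail (Z w))) =
    mean P (fun w => G w * H w) - mean P G * mean P H.
  have eG : mean P G = mean P (fun w => g (Z w)) - g o.
    by rewrite meanB ?mean_cst//; exact: bounded_rv_cst.
  have eH : mean P H = mean P (fun w => h (tail (Z w))) - h o.
    by rewrite meanB ?mean_cst//; exact: bounded_rv_cst.
  have eGH : mean P (fun w => G w * H w) = mean P (fun w => g (Z w) * h (tail (Z w)))
     - h o * mean P (fun w => g (Z w)) - g o * mean P (fun w => h (tail (Z w))) + g o * h o.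
    rewrite -!meanZ// -[X in _ + X](mean_cst P) -meanB; [|exact: bounded_rvM|exact: bounded_rvZ].
    rewrite -meanB; [|by apply: bounded_rvB; [exact: bounded_rvM|exact: bounded_rvZ]|exact: bounded_rvZ].
    rewrite -meanD; [|do ![apply: bounded_rvB|exact: bounded_rvM|exact: bounded_rvZ]|exact: bounded_rv_cst].
    by apply: eq_mean => w; rewrite /G /H; ring.
  by rewrite /rvcov eG eH eGH; ring.
pose LX w := linform N p (Z w); pose LY w := linform N q (tail (Z w)).
have Zo w : Z w = (fun i => o i + Z w i) by apply/funext => i; rewrite add0r.
have tZo w : tail (Z w) = (fun i => o i + tail (Z w) i) by apply/funext => i; rewrite add0r.
have GX w : `|G w - LX w| <= C * V w ^+ 2.
  rewrite /G {1}Zo; apply: le_trans (gp o (Z w)) _; rewrite ler_wpM2l// lerXn2r ?nnegrE ?sumr_ge0//.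
  exact: le_trans ler01 (V_ge1 w).
have HY w : `|H w - LY w| <= C * V w ^+ 2.
  rewrite /H {1}tZo; apply: le_trans (hq o (tail (Z w))) _; rewrite ler_wpM2l// lerXn2r ?nnegrE ?sumr_ge0//.
  exact: le_trans ler01 (V_ge1 w).
have lin_le (r : nat -> R) (x : nat -> R) w : (forall i, 0 <= r i) -> \sum_(i < N) r i <= 1 ->
    l1norm N x <= V w -> `|linform N r x| <= V w.
  move=> r0 r1 xV; apply: le_trans (ler_norm_sum _ _ _) _.
  apply: (@le_trans _ _ (\sum_(i < N) r i * V w)).
    apply: ler_sum => i _; rewrite normrM ger0_norm// ler_wpM2l//.
    exact: coord_le xV (ltn_ord i).
  by rewrite -mulr_suml ler_piMl// (le_trans ler01 (V_ge1 w)).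
have LXV w : `|LX w| <= V w := lin_le _ _ _ (p00 o) (p01 o) (l1_le_V w).
have LYV w : `|LY w| <= V w := lin_le _ _ _ (q00 o) (q01 o) (l1t_le_V w).
have mLX : measurable_fun setT LX by exact: measurable_linform.
have mLY : measurable_fun setT LY by exact: (measurable_linform N q mtZ).
have V0 w : 0 <= V w := le_trans ler01 (V_ge1 w).
have iLX : P.-integrable setT (EFin \o LX).
  apply: (@dominated _ 1) => // w; rewrite mul1r.
  by apply: le_trans (LXV w) _; rewrite -[X in X <= _]expr1; exact: V_le.
have iLY : P.-integrable setT (EFin \o LY).
  apply: (@dominated _ 1) => // w; rewrite mul1r.
  by apply: le_trans (LYV w) _; rewrite -[X in X <= _]expr1; exact: V_le.
have iLXY : P.-integrable setT (EFin \o (fun w => LX w * LY w)).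
  apply: (@dominated _ 1); first exact: measurable_funM.
  move=> w; rewrite mul1r normrM; apply: le_trans (V_le w (isT : (2 <= 4)%N)).
  by rewrite expr2 ler_pM.
have mean_lin (r : nat -> R) (Y : T -> nat -> R) :
    (forall i, (i < N)%N -> P.-integrable setT (EFin \o (Y ^~ i))) ->
    (forall i, mean P (Y ^~ i) = 0) -> mean P (fun w => linform N r (Y w)) = 0.
  move=> iY Y0; have [|_ ->] := @integrable_mean_sum _ _ _ P _ (index_enum 'I_N) (fun i w => r i * Y w i).
    by move=> i; apply: integrable_scale; exact: iY.
  by rewrite big1// => i _; rewrite integrable_meanZ ?Y0 ?mulr0//; exact: iY.
have eLX : mean P LX = 0.
  by apply: mean_lin => // i iN; apply: integrable_coord; rewrite ltn_addr.
have eLY : mean P LY = 0.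
  apply: (mean_lin q (fun w => tail (Z w))) => [i iN|i]; last exact: centred.
  by apply: integrable_coord; rewrite ltn_add2l.
have eLXY : mean P (fun w => LX w * LY w) =
    \sum_(i < N) \sum_(j < N) p i * q j * mean P (fun w => Z w i * Z w (N + j)%N).
  have iin i j : (i < N)%N -> (j < N)%N ->
      P.-integrable setT (EFin \o (fun w => p i * q j * (Z w i * Z w (N + j)%N))).
    by move=> iN jN; apply: integrable_scale; exact: integrable_coordM.
  have inner i : (i < N)%N ->
      P.-integrable setT (EFin \o (fun w => \sum_(j < N) p i * q j * (Z w i * Z w (N + j)%N))) /\
      mean P (fun w => \sum_(j < N) p i * q j * (Z w i * Z w (N + j)%N)) =
      \sum_(j < N) p i * q j * mean P (fun w => Z w i * Z w (N + j)%N).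
    move=> iN.
    have [i1 e1] := integrable_mean_sum (index_enum 'I_N) (fun j => iin i j iN (ltn_ord j)).
    split => //; rewrite e1; apply: eq_bigr => j _; rewrite integrable_meanZ//.
    exact: integrable_coordM.
  have [_] := integrable_mean_sum (index_enum 'I_N) (fun i => (inner i (ltn_ord i)).1).
  move=> e1; transitivity (\sum_(i < N) mean P (fun w => \sum_(j < N) p i * q j * (Z w i * Z w (N + j)%N))); last first.
    by apply: eq_bigr => i _; exact: (inner i (ltn_ord i)).2.
  rewrite -e1; apply: eq_mean => w; rewrite /LX /LY /linform mulr_suml.
  apply: eq_bigr => i _; rewrite mulr_sumr; apply: eq_bigr => j _.
  by rewrite /tail; ring.
have /andP[lo1 hi1] : lo <= mean P (fun w => LX w * LY w) <= hi by rewrite eLXY; exact: (cov_bound (p00 o) (q00 o) (p01 o) (q01 o)).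
have m40 : 0 <= m4 by rewrite /m4 /mean Rintegral_ge0// => w _; exact: exprn_ge0.
have diff : `|mean P (fun w => G w * H w) - mean P (fun w => LX w * LY w)| <= C * (3 * m4).
  rewrite -integrable_meanB//; last exact: bounded_rv_integrable (bounded_rvM bG bH).
  rewrite mulrCA mulrA -integrable_meanZ; last exact: V4.
  apply: le_norm_mean.
  - apply: integrable_sub => //; exact: bounded_rv_integrable (bounded_rvM bG bH).
  - exact: integrable_scale.
  move=> w.
  rewrite (_ : G w * H w - LX w * LY w = LX w * (H w - LY w) + (G w - LX w) * LY w
    + (G w - LX w) * (H w - LY w)); last by ring.
  apply: le_trans (ler_normD _ _) _; apply: le_trans (lerD (ler_normD _ _) (lexx _)) _.
  rewrite !normrM.
  have V3 : V w ^+ 3 <= V w ^+ 4 by exact: V_le.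
  have t1 : `|LX w| * `|H w - LY w| <= C * V w ^+ 4.
    apply: le_trans (ler_pM (normr_ge0 _) (normr_ge0 _) (LXV w) (HY w)) _.
    by rewrite mulrCA -exprS ler_wpM2l.
  have t2 : `|G w - LX w| * `|LY w| <= C * V w ^+ 4.
    apply: le_trans (ler_pM (normr_ge0 _) (normr_ge0 _) (GX w) (LYV w)) _.
    by rewrite -mulrA -exprSr ler_wpM2l.
  have t3 : `|G w - LX w| * `|H w - LY w| <= C * V w ^+ 4.
    apply: le_trans (ler_pM (normr_ge0 _) (normr_ge0 _) (GX w) (HY w)) _.
    by rewrite mulrACA -exprD ler_wpM2r ?exprn_ge0// ler_piMl.
  by apply: le_trans (lerD (lerD t1 t2) t3) _; lra.
have mean_le_m4 (U L : T -> R) : bounded_rv U -> P.-integrable setT (EFin \o L) -> mean P L = 0 ->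
    (forall w, `|U w - L w| <= C * V w ^+ 2) -> `|mean P U| <= C * m4.
  move=> bU iL L0 UL; have iU := bounded_rv_integrable P bU.
  rewrite -[mean P U]subr0 -L0 -integrable_meanB// -integrable_meanZ//.
  apply: le_norm_mean; [exact: integrable_sub|exact: integrable_scale|].
  by move=> w; apply: le_trans (UL w) _; rewrite ler_wpM2l// V_le.
have mG := mean_le_m4 _ _ bG iLX eLX GX; have mH := mean_le_m4 _ _ bH iLY eLY HY.
have mGH : `|mean P G * mean P H| <= C * m4 ^+ 2.
  rewrite normrM; apply: le_trans (ler_pM (normr_ge0 _) (normr_ge0 _) mG mH) _.
  by rewrite mulrACA -expr2 ler_wpM2r ?sqr_ge0// ler_piMl.
rewrite covE /B mulrDr; move: diff mGH; rewrite !ler_norml.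
move=> /andP[? ?] /andP[? ?]; apply/andP; split; lra.
Qed.

Lemma smooth_prod_lipschitz C g h : smooth N C g -> smooth N C h ->
  [/\ bounded_lipschitz (N + N) g, bounded_lipschitz (N + N) (fun x => h (tail x)) &
      bounded_lipschitz (N + N) (fun x => g x * h (tail x))].
Proof.
move=> [[mg gL _] [M gM]] [[mh hL _] [K hK]].
have l1 x y : l1dist (N + N) x y = l1dist N x y + l1dist N (tail x) (tail y).
  by rewrite /l1dist big_split_ord.
have l0 n (x y : nat -> R) : 0 <= l1dist n x y by rewrite sumr_ge0.
have gL' x y : `|g x - g y| <= l1dist (N + N) x y.
  by apply: le_trans (gL x y) _; rewrite l1 lerDl.
have hL' x y : `|h (tail x) - h (tail y)| <= l1dist (N + N) x y.
  by apply: le_trans (hL _ _) _; rewrite l1 lerDr.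
have mht : measurable_functional (fun x => h (tail x)).
  by move=> d0 T0 Y mY; apply: (mh _ _ (fun w => tail (Y w))) => i; exact: mY.
have M0 : 0 <= M := le_trans (normr_ge0 _) (gM (fun=> 0)).
have K0 : 0 <= K := le_trans (normr_ge0 _) (hK (fun=> 0)).
split.
- split => //; first by exists M.
  by exists 1 => // x y; rewrite mul1r.
- split => //; first by exists K => x.
  by exists 1 => // x y; rewrite mul1r.
- split.
  + by move=> d0 T0 Y mY; apply: measurable_funM; [exact: mg|exact: mht].
  + by exists (M * K) => x; rewrite normrM ler_pM.
  + exists (K + M) => [|x y]; first exact: addr_ge0.
    rewrite (_ : g x * h (tail x) - g y * h (tail y) =
      (g x - g y) * h (tail x) + g y * (h (tail x) - h (tail y))); last by ring.
    apply: le_trans (ler_normD _ _) _; rewrite !normrM mulrDl.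
    apply: lerD; last by rewrite ler_pM.
    by rewrite [leRHS]mulrC ler_pM.
Qed.

(** Write the vector as the half mix of two independent copies and condition on
the first one: by the law of total covariance the covariance is half the mean
of the conditional covariances of [sqrt 2 * g] and [sqrt 2 * h], plus half the
covariance of their conditional means. Both are covariances of functions
whose second-order constant is smaller by a factor [sqrt 2]. *)
Lemma cov_halving C a b :
  (forall g h, smooth N (C / Num.sqrt 2) g -> smooth N (C / Num.sqrt 2) h ->
    a <= rvcov (fun w => g (Z w)) (fun w => h (tail (Z w))) <= b) ->
  forall g h, smooth N C g -> smooth N C h ->
    a <= rvcov (fun w => g (Z w)) (fun w => h (tail (Z w))) <= b.
Proof.
move=> IH g h sg sh; have r0 : 0 < Num.sqrt 2 :> R := sqrt2_gt0.
have rr : Num.sqrt 2 * Num.sqrt 2 = 2 :> R := sqrt2_sqr.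
set r := Num.sqrt 2 in r0 rr IH *.
pose Z2 (w : T * T) := half_mix (Z w.1) (Z w.2).
have mZ2 i : measurable_fun setT (Z2 ^~ i).
  apply: (measurable_half_mix (Z := fun w : T * T => Z w.1) (Y := fun w : T * T => Z w.2)) => j.
    exact: (measurableT_comp (mZ j) measurable_fst).
  exact: (measurableT_comp (mZ j) measurable_snd).
have [Lg Lh Lgh] := smooth_prod_lipschitz sg sh.
have toprod F : bounded_lipschitz (N + N) F -> mean P (fun w => F (Z w)) =
    mean P (fun w1 => mean P (fun w2 => F (half_mix (Z w1) (Z w2)))).
  move=> LF; rewrite (law_identity mZ mZ2 stable LF) mean_prod//.
  by have [mF [M FM] _] := LF; split; [exact: mF|exists M].
pose gt x := r * mean P (fun w => g (half_mix x (Z w))).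
pose ht x := r * mean P (fun w => h (half_mix x (tail (Z w)))).
have sgt : smooth N (C / r) gt by exact: smooth_average.
have sht : smooth N (C / r) ht by exact: (smooth_average P mtZ sh).
pose c w1 := rvcov (fun w => r * g (half_mix (Z w1) (Z w)))
                   (fun w => r * h (half_mix (tail (Z w1)) (tail (Z w)))).
have cab w : a <= c w <= b.
  exact: (IH _ _ (smooth_slice (Z w) sg) (smooth_slice (tail (Z w)) sh)).
have bgt := smooth_bounded_rv mZ sgt; have bht := smooth_bounded_rv mtZ sht.
have bs (x : nat -> R) : bounded_rv (fun w => g (half_mix x (Z w))).
  apply: (smooth_bounded_rv (Z := fun w => half_mix x (Z w))) sg.
  by apply: (measurable_half_mix (Z := fun=> x)) => // j; exact: measurable_cst.
have bs' (x : nat -> R) : bounded_rv (fun w => h (half_mix x (tail (Z w)))).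
  apply: (smooth_bounded_rv (Z := fun w => half_mix x (tail (Z w)))) sh.
  by apply: (measurable_half_mix (Z := fun=> x)) => // j; exact: measurable_cst.
have inner w1 : mean P (fun w2 => g (half_mix (Z w1) (Z w2)) * h (tail (half_mix (Z w1) (Z w2)))) =
    2^-1 * (c w1 + gt (Z w1) * ht (tail (Z w1))).
  rewrite /c /rvcov /gt /ht !meanZ// subrK.
  rewrite (_ : mean P (fun w => r * g (half_mix (Z w1) (Z w)) *
      (r * h (half_mix (tail (Z w1)) (tail (Z w))))) =
    r * r * mean P (fun w => g (half_mix (Z w1) (Z w)) * h (tail (half_mix (Z w1) (Z w))))).
    by rewrite rr mulKf.
  rewrite -meanZ; last by apply: bounded_rvM => //; exact: bs'.
  by apply: eq_mean => w; rewrite /tail /half_mix; ring.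
have bF2 : bounded_rv (fun w1 => mean P (fun w2 => g (half_mix (Z w1) (Z w2)) * h (tail (half_mix (Z w1) (Z w2))))).
  apply: (bounded_rv_mean P (F := fun z : T * T => g (half_mix (Z z.1) (Z z.2)) * h (tail (half_mix (Z z.1) (Z z.2))))).
  by have [mF [M FM] _] := Lgh; split; [exact: mF mZ2|exists M].
have bc : bounded_rv c.
  have -> : c = fun w1 => 2 * mean P (fun w2 => g (half_mix (Z w1) (Z w2)) * h (tail (half_mix (Z w1) (Z w2))))
      - gt (Z w1) * ht (tail (Z w1)).
    by apply/funext => w; rewrite inner; field.
  by apply: bounded_rvB; [exact: bounded_rvZ|exact: bounded_rvM].
have e : rvcov (fun w => g (Z w)) (fun w => h (tail (Z w))) =
    2^-1 * mean P c + 2^-1 * rvcov (fun w => gt (Z w)) (fun w => ht (tail (Z w))).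
  rewrite {1}/rvcov (toprod _ Lgh) (toprod _ Lg) (toprod _ Lh).
  under eq_mean do rewrite inner.
  rewrite meanZ; last by apply: bounded_rvD => //; exact: bounded_rvM.
  rewrite meanD//; last exact: bounded_rvM.
  rewrite /rvcov.
  have -> : mean P (fun w => gt (Z w)) = r * mean P (fun w1 => mean P (fun w2 => g (half_mix (Z w1) (Z w2)))).
    rewrite -meanZ//; apply: (bounded_rv_mean P (F := fun z : T * T => g (half_mix (Z z.1) (Z z.2)))).
    by have [mF [M FM] _] := Lg; split; [exact: mF mZ2|exists M].
  have -> : mean P (fun w => ht (tail (Z w))) = r * mean P (fun w1 => mean P (fun w2 => h (tail (half_mix (Z w1) (Z w2))))).
    rewrite -meanZ//; apply: (bounded_rv_mean P (F := fun z : T * T => h (tail (half_mix (Z z.1) (Z z.2))))).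
    by have [mF [M FM] _] := Lh; split; [exact: mF mZ2|exists M].
  move: (mean P (fun w1 => mean P (fun w2 => g _))) => A.
  move: (mean P (fun w1 => mean P (fun w2 => h _))) => D.
  rewrite (_ : r * A * (r * D) = 2 * (A * D)); last by rewrite -rr; ring.
  by field.
have /andP[c1 c2] := mean_itv P bc cab; have /andP[c3 c4] := IH _ _ sgt sht.
by rewrite e; apply/andP; split; lra.
Qed.

(** Halving [n] times makes the second-order constant [C / sqrt 2 ^+ n], at
which point the linear case applies up to an error that vanishes with [n]. *)
Lemma cov_smooth C g h : 0 <= C -> smooth N C g -> smooth N C h ->
  lo <= rvcov (fun w => g (Z w)) (fun w => h (tail (Z w))) <= hi.
Proof.
move=> C0 sg sh.
have r1 : 1 <= Num.sqrt 2 :> R by rewrite -[leLHS]sqrtr1 ler_sqrt// ler1n.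
have r0 : 0 < Num.sqrt 2 :> R := sqrt2_gt0.
have key n : C / Num.sqrt 2 ^+ n <= 1 ->
    lo - C / Num.sqrt 2 ^+ n * B <= rvcov (fun w => g (Z w)) (fun w => h (tail (Z w))) <= hi + C / Num.sqrt 2 ^+ n * B.
  move=> Cn.
  have : forall k, (k <= n)%N -> forall g h, smooth N (C / Num.sqrt 2 ^+ (n - k)) g -> smooth N (C / Num.sqrt 2 ^+ (n - k)) h ->
    lo - C / Num.sqrt 2 ^+ n * B <= rvcov (fun w => g (Z w)) (fun w => h (tail (Z w))) <= hi + C / Num.sqrt 2 ^+ n * B.
    elim=> [|k IHk] kn g' h'.
      by rewrite subn0; apply: cov_smooth_base; rewrite Cn divr_ge0// exprn_ge0// ltW.
    apply: cov_halving => g'' h''.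
    have -> : C / Num.sqrt 2 ^+ (n - k.+1) / Num.sqrt 2 = C / Num.sqrt 2 ^+ (n - k).
      by rewrite -mulrA -invfM -exprSr subnSK.
    exact: IHk (ltnW kn) _ _.
  by move=> /(_ n (leqnn n) g h); rewrite subnn expr0 divr1; apply.
have r2 k : k%:R <= Num.sqrt 2 ^+ (k * 2) :> R.
  by rewrite mulnC exprM sqr_sqrtr// -natrX ler_nat ltnW// ltn_expl.
have B0 : 0 <= B.
  have m0 : 0 <= mean P (fun w => V w ^+ 4) by rewrite /mean Rintegral_ge0// => w _; apply: exprn_ge0; exact: le_trans ler01 (V_ge1 w).
  by rewrite addr_ge0 ?mulr_ge0 ?sqr_ge0.
have small e : 0 < e -> exists n, C / Num.sqrt 2 ^+ n <= 1 /\ C / Num.sqrt 2 ^+ n * B <= e.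
  move=> e0.
  have CBe : 0 <= C * B / e by rewrite divr_ge0 ?mulr_ge0// ltW.
  have [k k1] : exists k, C + C * B / e <= Num.sqrt 2 ^+ (k * 2).
    exists (Num.bound (C + C * B / e)); apply: le_trans (r2 _).
    by apply/ltW/archi_boundP; rewrite addr_ge0.
  exists (k * 2)%N.
  have p0 : 0 < Num.sqrt 2 ^+ (k * 2) :> R by rewrite exprn_gt0.
  split; first by rewrite ler_pdivrMr// mul1r; apply: le_trans k1; rewrite lerDl.
  rewrite mulrAC ler_pdivrMr// -ler_pdivrMl// mulrC; apply: le_trans k1.
  by rewrite lerDr.
move: (rvcov _ _) key => c key.
apply/andP; split; apply/ler_addgt0Pr => e e0; have [n [n1 n2]] := small e e0.
  by have /andP[h1 _] := key n n1; rewrite -lerBlDr (le_trans _ h1)// lerB.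
by have /andP[_ h1] := key n n1; apply: le_trans h1 _; rewrite lerD2l.
Qed.

End HalvingArgument.

(** * Smooth approximation of lattice polynomials *)

Section SmoothLattice.
Context {R : realType}.
Implicit Types (x v : nat -> R) (sg ep : R).

(** A smooth version of the absolute value, exact when [sg = 0]. *)
Definition soft_abs sg z : R := Num.sqrt (z ^+ 2 + sg ^+ 2).

(** A smooth maximum for [ep = 1] and a smooth minimum for [ep = -1]. *)
Definition soft sg ep (a b : R) : R := (a + b + ep * soft_abs sg (a - b)) / 2.

Lemma soft_abs_sqr sg z : soft_abs sg z ^+ 2 = z ^+ 2 + sg ^+ 2.
Proof. by rewrite /soft_abs sqr_sqrtr// addr_ge0 ?sqr_ge0. Qed.

Lemma soft_abs_ge0 sg z : 0 <= soft_abs sg z. Proof. exact: sqrtr_ge0. Qed.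

Lemma soft_abs_ge sg z : `|z| <= soft_abs sg z.
Proof.
rewrite -(ler_pXn2r (ltn0Sn 1)) ?nnegrE ?soft_abs_ge0// soft_abs_sqr.
by rewrite real_normK ?num_real// lerDl sqr_ge0.
Qed.

Lemma soft_abs_le sg z : 0 <= sg -> soft_abs sg z <= `|z| + sg.
Proof.
move=> sg0; rewrite -(ler_pXn2r (ltn0Sn 1)) ?nnegrE ?soft_abs_ge0 ?addr_ge0//.
rewrite soft_abs_sqr sqrrD real_normK ?num_real// lerD2r lerDl.
by rewrite mulrn_wge0// mulr_ge0.
Qed.

Lemma soft_abs_gt0 sg z : 0 < sg -> 0 < soft_abs sg z.
Proof.
by move=> sg0; rewrite sqrtr_gt0 ltr_wpDl ?sqr_ge0// exprn_gt0.
Qed.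

Lemma soft_abs0 z : soft_abs 0 z = `|z|.
Proof. by rewrite /soft_abs expr0n addr0 sqrtr_sqr. Qed.

Lemma soft_abs_lipschitz sg y z : `|soft_abs sg y - soft_abs sg z| <= `|y - z|.
Proof.
have [sz|] := ltP 0 (soft_abs sg y + soft_abs sg z); last first.
  have := soft_abs_ge0 sg y; have := soft_abs_ge0 sg z => h1 h2 h3.
  by rewrite (_ : soft_abs sg y - soft_abs sg z = 0) ?normr0//; lra.
rewrite -(ler_pM2r sz) -{1}(gtr0_norm sz) -normrM -subr_sqr !soft_abs_sqr.
rewrite (_ : _ - _ = (y - z) * (y + z)); last by ring.
rewrite normrM ler_wpM2l//; apply: le_trans (ler_normD _ _) _.
by apply: lerD; exact: soft_abs_ge.
Qed.

Lemma soft_abs_taylor sg (y t : R) : 0 < sg ->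
  `|soft_abs sg (y + t) - soft_abs sg y - y / soft_abs sg y * t| <= t ^+ 2 / (2 * sg).
Proof.
move=> sg0; set A := soft_abs sg y; set B := soft_abs sg (y + t).
have A0 : 0 < A by exact: soft_abs_gt0.
have AA : A ^+ 2 = y ^+ 2 + sg ^+ 2 by exact: soft_abs_sqr.
have BB : B ^+ 2 = (y + t) ^+ 2 + sg ^+ 2 by exact: soft_abs_sqr.
have Asg : sg <= A.
  by rewrite -(ler_pXn2r (ltn0Sn 1)) ?nnegrE ?(ltW sg0) ?(ltW A0)// AA lerDr sqr_ge0.
have BAt : (B - A) ^+ 2 <= t ^+ 2.
  rewrite -[X in X <= _]real_normK ?num_real// -[X in _ <= X]real_normK ?num_real//.
  rewrite lerXn2r ?nnegrE//; apply: le_trans (soft_abs_lipschitz _ _ _) _.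
  by rewrite addrAC subrr add0r.
have -> : B - A - y / A * t = (t ^+ 2 - (B - A) ^+ 2) / (2 * A).
  have -> : (B - A) ^+ 2 = B ^+ 2 - 2 * A * B + A ^+ 2 by ring.
  have -> : B ^+ 2 = A ^+ 2 + 2 * y * t + t ^+ 2 by rewrite BB AA; ring.
  by field; exact: lt0r_neq0.
rewrite ger0_norm ?divr_ge0 ?subr_ge0 ?mulr_ge0 ?(ltW A0)//.
apply: (@le_trans _ _ (t ^+ 2 / (2 * A))).
  by rewrite ler_wpM2r ?invr_ge0 ?mulr_ge0 ?(ltW A0)// gerBl sqr_ge0.
by rewrite ler_wpM2l ?sqr_ge0// lef_pV2 ?posrE ?mulr_gt0// ler_pM2l.
Qed.

Lemma soft_close sg ep a b a' b' D : 0 <= sg -> `|ep| <= 1 ->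
  `|a - a'| <= D -> `|b - b'| <= D ->
  `|soft sg ep a b - soft sg ep a' b'| <= D.
Proof.
move=> sg0; rewrite ler_norml => /andP[e1 e2]; rewrite !ler_norml => /andP[a1 a2] /andP[b1 b2].
have := soft_abs_lipschitz sg (a - b) (a' - b').
rewrite /soft; move: (soft_abs sg (a - b)) (soft_abs sg (a' - b')) => S S'.
have h : `|ep * (S - S')| <= `|S - S'|.
  by rewrite normrM ler_piMl// ler_norml e1.
move=> SS; have {h}h := le_trans h SS.
have : -D <= (a - a' + (b - b') + ep * (S - S')) / 2 <= D.
  move: h; rewrite ler_norml => /andP[h1 h2].
  by case: (leP 0 (a - b - (a' - b'))) h1 h2 => s; rewrite ?(ger0_norm s) ?(ltr0_norm s) => h1 h2;
    apply/andP; split; lra.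
by move=> /andP[? ?]; apply/andP; split; lra.
Qed.

Lemma soft0_close sg ep a b : 0 <= sg -> `|ep| <= 1 ->
  `|soft sg ep a b - soft 0 ep a b| <= sg.
Proof.
move=> sg0 e1; rewrite /soft soft_abs0.
rewrite (_ : _ - _ = ep * (soft_abs sg (a - b) - `|a - b|) / 2); last by field.
have h1 := soft_abs_ge sg (a - b); have h2 := soft_abs_le (a - b) sg0.
rewrite normrM (gtr0_norm (_ : 0 < 2^-1)) ?invr_gt0// normrM.
rewrite ler_pdivrMr// (ger0_norm (_ : 0 <= _ - _)) ?subr_ge0//.
by apply: le_trans (ler_piMl _ e1) _; rewrite ?subr_ge0//; lra.
Qed.

Lemma soft_max a b : soft 0 1 a b = Num.max a b.
Proof.
rewrite /soft soft_abs0 mul1r; case: (leP a b) => ab.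
  by rewrite ler0_norm ?subr_le0//; field.
by rewrite gtr0_norm ?subr_gt0//; field.
Qed.

Lemma soft_min a b : soft 0 (-1) a b = Num.min a b.
Proof.
rewrite /soft soft_abs0 mulN1r; case: (leP a b) => ab.
  by rewrite ler0_norm ?subr_le0//; field.
by rewrite gtr0_norm ?subr_gt0//; field.
Qed.

Lemma continuous_soft_abs sg : continuous (soft_abs sg).
Proof.
move=> z; rewrite /soft_abs.
apply: (@cvg_comp _ _ _ (fun t : R => t ^+ 2 + sg ^+ 2) (@Num.sqrt R) _ (nbhs (z ^+ 2 + sg ^+ 2))).
  by apply: cvgD; [exact: exprn_continuous|exact: cvg_cst].
exact: sqrt_continuous.
Qed.

Lemma measurable_soft_abs sg d (T : measurableType d) (X : T -> R) :
  measurable_fun setT X -> measurable_fun setT (fun w => soft_abs sg (X w)).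
Proof.
move=> mX; apply: (@measurableT_comp _ _ _ _ _ _ (soft_abs sg)) => //.
apply: continuous_measurable_fun; exact: continuous_soft_abs.
Qed.

Lemma measurable_soft_slope sg d (T : measurableType d) (X : T -> R) : 0 < sg ->
  measurable_fun setT X -> measurable_fun setT (fun w => X w / soft_abs sg (X w)).
Proof.
move=> sg0 mX; pose f (z : R) := z / soft_abs sg z.
suff mf : measurable_fun setT f by exact: (measurableT_comp mf mX).
apply: continuous_measurable_fun => z; apply: cvgM; first exact: cvg_id.
apply: cvgV; last exact: continuous_soft_abs.
by rewrite gt_eqF// soft_abs_gt0.
Qed.

Lemma linform_lin N (p q : nat -> R) (k l : R) v :
  linform N (fun i => k * p i + l * q i) v = k * linform N p v + l * linform N q v.
Proof.
rewrite /linform !mulr_sumr -big_split/=; apply: eq_bigr => i _.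
by rewrite mulrDl !mulrA.
Qed.

(** The gradient of a soft maximum or minimum is a convex combination of the two
gradients, so its entries stay nonnegative with sum at most 1. *)
Lemma gradual_soft N sg ep C1 C2 (g1 g2 : (nat -> R) -> R) : 0 < sg -> `|ep| <= 1 ->
  0 <= C1 -> 0 <= C2 -> gradual N C1 g1 -> gradual N C2 g2 ->
  gradual N (C1 + C2 + sg^-1) (fun x => soft sg ep (g1 x) (g2 x)).
Proof.
move=> sg0 e1 C10 C20 [m1 L1 [p1 [mp1 p10 p11 t1]]] [m2 L2 [p2 [mp2 p20 p21 t2]]].
pose r x := ep * ((g1 x - g2 x) / soft_abs sg (g1 x - g2 x)).
have r1 x : `|r x| <= 1.
  rewrite /r normrM -[1]mulr1 ler_pM// normrM (ger0_norm (_ : 0 <= _^-1)) ?invr_ge0 ?soft_abs_ge0//.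
  by rewrite ler_pdivrMr ?soft_abs_gt0// mul1r soft_abs_ge.
have ra x : 0 <= (1 + r x) / 2 by have := r1 x; rewrite ler_norml => /andP[? ?]; lra.
have rb x : 0 <= (1 - r x) / 2 by have := r1 x; rewrite ler_norml => /andP[? ?]; lra.
split.
- move=> d T Z mZ; rewrite /soft; apply: measurable_funM => //.
  have a := m1 _ _ Z mZ; have b := m2 _ _ Z mZ.
  apply: measurable_funD; first exact: measurable_funD.
  by apply: measurable_funM => //; apply: measurable_soft_abs; exact: measurable_funB.
- by move=> x y; apply: soft_close => //; exact: ltW.
- exists (fun x i => (1 + r x) / 2 * p1 x i + (1 - r x) / 2 * p2 x i); split.
  + move=> i d T Z mZ.
    have mr : measurable_fun setT (fun w => r (Z w)).
      apply: measurable_funM => //; apply: measurable_soft_slope => //.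
      by apply: measurable_funB; [exact: m1|exact: m2].
    apply: measurable_funD; apply: measurable_funM; [|exact: mp1| |exact: mp2].
    * by apply: measurable_funM => //; exact: measurable_funD.
    * by apply: measurable_funM => //; exact: measurable_funB.
  + by move=> x i; rewrite addr_ge0// mulr_ge0.
  + move=> x; rewrite big_split/= -!mulr_sumr.
    apply: le_trans (lerD (ler_wpM2l (ra x) (p11 x)) (ler_wpM2l (rb x) (p21 x))) _; lra.
  + move=> x v; rewrite linform_lin.
    have h1 := t1 x v; have h2 := t2 x v.
    set y := (fun i => x i + v i) in h1 h2 *.
    set l1 := linform N (p1 x) v in h1 *; set l2 := linform N (p2 x) v in h2 *.
    set D1 := g1 y - g1 x - l1 in h1; set D2 := g2 y - g2 x - l2 in h2.
    pose u := (g1 y - g2 y) - (g1 x - g2 x).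
    have e3 := soft_abs_taylor (g1 x - g2 x) u sg0.
    have dl : l1dist N y x = l1norm N v.
      by rewrite /l1dist /l1norm; apply: eq_bigr => i _; rewrite /y addrAC subrr add0r.
    have ub : `|u| <= 2 * l1norm N v.
      rewrite /u (_ : _ - _ = (g1 y - g1 x) - (g2 y - g2 x)); last by ring.
      apply: le_trans (ler_normB _ _) _; rewrite mulr_natl mulr2n -dl.
      by apply: lerD; [exact: L1|exact: L2].
    have u2 : u ^+ 2 / (2 * sg) <= 2 * (l1norm N v ^+ 2 / sg).
      rewrite ler_pdivrMr ?mulr_gt0//.
      rewrite (_ : 2 * _ * _ = (2 * l1norm N v) ^+ 2); last by field; exact: lt0r_neq0.
      rewrite -[X in X <= _]real_normK ?num_real// lerXn2r ?nnegrE//.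
      exact: le_trans (normr_ge0 u) ub.
    rewrite (_ : g1 x - g2 x + u = g1 y - g2 y) in e3; last by rewrite /u; ring.
    set E := _ - _ - _ in e3.
    have E' : `|ep * E| <= 2 * (l1norm N v ^+ 2 / sg).
      rewrite normrM; apply: le_trans (ler_piMl (normr_ge0 _) e1) _.
      exact: le_trans e3 u2.
    rewrite (_ : _ - _ - _ = (1 + r x) / 2 * D1 + (1 - r x) / 2 * D2 + ep * E / 2); last first.
      by rewrite /soft /D1 /D2 /E /r /u; field; rewrite gt_eqF// soft_abs_gt0.
    have n0 : 0 <= l1norm N v ^+ 2 by exact: sqr_ge0.
    have k1 : `|(1 + r x) / 2 * D1| <= (1 + r x) / 2 * ((C1 + C2) * l1norm N v ^+ 2).
      rewrite normrM (ger0_norm (ra x)) ler_wpM2l//; apply: le_trans h1 _.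
      by rewrite ler_wpM2r// lerDl.
    have k2 : `|(1 - r x) / 2 * D2| <= (1 - r x) / 2 * ((C1 + C2) * l1norm N v ^+ 2).
      rewrite normrM (ger0_norm (rb x)) ler_wpM2l//; apply: le_trans h2 _.
      by rewrite ler_wpM2r// lerDr.
    apply: le_trans (ler_normD _ _) _; apply: le_trans (lerD (ler_normD _ _) (lexx _)) _.
    rewrite [X in _ + X]normrM (gtr0_norm (_ : 0 < 2^-1)) ?invr_gt0//.
    apply: le_trans (lerD (lerD k1 k2) (lexx _)) _.
    rewrite (_ : (C1 + C2 + sg^-1) * _ = (C1 + C2) * l1norm N v ^+ 2 + l1norm N v ^+ 2 / sg); last by ring.
    rewrite (_ : _ / 2 * _ + _ / 2 * _ = (C1 + C2) * l1norm N v ^+ 2); last by field.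
    by rewrite lerD2l ler_pdivrMr// [_ * 2]mulrC.
Qed.

Lemma gradual_cst N C (k : R) : 0 <= C -> gradual N C (fun=> k).
Proof.
move=> C0; split; first by move=> d T Z _; exact: measurable_cst.
  by move=> x y; rewrite subrr normr0 sumr_ge0.
exists (fun _ _ => 0); split => //.
- by move=> i d T Z _; exact: measurable_cst.
- by move=> x; rewrite big1.
- move=> x v; rewrite subrr (_ : linform _ _ _ = 0); last first.
    by rewrite /linform big1// => i _; rewrite mul0r.
  by rewrite subrr normr0; exact: mulr_ge0 C0 (sqr_ge0 _).
Qed.

Lemma gradual_coord N C k c : (k < N)%N -> 0 <= C -> gradual N C (fun x => x k + c).
Proof.
move=> kN C0; split.
- by move=> d T Z mZ; apply: measurable_funD.
- move=> x y; rewrite (_ : _ - _ = x k - y k); last by ring.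
  by rewrite /l1dist (bigD1 (Ordinal kN))//= lerDl sumr_ge0.
exists (fun _ i => (i == k)%:R); split.
- by move=> i d T Z _; exact: measurable_cst.
- by move=> x i; exact: ler0n.
- move=> x; rewrite (bigD1 (Ordinal kN))//= eqxx big1 ?addr0// => i ik.
  by rewrite (_ : (i == k :> nat) = false)//; apply: contraNF ik => /eqP ik; apply/eqP/val_inj.
- move=> x v.
  have -> : linform N (fun i => (i == k)%:R) v = v k.
    rewrite /linform (bigD1 (Ordinal kN))//= eqxx mul1r big1 ?addr0// => i ik.
    by rewrite (_ : (i == k :> nat) = false) ?mul0r//; apply: contraNF ik => /eqP ik; apply/eqP/val_inj.
  rewrite (_ : _ - _ - _ = 0); last by ring.
  by rewrite normr0; exact: mulr_ge0 C0 (sqr_ge0 _).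
Qed.

(** For [sg = 0] the functions below are
[min gm (min_(k < K) (x k + c k))] and
[max 0 (max_(j < J) min (gm j) (min_(k < K) (x k + c j k)))]. *)
Fixpoint soft_meet sg (gm : R) (c : nat -> R) K x : R :=
  if K is k.+1 then soft sg (-1) (soft_meet sg gm c k x) (x k + c k) else gm.

Fixpoint soft_join sg (gm : nat -> R) (c : nat -> nat -> R) K J x : R :=
  if J is j.+1 then soft sg 1 (soft_join sg gm c K j x) (soft_meet sg (gm j) (c j) K x) else 0.

Lemma gradual_soft_meet N sg gm c K : 0 < sg -> (K <= N)%N ->
  exists2 C, 0 <= C & gradual N C (soft_meet sg gm c K).
Proof.
move=> sg0; elim: K => [|K IH] KN /=; first by exists 0 => //; exact: gradual_cst.
have [C C0 gC] := IH (ltnW KN).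
exists (C + 0 + sg^-1); first by rewrite !addr_ge0 ?invr_ge0 ?(ltW sg0).
by apply: gradual_soft => //; [rewrite normrN1|exact: gradual_coord].
Qed.

Lemma gradual_soft_join N sg gm c K J : 0 < sg -> (K <= N)%N ->
  exists2 C, 0 <= C & gradual N C (soft_join sg gm c K J).
Proof.
move=> sg0 KN; elim: J => [|J [C C0 gC]] /=; first by exists 0 => //; exact: gradual_cst.
have [C' C'0 gC'] := gradual_soft_meet (gm J) (c J) sg0 KN.
exists (C + C' + sg^-1); first by rewrite !addr_ge0 ?invr_ge0 ?(ltW sg0).
by apply: gradual_soft => //; rewrite normr1.
Qed.

Lemma soft_meet_close sg gm c K x : 0 <= sg ->
  `|soft_meet sg gm c K x - soft_meet 0 gm c K x| <= K%:R * sg.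
Proof.
move=> sg0; elim: K => [|K IH] /=; first by rewrite subrr normr0 mul0r.
have e1 : `|-1| <= 1 :> R by rewrite normrN1.
rewrite (_ : _ - _ = (soft sg (-1) (soft_meet sg gm c K x) (x K + c K) - soft sg (-1) (soft_meet 0 gm c K x) (x K + c K))
  + (soft sg (-1) (soft_meet 0 gm c K x) (x K + c K) - soft 0 (-1) (soft_meet 0 gm c K x) (x K + c K))); last by ring.
apply: le_trans (ler_normD _ _) _; rewrite -addn1 natrD mulrDl mul1r.
apply: lerD; last exact: soft0_close.
by apply: soft_close => //; rewrite subrr normr0 mulr_ge0.
Qed.

Lemma soft_join_close sg gm c K J x : 0 <= sg ->
  `|soft_join sg gm c K J x - soft_join 0 gm c K J x| <= (K + J)%:R * sg.
Proof.
move=> sg0; elim: J => [|J IH] /=; first by rewrite subrr normr0 mulr_ge0.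
have e1 : `|1| <= 1 :> R by rewrite normr1.
set a := soft_join sg _ _ _ _ _ in IH *; set a0 := soft_join 0 _ _ _ _ _ in IH *.
have h := soft_meet_close (gm J) (c J) K x sg0.
set b := soft_meet sg _ _ _ _ in h *; set b0 := soft_meet 0 _ _ _ _ in h *.
rewrite (_ : _ - _ = (soft sg 1 a b - soft sg 1 a0 b0) + (soft sg 1 a0 b0 - soft 0 1 a0 b0)); last by ring.
apply: le_trans (ler_normD _ _) _; rewrite addnS -addn1 natrD mulrDl mul1r.
apply: lerD; last exact: soft0_close.
apply: soft_close => //; apply: le_trans h _.
by rewrite ler_wpM2r// ler_nat leq_addr.
Qed.

Lemma soft_meet_le gm c K x : soft_meet 0 gm c K x <= gm.
Proof. by elim: K => [//|K IH] /=; rewrite soft_min ge_min IH. Qed.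

Lemma soft_join_itv gm c K J x M : 0 <= M -> (forall j, gm j <= M) -> 0 <= soft_join 0 gm c K J x <= M.
Proof.
move=> M0 gM; elim: J => [|J /andP[h1 h2]] /=; first by rewrite lexx.
by rewrite soft_max le_max h1/= ge_max h2/= (le_trans (soft_meet_le _ _ _ _)).
Qed.

Lemma smooth_soft_join N sg gm c K J M : 0 < sg -> (K <= N)%N -> 0 <= M -> (forall j, gm j <= M) ->
  exists2 C, 0 <= C & smooth N C (soft_join sg gm c K J).
Proof.
move=> sg0 KN M0 gM; have [C C0 gC] := gradual_soft_join gm c J sg0 KN.
exists C => //; split => //; exists (M + (K + J)%:R * sg) => x.
rewrite -[soft_join _ _ _ _ _ _](subrK (soft_join 0 gm c K J x)).
apply: le_trans (ler_normD _ _) _; rewrite addrC lerD//; last first.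
  by apply: soft_join_close; exact: ltW.
by have /andP[h1 h2] := soft_join_itv c K J x M0 gM; rewrite ger0_norm.
Qed.

End SmoothLattice.

Section CovarianceLimits.
Context {R : realType} {d} {T : measurableType d} (P : probability T R).

Lemma rvcov_cvg (U_ V_ : nat -> T -> R) (U V : T -> R) (M : R) :
  (forall n, measurable_fun setT (U_ n)) -> (forall n, measurable_fun setT (V_ n)) ->
  (forall n w, `|U_ n w| <= M) -> (forall n w, `|V_ n w| <= M) ->
  (forall w, U_ ^~ w @ \oo --> U w) -> (forall w, V_ ^~ w @ \oo --> V w) ->
  rvcov P (U_ n) (V_ n) @[n --> \oo] --> rvcov P U V.
Proof.
move=> mU mV UM VM cU cV.
have hU := mean_cvg (P := P) mU UM cU; have hV := mean_cvg (P := P) mV VM cV.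
have hUV : mean P (fun w => U_ n w * V_ n w) @[n --> \oo] --> mean P (fun w => U w * V w).
  apply: (@mean_cvg _ _ _ P (fun n w => U_ n w * V_ n w) _ (M * M)).
  - by move=> n; exact: measurable_funM.
  - by move=> n w; rewrite normrM ler_pM.
  - by move=> w; apply: cvgM; [exact: cU|exact: cV].
exact: cvgB hUV (cvgM hU hV).
Qed.

Lemma rvcov_lim_itv (U_ V_ : nat -> T -> R) (U V : T -> R) (M lo hi : R) :
  (forall n, measurable_fun setT (U_ n)) -> (forall n, measurable_fun setT (V_ n)) ->
  (forall n w, `|U_ n w| <= M) -> (forall n w, `|V_ n w| <= M) ->
  (forall w, U_ ^~ w @ \oo --> U w) -> (forall w, V_ ^~ w @ \oo --> V w) ->
  (forall n, lo <= rvcov P (U_ n) (V_ n) <= hi) -> lo <= rvcov P U V <= hi.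
Proof.
move=> mU mV UM VM cU cV UV; have c := rvcov_cvg mU mV UM VM cU cV.
rewrite -(cvg_lim _ c)//; apply/andP; split.
  by apply: limr_ge; [exact: cvgP c|apply: nearW => n; case/andP: (UV n)].
by apply: limr_le; [exact: cvgP c|apply: nearW => n; case/andP: (UV n)].
Qed.

End CovarianceLimits.

(** * Characteristic functions of Gaussian variables *)

Section DensityMeasure.
Local Open Scope ereal_scope.
Context {d} {T : measurableType d} {R : realType}.
Variables (mu nu : {measure set T -> \bar R}) (p : T -> R).
Hypothesis mp : measurable_fun setT p.
Hypothesis p0 : forall x, (0 <= p x)%R.
Hypothesis nuE : forall A, measurable A -> nu A = \int[mu]_(x in A) (p x)%:E.

Import HBNNSimple.

Let density_nnsfun (h : {nnsfun T >-> R}) :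
  \int[nu]_x (h x)%:E = \int[mu]_x ((h x)%:E * (p x)%:E).
Proof.
under [LHS]eq_integral do rewrite fimfunE -fsumEFin//.
rewrite [LHS]ge0_integral_fsum//; last 2 first.
  - by move=> r; exact/measurable_EFinP/measurableT_comp.
  - by move=> n x _; rewrite EFinM nnfun_muleindic_ge0.
under [RHS]eq_integral.
  move=> x xD; rewrite fimfunE -fsumEFin// muleC ge0_mule_fsumr; last first.
    by move=> r; rewrite EFinM nnfun_muleindic_ge0.
  over.
rewrite [RHS]ge0_integral_fsum//; last 2 first.
  - move=> r; apply: emeasurable_funM; first exact/measurable_EFinP.
    exact/measurable_EFinP/measurableT_comp.
  - move=> n x _; apply: mule_ge0; first by rewrite lee_fin.
    by rewrite EFinM nnfun_muleindic_ge0.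
apply: eq_fsbigr => r _; rewrite integralZl_indic_nnsfun//= integral_indic//= setIT nuE//.
have [r0|r0] := ltP r 0%R.
  by rewrite preimage_nnfun0//= integral_set0 mule0 integral0_eq// => x _; rewrite indic0 mulr0 mule0.
rewrite integral_mkcond -ge0_integralZl//; last 2 first.
  - by apply/(measurable_restrictT _ _).1 => //; exact/measurable_EFinP/measurable_funTS.
  - by move=> x _; rewrite patchE; case: ifP => // _; rewrite lee_fin.
apply: eq_integral => x _; rewrite patchE indicE; case: ifP => _.
  by rewrite mulr1 muleC.
by rewrite mulr0 !mule0.
Qed.

(** By monotone approximation from simple functions. *)
Lemma ge0_integral_density (f : T -> \bar R) : measurable_fun setT f -> (forall x, 0 <= f x) ->
  \int[nu]_x f x = \int[mu]_x (f x * (p x)%:E).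
Proof.
move=> mf f0; pose f_ := nnsfun_approx measurableT mf.
transitivity (limn (fun n => \int[nu]_x (f_ n x)%:E)).
  rewrite -monotone_convergence//=.
  - apply: eq_integral => x _; apply/esym/cvg_lim => //=.
    by apply: cvg_nnsfun_approx.
  - by move=> n; exact/measurable_EFinP/measurable_funTS.
  - by move=> n x _; rewrite lee_fin.
  - by move=> x _ a b ab; rewrite lee_fin//; exact/lefP/nd_nnsfun_approx.
rewrite (_ : \int[mu]_x _ = limn (fun n => \int[mu]_x ((f_ n x)%:E * (p x)%:E))); last first.
  rewrite -monotone_convergence//=.
  - apply: eq_integral => x _; apply/esym/cvg_lim => //.
    apply: cvgeZr => //; by apply: cvg_nnsfun_approx.
  - move=> n; apply: emeasurable_funM; first exact/measurable_EFinP/measurable_funTS.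
    exact/measurable_EFinP.
  - by move=> n x _; rewrite mule_ge0// lee_fin.
  - move=> x _ a b ab; apply: lee_wpmul2r; first by rewrite lee_fin.
    by rewrite lee_fin//; exact/lefP/nd_nnsfun_approx.
by congr (limn _); apply/funext => n /=; exact: density_nnsfun.
Qed.

End DensityMeasure.

Section NormalShift.
Context {R : realType} (m s : R).
Hypothesis s0 : s != 0.
Local Notation mu := (@lebesgue_measure R).

Lemma ge0_integral_lebesgue_shift (G : R -> R) h : continuous G -> (forall x, 0 <= G x) ->
  (\int[mu]_x (G x)%:E = \int[mu]_x (G (x + h))%:E)%E.
Proof.
move=> cG G0.
pose F := (fun x : R => x + h).
have dF (x : R) : is_derive x 1 F 1.
  by rewrite -[X in is_derive _ _ _ X]addr0; apply: is_deriveD.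
have F' : derive1 F = cst 1.
  by apply/funext => x; rewrite derive1E; have [_ ->] := dF x.
rewrite (@increasing_ge0_integration_by_substitutionT _ F G)//.
- by apply: eq_integral => x _; rewrite F'/= /GRing.mul/= mulr1.
- by move=> x y xy; rewrite /F ltrD2r.
- by rewrite F' => x; exact: cvg_cst.
- by rewrite F'; exact: is_cvg_cst.
- by rewrite F'; exact: is_cvg_cst.
- exact: cvg_addrr_Ny.
- exact: cvg_addrr.
Qed.

Lemma normal_pdf_shift x h :
  normal_pdf m s (x - s ^+ 2 * h) =
  normal_pdf m s x * expR (h * (x - m) - s ^+ 2 * h ^+ 2 / 2).
Proof.
have E y : normal_pdf m s y = normal_peak s * normal_fun m s y by rewrite /normal_pdf (negbTE s0).
rewrite !E /normal_fun -[RHS]mulrA -expRD; congr (_ * expR _).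
by field; rewrite s0.
Qed.

Lemma ge0_integral_normal_prob (f : R -> \bar R) : measurable_fun setT f ->
  (forall x, (0 <= f x)%E) ->
  (\int[normal_prob m s]_x f x = \int[mu]_x (f x * (normal_pdf m s x)%:E))%E.
Proof.
move=> mf f0.
apply: (@ge0_integral_density _ (measurableTypeR R) R mu (normal_prob m s)) => //.
- exact: measurable_normal_pdf.
- by move=> x; exact: normal_pdf_ge0.
Qed.

(** The Cameron-Martin formula in dimension one: translating a normal variable
amounts to weighting it with an exponential. *)
Lemma ge0_normal_shift (G : R -> R) h : continuous G -> (forall x, 0 <= G x) ->
  (\int[normal_prob m s]_x (G (x + s ^+ 2 * h)%R)%:E =
   \int[normal_prob m s]_x (G x * expR (h * (x - m) - s ^+ 2 * h ^+ 2 / 2))%:E)%E.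
Proof.
move=> cG G0.
have cshift : continuous (fun x => G (x + s ^+ 2 * h)).
  move=> x; apply: (@cvg_comp _ _ _ (fun t => t + s ^+ 2 * h) G); last exact: cG.
  by apply: cvgD; [exact: cvg_id|exact: cvg_cst].
have cE : continuous (fun x => expR (h * (x - m) - s ^+ 2 * h ^+ 2 / 2)).
  move=> x; apply: (@cvg_comp _ _ _ (fun t => h * (t - m) - s ^+ 2 * h ^+ 2 / 2) expR); last exact: continuous_expR.
  apply: cvgB; last exact: cvg_cst.
  by apply: cvgM; [exact: cvg_cst|apply: cvgB; [exact: cvg_id|exact: cvg_cst]].
have cp := @continuous_normal_pdf _ m _ s0.
rewrite !ge0_integral_normal_prob; first last.
- by move=> x; rewrite lee_fin.
- by apply/measurable_EFinP; apply: continuous_measurable_fun; exact: cshift.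
- by move=> x; rewrite lee_fin mulr_ge0// expR_ge0.
- apply/measurable_EFinP; apply: continuous_measurable_fun => x.
  by apply: cvgM; [exact: cG|exact: cE].
under eq_integral do rewrite -EFinM.
under [RHS]eq_integral do rewrite -EFinM.
rewrite (@ge0_integral_lebesgue_shift _ (- (s ^+ 2 * h))); first last.
- by move=> x; rewrite mulr_ge0// normal_pdf_ge0.
- by move=> x; apply: cvgM; [exact: cshift|exact: cp].
apply: eq_integral => x _; rewrite subrK normal_pdf_shift; congr (_%:E).
by ring.
Qed.

End NormalShift.

Section GaussianVariables.
Context {R : realType}.

Lemma taylor1_le (f df : R -> R) (L : R) : (forall x : R, is_derive x 1 f (df x)) ->
  (forall x y, `|df x - df y| <= L * `|x - y|) ->
  forall a b, `|f (a + b) - f a - b * df a| <= L * b ^+ 2.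
Proof.
move=> hf hL a b; have [c] := MVT_between hf a (a + b).
rewrite (_ : a + b - a = b); last by ring.
move=> cb ->; rewrite mulrC -mulrBr normrM.
have L0 : 0 <= L by have := hL 1 0; rewrite subr0 normr1 mulr1; exact: le_trans.
rewrite -real_normK ?num_real// expr2 mulrCA ler_wpM2l//.
by apply: le_trans (hL c a) _; rewrite ler_wpM2l.
Qed.

Lemma sin_taylor1 (a b : R) : `|sin (a + b) - sin a - b * cos a| <= b ^+ 2.
Proof.
rewrite -[leRHS]mul1r; apply: (@taylor1_le sin cos 1) => x y.
have [c _ ->] := MVT_between (@is_derive_cos R) y x.
by rewrite normrM ler_wpM2r// normrN sin_max.
Qed.

Lemma cos_taylor1 (a b : R) : `|cos (a + b) - cos a + b * sin a| <= b ^+ 2.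
Proof.
rewrite -[leRHS]mul1r -[b * sin a]opprK -mulrN.
apply: (@taylor1_le cos (fun x => - sin x) 1) => x y.
have [c _] := MVT_between (@is_derive_sin R) y x.
rewrite -opprD normrN => ->.
by rewrite normrM ler_wpM2r// cos_max.
Qed.

Lemma expR_taylor1 (u : R) : `|expR u - 1 - u| <= u ^+ 2 * expR `|u|.
Proof.
have [c] := MVT_between (@is_derive_expR R) 0 u.
have [b] := MVT_between (@is_derive_expR R) 0 c.
rewrite expR0 !subr0 => bc ec cu ->.
rewrite -{2}[u]mul1r -mulrBl normrM ec normrM.
rewrite -(real_normK (num_real u)) expr2 [leRHS]mulrAC ler_wpM2r// [leRHS]mulrC ler_pM//.
rewrite ger0_norm ?expR_ge0// ler_expR (le_trans (ler_norm b))//.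
exact: le_trans bc cu.
Qed.

Lemma is_derive_taylor1 (f : R -> R) (t D C : R) :
  (forall d, `|f (t + d) - f t - d * D| <= C * d ^+ 2) -> is_derive t 1 f D.
Proof.
move=> fC; have C0 : 0 <= C by have := fC 1; rewrite expr1n mulr1; exact: le_trans.
have c : h^-1 *: (f (h *: 1 + t) - f t) @[h --> 0^'] --> D.
  apply/cvgrPdist_le => e e0; near=> h.
  have h0 : h != 0 by near: h; exact: nbhs_dnbhs_neq.
  rewrite distrC /GRing.scale/= mulr1 [h + t]addrC.
  rewrite (_ : _ - D = h^-1 * (f (t + h) - f t - h * D)); last by field.
  rewrite normrM normfV ler_pdivrMl ?normr_gt0//; apply: le_trans (fC h) _.
  rewrite -real_normK ?num_real// expr2 mulrCA ler_wpM2l//.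
  have hs : `|h| <= e / (C + 1).
    near: h; apply: dnbhs0_le; rewrite divr_gt0// ltr_wpDl//.
  apply: le_trans (ler_wpM2l C0 hs) _.
  by rewrite mulrCA ler_piMr ?(ltW e0)// ler_pdivrMr ?ltr_wpDl// mul1r lerDl.
by apply: DeriveDef; [exact: cvgP c|exact: cvg_lim c].
Unshelve. all: by end_near. Qed.

Lemma eq0_of_quadratic (A C : R) : (forall h, 0 < h <= 1 -> `|h * A| <= C * h ^+ 2) -> A = 0.
Proof.
move=> AC; apply/eqP; rewrite -normr_le0; apply/ler_addgt0Pr => e e0; rewrite add0r.
have C0 : 0 <= C by have := AC 1; rewrite ltr01 lexx expr1n mulr1 => /(_ isT); exact: le_trans.
pose h := Num.min 1 (e / (C + 1)).
have h0 : 0 < h by rewrite lt_min ltr01 divr_gt0// ltr_wpDl.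
have h1 : h <= 1 by rewrite ge_min lexx.
have := AC h; rewrite h0 h1 => /(_ isT); rewrite normrM gtr0_norm// expr2 mulrCA ler_pM2l//.
move=> /le_trans; apply.
apply: (@le_trans _ _ (C * (e / (C + 1)))).
  by rewrite ler_wpM2l// ge_min lexx orbT.
by rewrite mulrCA ler_piMr ?(ltW e0)// ler_pdivrMr ?ltr_wpDl// mul1r lerDl.
Qed.

Context {d} {T : measurableType d} (P : probability T R).

(** The density of the law translated by [s ^+ 2 * h] with respect to the law
itself. *)
Definition tilt (m s h x : R) : R := expR (h * (x - m) - s ^+ 2 * h ^+ 2 / 2).

Lemma continuous_tilt m s h : continuous (tilt m s h).
Proof.
move=> x; apply: (@cvg_comp _ _ _ (fun t => h * (t - m) - s ^+ 2 * h ^+ 2 / 2) expR); last exact: continuous_expR.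
apply: cvgB; last exact: cvg_cst.
by apply: cvgM; [exact: cvg_cst|apply: cvgB; [exact: cvg_id|exact: cvg_cst]].
Qed.

(** The only property of the normal law used afterwards. It includes the
degenerate case [s = 0], where both sides are the value of [G] at [m]. *)
Lemma gaussian_rv_shift (Y : T -> R) : gaussian_rv P Y ->
  measurable_fun setT Y /\ exists m s : R, forall (G : R -> R) h, continuous G -> (forall x, 0 <= G x) ->
    (\int[P]_w (G (Y w + s ^+ 2 * h))%:E = \int[P]_w (G (Y w) * tilt m s h (Y w))%:E)%E.
Proof.
move=> [mY [m [s mus]]]; split => //; exists m, s => G h cG G0.
have cshift : continuous (fun x => G (x + s ^+ 2 * h)).
  move=> x; apply: (@cvg_comp _ _ _ (fun t => t + s ^+ 2 * h) G); last exact: cG.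
  by apply: cvgD; [exact: cvg_id|exact: cvg_cst].
have cGt : continuous (fun x => G x * tilt m s h x).
  by move=> x; apply: cvgM; [exact: cG|exact: continuous_tilt].
pose Y' : T -> measurableTypeR R := Y.
have mY' : measurable_fun setT Y' by exact: mY.
have mF (F : R -> R) : continuous F -> measurable_fun setT (F : measurableTypeR R -> R).
  by move=> cF; have := continuous_measurable_fun cF.
have push (F : R -> R) : continuous F -> (forall x, 0 <= F x) ->
    (\int[P]_w (F (Y w))%:E = \int[pushforward P Y']_x (F x)%:E)%E.
  move=> cF F0; have mFF := mF F cF.
  rewrite ge0_integral_pushforward ?preimage_setT//; first exact/measurable_EFinP.
  by move=> x _; rewrite lee_fin.
rewrite (push _ cshift)//; rewrite (push _ cGt); last first.
  by move=> x; rewrite mulr_ge0// expR_ge0.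
have [s0|s0] := eqVneq s 0.
  have eD (F : R -> R) : continuous F ->
      (\int[pushforward P Y']_x (F x)%:E = (F m)%:E)%E.
    move=> cF; have mFF := mF F cF.
    rewrite (@eq_measure_integral _ (measurableTypeR R) R setT (@dirac _ (measurableTypeR R) m R)) => [|A mA _]; last first.
      by move: (mus A mA); rewrite s0 eqxx.
    rewrite integral_dirac//= ?diracT ?mul1e//.
    exact/measurable_EFinP.
  rewrite !eD//; congr (_%:E); rewrite /tilt s0 expr0n/= subrr !mul0r mulr0 subrr expR0 mulr1.
  by rewrite addr0.
have eN (F : R -> R) : (\int[pushforward P Y']_x (F x)%:E = \int[normal_prob m s]_x (F x)%:E)%E.
  rewrite [LHS](@eq_measure_integral _ _ _ setT (normal_prob m s))// => A mA _.
  by move: (mus A mA); rewrite (negbTE s0).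
by rewrite !eN ge0_normal_shift.
Qed.

Section OneVariable.
Variables (Y : T -> R) (m s : R).
Hypothesis mY : measurable_fun setT Y.
Hypothesis shift : forall (G : R -> R) h, continuous G -> (forall x, 0 <= G x) ->
    (\int[P]_w (G (Y w + s ^+ 2 * h))%:E = \int[P]_w (G (Y w) * tilt m s h (Y w))%:E)%E.
Let X w := Y w - m.

Let mX : measurable_fun setT X.
Proof. exact: measurable_funB. Qed.

Let mtilt h : measurable_fun setT (fun w => tilt m s h (Y w)).
Proof.
apply: (@measurableT_comp _ _ _ _ _ _ (tilt m s h)) => //.
apply: continuous_measurable_fun; exact: continuous_tilt.
Qed.

Let tilt_mean h : (\int[P]_w (tilt m s h (Y w))%:E = 1)%E.
Proof.
transitivity (\int[P]_w (cst 1 (Y w + s ^+ 2 * h)%R)%:E)%E; last first.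
  transitivity (\int[P]_w cst 1%E w)%E => //.
  by rewrite integral_cst// mul1e; exact: probability_setT.
rewrite (@shift (cst 1) h)//; last by move=> x; exact: cvg_cst.
by apply: eq_integral => w _; rewrite mul1r.
Qed.

Let integrable_tilt h : P.-integrable setT (EFin \o (fun w => tilt m s h (Y w))).
Proof.
apply/integrableP; split; first exact/measurable_EFinP.
under eq_integral do rewrite /= ger0_norm ?expR_ge0//.
by rewrite tilt_mean ltry.
Qed.

Let expX h : P.-integrable setT (EFin \o (fun w => expR (h * X w))).
Proof.
have -> : (fun w => expR (h * X w)) = (fun w => expR (s ^+ 2 * h ^+ 2 / 2) * tilt m s h (Y w)).
  by apply/funext => w; rewrite /tilt -expRD; congr expR; rewrite /X; ring.
exact: integrable_scale.
Qed.

Let D w := expR (4 * X w) + expR (- 4 * X w).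

Let iD : P.-integrable setT (EFin \o D).
Proof. exact: (integrableD measurableT (expX 4) (expX (-4))). Qed.

Let exp_le_D w : expR (4 * `|X w|) <= D w.
Proof.
rewrite /D; case: (leP 0 (X w)) => x0.
  by rewrite ger0_norm// lerDl expR_ge0.
by rewrite ltr0_norm// mulrN -mulNr lerDr expR_ge0.
Qed.

Let D1 w : 1 <= D w.
Proof.
by apply: le_trans (exp_le_D w); rewrite -[leLHS]expR0 ler_expR mulr_ge0.
Qed.

Let X_le_exp w : `|X w| <= expR `|X w|.
Proof. by apply: le_trans (expR_ge1Dx _); rewrite lerDr. Qed.

Let X4_le_D w : `|X w ^+ 4| <= D w.
Proof.
rewrite normrX; apply: le_trans (exp_le_D w).
by rewrite expRM_natl lerXn2r// nnegrE ?expR_ge0.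
Qed.

Lemma gaussian_integrable4 : P.-integrable setT (EFin \o (fun w => X w ^+ 4)).
Proof.
apply: (le_integrable measurableT _ _ iD); first by apply/measurable_EFinP; exact: measurable_funX.
by move=> w _ /=; rewrite lee_fin (le_trans (X4_le_D w))// ler_norm.
Qed.

Let X2_le_D w : `|X w ^+ 2| <= D w.
Proof.
rewrite normrX; apply: le_trans (exp_le_D w); apply: (@le_trans _ _ (expR `|X w| ^+ 2)).
  by rewrite lerXn2r// nnegrE ?expR_ge0.
by rewrite -expRM_natl ler_expR ler_wpM2r// ler_nat.
Qed.

Let X_le_D w : `|X w| <= D w.
Proof.
apply: le_trans (X_le_exp w) _; apply: le_trans (exp_le_D w).
by rewrite ler_expR ler_peMl// ler1n.
Qed.

Let iX2 : P.-integrable setT (EFin \o (fun w => X w ^+ 2)).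
Proof.
apply: (le_integrable measurableT _ _ iD); first by apply/measurable_EFinP; exact: measurable_funX.
by move=> w _ /=; rewrite lee_fin (le_trans (X2_le_D w))// ler_norm.
Qed.

Let iXM (F : T -> R) : measurable_fun setT F -> (forall w, `|F w| <= 1) ->
  P.-integrable setT (EFin \o (fun w => X w * F w)).
Proof.
move=> mF F1; apply: (le_integrable measurableT _ _ iD).
  by apply/measurable_EFinP; exact: measurable_funM.
move=> w _ /=; rewrite lee_fin (le_trans _ (ler_norm _))// (le_trans _ (X_le_D w))//.
by rewrite normrM ler_piMr.
Qed.

Let K := expR (3 * s ^+ 2) + s ^+ 2.

(** The linear part in [h] of the tilt is [X], which is how moments against [X]
are obtained from the shift formula. *)
Let tilt_taylor h w : 0 < h <= 1 -> `|tilt m s h (Y w) - 1 - h * X w| <= h ^+ 2 * (K * D w).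
Proof.
move=> /andP[h0 h1].
rewrite /tilt -/(X w); set u := h * X w - _.
pose a := `|X w| + s ^+ 2.
have s20 : 0 <= s ^+ 2 := sqr_ge0 s.
have a0 : 0 <= a by rewrite addr_ge0.
have ua : `|u| <= h * a.
  apply: le_trans (ler_normB _ _) _; rewrite normrM (gtr0_norm h0) mulrDr lerD2l.
  rewrite ger0_norm; last by rewrite divr_ge0// mulr_ge0// sqr_ge0.
  by have := mulr_ge0 (ltW h0) s20; nra.
have ua' : `|u| <= a by apply: le_trans ua _; rewrite ler_piMl.
have a_le : a <= expR a by apply: le_trans (expR_ge1Dx _); rewrite lerDr.
rewrite (_ : _ - _ - _ = (expR u - 1 - u) - s ^+ 2 * h ^+ 2 / 2); last by rewrite /u; ring.
apply: le_trans (ler_normB _ _) _.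
have t1 : `|expR u - 1 - u| <= h ^+ 2 * (expR (3 * s ^+ 2) * D w).
  apply: le_trans (expR_taylor1 u) _.
  have e1 : expR `|u| <= expR a by rewrite ler_expR.
  have e2 : u ^+ 2 <= h ^+ 2 * expR a ^+ 2.
    rewrite -real_normK ?num_real// -exprMn lerXn2r ?nnegrE ?mulr_ge0 ?expR_ge0 ?(ltW h0)//.
    by apply: le_trans ua _; rewrite ler_wpM2l// ltW.
  apply: le_trans (ler_pM (sqr_ge0 u) (expR_ge0 _) e2 e1) _.
  rewrite -mulrA ler_wpM2l ?sqr_ge0// -exprSr -expRM_natl.
  have -> : expR (3 * a) = expR (3 * s ^+ 2) * expR (3 * `|X w|).
    by rewrite -expRD; congr expR; rewrite /a; ring.
  rewrite ler_wpM2l ?expR_ge0//; apply: le_trans (exp_le_D w).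
  by rewrite ler_expR ler_wpM2r// ler_nat.
have t2 : `|s ^+ 2 * h ^+ 2 / 2| <= h ^+ 2 * (s ^+ 2 * D w).
  rewrite ger0_norm; last by rewrite divr_ge0// mulr_ge0// sqr_ge0.
  rewrite (_ : s ^+ 2 * h ^+ 2 / 2 = h ^+ 2 * (s ^+ 2 / 2)); last by ring.
  by rewrite ler_wpM2l ?sqr_ge0//; have := ler_peMr s20 (D1 w); lra.
by apply: le_trans (lerD t1 t2) _; rewrite -mulrDr -mulrDl.
Qed.

(** The tilt has mean 1 for every [h]; its expansion in [h] kills the mean of
[X]. *)
Lemma gaussian_mean : mean P Y = m.
Proof.
have iX : P.-integrable setT (EFin \o X).
  apply: (le_integrable measurableT _ _ iD); first exact/measurable_EFinP.
  by move=> w _ /=; rewrite lee_fin (le_trans (X_le_D w))// ler_norm.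
have i1 : P.-integrable setT (EFin \o (fun _ : T => 1)) by apply: bounded_rv_integrable; exact: bounded_rv_cst.
suff : mean P X = 0.
  have im : P.-integrable setT (EFin \o (fun _ : T => m)) by apply: bounded_rv_integrable; exact: bounded_rv_cst.
  have -> : mean P Y = mean P (fun w => X w + m) by apply: eq_mean => w; rewrite /X subrK.
  by rewrite integrable_meanD// mean_cst => ->; rewrite add0r.
apply: (@eq0_of_quadratic _ (K * mean P D)) => h h01.
have it : P.-integrable setT (EFin \o (fun w => tilt m s h (Y w) - 1)) by exact: integrable_sub.
rewrite -(integrable_meanZ h iX).
have -> : mean P (fun w => h * X w) = - mean P (fun w => tilt m s h (Y w) - 1 - h * X w).
  rewrite integrable_meanB//; last exact: integrable_scale.
  by rewrite integrable_meanB// mean_cst [mean P (fun w => tilt _ _ _ _)]/mean /Rintegral tilt_mean/= subrr sub0r opprK.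
rewrite normrN.
rewrite mulrC mulrA -[h ^+ 2 * K * _]integrable_meanZ//.
apply: le_norm_mean.
- by apply: integrable_sub => //; exact: integrable_scale.
- exact: integrable_scale.
- by move=> w; rewrite -mulrA; exact: tilt_taylor.
Qed.

Section Trigonometric.
Variable c : R.

Let mlin t : measurable_fun setT (fun w => t * X w + c).
Proof. by apply: measurable_funD => //; exact: measurable_funM. Qed.

Let bsin t b : bounded_rv (fun w => sin (t * (X w + b) + c)).
Proof.
split; last by exists 1 => w; exact: sin_max.
apply: measurableT_comp; first by apply: continuous_measurable_fun; exact: continuous_sin.
by apply: measurable_funD => //; apply: measurable_funM => //; exact: measurable_funD.
Qed.

Let bsin0 t : bounded_rv (fun w => sin (t * X w + c)).
Proof. by have := bsin t 0; under eq_fun do rewrite addr0. Qed.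

Let bcos t : bounded_rv (fun w => cos (t * X w + c)).
Proof.
split; last by exists 1 => w; exact: cos_max.
by apply: measurableT_comp; [apply: continuous_measurable_fun; exact: continuous_cos|exact: mlin].
Qed.

Let i_sin_tilt t h : P.-integrable setT (EFin \o (fun w => sin (t * X w + c) * tilt m s h (Y w))).
Proof.
apply: (le_integrable measurableT _ _ (integrable_tilt h)).
  by apply/measurable_EFinP; apply: measurable_funM => //; exact: (bsin0 t).1.
move=> w _ /=; rewrite lee_fin normrM ler_piMl//; exact: sin_max.
Qed.

Let shift_sin t h :
  mean P (fun w => sin (t * (X w + s ^+ 2 * h) + c)) =
  mean P (fun w => sin (t * X w + c) * tilt m s h (Y w)).
Proof.
(* the shift formula is for nonnegative functions *)
pose G x := 1 + sin (t * (x - m) + c).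
have cG : continuous G.
  move=> x; apply: cvgD; first exact: cvg_cst.
  apply: (@cvg_comp _ _ _ (fun x => t * (x - m) + c) sin); last exact: continuous_sin.
  apply: cvgD; last exact: cvg_cst.
  by apply: cvgM; [exact: cvg_cst|apply: cvgB; [exact: cvg_id|exact: cvg_cst]].
have G0 x : 0 <= G x.
  by have := sin_max (t * (x - m) + c); rewrite ler_norml /G => /andP[? _]; lra.
have e : mean P (fun w => G (Y w + s ^+ 2 * h)) = mean P (fun w => G (Y w) * tilt m s h (Y w)).
  exact: (congr1 fine (shift h cG G0)).
have e1 : mean P (fun w => G (Y w + s ^+ 2 * h)) = 1 + mean P (fun w => sin (t * (X w + s ^+ 2 * h) + c)).
  rewrite -[X in X + _](mean_cst P) -meanD//; last exact: bounded_rv_cst.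
  by apply: eq_mean => w; rewrite /G /X; congr (_ + sin (_ * _ + _)); ring.
have e2 : mean P (fun w => G (Y w) * tilt m s h (Y w)) = 1 + mean P (fun w => sin (t * X w + c) * tilt m s h (Y w)).
  have {1}-> : 1 = mean P (fun w => tilt m s h (Y w)) by rewrite /mean /Rintegral tilt_mean.
  by rewrite -integrable_meanD//; apply: eq_mean => w; rewrite /G /X mulrDl mul1r.
by move: e; rewrite e1 e2 => /addrI.
Qed.

(** Integration by parts for a Gaussian variable, read off from the first order
in [h] of the shift formula. *)
Let stein t : mean P (fun w => X w * sin (t * X w + c)) = t * s ^+ 2 * mean P (fun w => cos (t * X w + c)).
Proof.
apply/eqP; rewrite -subr_eq0; apply/eqP.
apply: (@eq0_of_quadratic _ (K * mean P D + (t * s ^+ 2) ^+ 2)) => h h01.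
have /andP[h0 h1] := h01.
have iXs : P.-integrable setT (EFin \o (fun w => X w * sin (t * X w + c))).
  by apply: iXM; [exact: (bsin0 t).1|move=> w; exact: sin_max].
have is0 := bounded_rv_integrable P (bsin0 t).
set A := mean P (fun w => X w * _); set B := mean P (fun w => cos _).
pose S := mean P (fun w => sin (t * X w + c)).
have e1 : `|mean P (fun w => sin (t * X w + c) * tilt m s h (Y w)) - S - h * A| <= h ^+ 2 * (K * mean P D).
  rewrite /S /A -integrable_meanB// -(integrable_meanZ h iXs) -integrable_meanB//; first last.
  - exact: integrable_scale.
  - exact: integrable_sub.
  rewrite mulrA -integrable_meanZ//; apply: le_norm_mean.
  - by apply: integrable_sub; [exact: integrable_sub|exact: integrable_scale].
  - exact: integrable_scale.
  move=> w; rewrite (_ : _ - _ - _ = sin (t * X w + c) * (tilt m s h (Y w) - 1 - h * X w)); last by ring.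
  rewrite normrM -mulrA; apply: le_trans (tilt_taylor w h01).
  by rewrite ler_piMl// sin_max.
have e2 : `|mean P (fun w => sin (t * (X w + s ^+ 2 * h) + c)) - S - h * (t * s ^+ 2 * B)| <= h ^+ 2 * (t * s ^+ 2) ^+ 2.
  rewrite /S -meanB// mulrA -meanZ// -meanB; [|exact: bounded_rvB|exact: bounded_rvZ].
  rewrite ler_norml; apply: mean_itv.
    by apply: bounded_rvB; [exact: bounded_rvB|exact: bounded_rvZ].
  move=> w; rewrite -ler_norml -exprMn.
  rewrite (_ : t * (X w + s ^+ 2 * h) + c = (t * X w + c) + h * (t * s ^+ 2)); last by ring.
  exact: sin_taylor1.
rewrite shift_sin in e2; move: e1 e2; set Q := mean P _ => e1 e2.
rewrite (_ : h * _ = (Q - S - h * (t * s ^+ 2 * B)) - (Q - S - h * A)); last by ring.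
apply: le_trans (ler_normB _ _) _; apply: le_trans (lerD e2 e1) _.
by rewrite -mulrDr mulrC [X in X * _]addrC.
Qed.

(** By Stein's identity the left-hand side [f] satisfies [f' t = - t * s ^+ 2 * f t]. *)
Lemma gaussian_char t : mean P (fun w => cos (t * X w + c)) = expR (- (s ^+ 2 * t ^+ 2 / 2)) * cos c.
Proof.
pose f t := mean P (fun w => cos (t * X w + c)).
have df (u : R) : is_derive u 1 f (- (u * s ^+ 2 * f u)).
  apply: (@is_derive_taylor1 _ _ _ (mean P (fun w => X w ^+ 2))) => dl.
  have iXs : P.-integrable setT (EFin \o (fun w => X w * sin (u * X w + c))).
    by apply: iXM; [exact: (bsin0 u).1|move=> w; exact: sin_max].
  rewrite mulrN opprK /f -stein -meanB// -integrable_meanZ//.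
  have ib := bounded_rv_integrable P (bounded_rvB (bcos (u + dl)) (bcos u)).
  rewrite -integrable_meanD//; last exact: integrable_scale.
  rewrite mulrC -integrable_meanZ//; apply: le_norm_mean.
  - by apply: integrable_add => //; exact: integrable_scale.
  - exact: integrable_scale.
  move=> w; rewrite (_ : (u + dl) * X w + c = (u * X w + c) + dl * X w); last by ring.
  by rewrite mulrA -exprMn; exact: cos_taylor1.
pose E (u : R) := expR (s ^+ 2 * u ^+ 2 / 2).
have dE (u : R) : is_derive u 1 E (E u * (s ^+ 2 * u)).
  pose q (u : R) : R := s ^+ 2 * u ^+ 2 / 2.
  have dq : is_derive u 1 q (s ^+ 2 * u).
    by apply: is_derive_eq; rewrite /GRing.scale/=; field.
  have := @is_derive1_comp _ expR q u _ _ (is_derive_expR (q u)) dq.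
  by rewrite mulrC.
pose g u := f u * E u.
have dg (u : R) : is_derive u 1 g 0.
  have := is_deriveM (df u) (dE u); rewrite /GRing.scale/=.
  by congr is_derive; ring.
have g0 : g t = g 0.
  by apply: (@is_derive_0_is_cst _ g t 0) => u; exact: dg.
have : g t = cos c.
  rewrite g0 /g /f /E expr0n/= mulr0 mul0r expR0 mulr1 -[RHS](mean_cst P).
  by apply: eq_mean => w; rewrite mul0r add0r.
rewrite /g /E -/(f t) expRN => <-; rewrite mulrC mulfK//.
by rewrite gt_eqF// expR_gt0.
Qed.

End Trigonometric.
End OneVariable.
End GaussianVariables.

(** * Continuous functions near a compact set of a metric space *)

Section CompactMetric.
Context {R : realType} {X : topologicalType}.
Variable dist : X -> X -> R.
Hypothesis dist_refl : forall x, dist x x = 0.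
Hypothesis dist_sym : forall x y, dist x y = dist y x.
Hypothesis dist_tri : forall x y z, dist x z <= dist x y + dist y z.
Hypothesis nbhs_dist : forall x (A : set X),
  nbhs x A <-> exists2 r : R, 0 < r & forall y, dist x y < r -> A y.
Variable K : set X.
Hypothesis cK : compact K.
Implicit Types (g h : continuousType X R) (e : R).

Lemma dist_ge0 x y : 0 <= dist x y.
Proof.
have := dist_tri x y x; rewrite dist_refl (dist_sym y x) -mulr2n.
by rewrite pmulrn_lge0.
Qed.

Lemma dist_lip x y z : `|dist x z - dist y z| <= dist x y.
Proof.
rewrite ler_norml; have := dist_tri x y z; have := dist_tri y x z.
by rewrite (dist_sym y x) => ? ?; apply/andP; split; lra.
Qed.

Lemma continuous_distP (g : X -> R) : continuous g <->
  (forall x e, 0 < e -> exists2 r : R, 0 < r & forall y, dist x y < r -> `|g x - g y| <= e).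
Proof.
split=> [cg x e e0|H x].
  have /cvgrPdist_le/(_ e e0) cge := cg x.
  by have /nbhs_dist[r r0 rg] : nbhs x [set y | `|g x - g y| <= e]; [exact: cge|exists r].
apply/cvgrPdist_le => e e0; have [r r0 rg] := H x e e0.
by apply/nbhs_dist; exists r.
Qed.

Lemma continuousT_dist g x e : 0 < e ->
  exists2 r : R, 0 < r & forall y, dist x y < r -> `|g x - g y| <= e.
Proof. by have /continuous_distP := @cts_fun _ _ g; apply. Qed.

Lemma bounded_on_compact (F : X -> R) : continuous F ->
  exists2 M : R, 0 <= M & forall x, K x -> `|F x| <= M.
Proof.
move=> cF; have [M [_ MF]] := compact_bounded (continuous_compact (continuous_subspaceT cF) cK).
exists (`|M| + 1); first by rewrite addr_ge0.
move=> x Kx; apply: MF; last by exists x.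
by rewrite ltr_pwDr// ler_norm.
Qed.

Lemma bounded_cts_on_compact g : exists2 M : R, 0 <= M & forall x, K x -> `|g x| <= M.
Proof. exact/bounded_on_compact/cts_fun. Qed.

Lemma unif_cts_on_compact g e : 0 < e ->
  exists2 r : R, 0 < r & forall x y, K x -> dist x y < r -> `|g x - g y| <= e.
Proof.
move=> e0; have e2 : 0 < e / 2 by rewrite divr_gt0.
have /compact_near_coveringP nc := cK.
pose Q (r : R) (x : X) := forall y, dist x y < r -> `|g x - g y| <= e.
have /(nc R (0^'+) Q _) : forall x, K x -> \forall x' \near x & r \near 0^'+, Q r x'.
  move=> x Kx; have [r r0 rg] := continuousT_dist g x e2.
  exists ([set y | dist x y < r / 2], [set t : R | t < r / 2]) => /=.
    split; last by apply: nbhs_right_lt; rewrite divr_gt0.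
    by apply/nbhs_dist; exists (r / 2) => //; rewrite divr_gt0.
  move=> [x' t] /= [xx' tr] y x'y.
  have h1 : `|g x - g x'| <= e / 2 by apply: rg; lra.
  have h2 : `|g x - g y| <= e / 2.
    by apply: rg; have := dist_tri x x' y; lra.
  rewrite (_ : g x' - g y = (g x - g y) - (g x - g x')); last by ring.
  by apply: le_trans (ler_normB _ _) _; lra.
move=> h; have [r [r0 rQ]] : exists r : R, 0 < r /\ K `<=` Q r.
  near (0 : R)^'+ => r; exists r; split => //.
  by near: r; exact: h.
by exists r => // x y Kx; exact: rQ.
Unshelve. all: by end_near. Qed.

(** A covering argument along the filter of finite subsets of [K]. *)
Lemma finite_net e : 0 < e -> exists s : seq X,
  (forall x, x \in s -> K x) /\ forall x, K x -> exists2 y, y \in s & dist x y < e.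
Proof.
move=> e0; have /compact_near_coveringP nc := cK.
pose F : set_system (seq X) := filter_from [set s0 : seq X | forall x, x \in s0 -> K x]
  (fun s0 : seq X => [set s : seq X | {subset s0 <= s} /\ forall x, x \in s -> K x]).
have FF : Filter F.
  apply: filter_from_filter; first by exists [::].
  move=> s1 s2 k1 k2; exists (s1 ++ s2).
    by move=> x; rewrite mem_cat => /orP[/k1|/k2].
  by move=> s [s12 sK]; split; split => // x xs; apply: s12; rewrite mem_cat xs ?orbT.
pose Q (s : seq X) (x : X) := exists2 y, y \in s & dist x y < e.
have /(nc _ F Q FF) : forall x, K x -> \forall x' \near x & s \near F, Q s x'.
  move=> x Kx; exists ([set y | dist x y < e], [set s : seq X | x \in s]) => /=.
    split; first by apply/nbhs_dist; exists e.
    exists [:: x] => [y|s [xs _]]; first by rewrite inE => /eqP ->.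
    by apply: xs; rewrite inE.
  by move=> [y s] /= [xy xs]; exists x => //; rewrite dist_sym.
move=> [s0 s0K] /(_ s0) h; exists s0; split => //.
by apply: h; split.
Qed.

Section Nonempty.
Variable k0 : X.
Hypothesis Kk0 : K k0.

(** Finite nets for the radii [n.+1^-1], enumerated together. Density is kept in
the uniform form of total boundedness. *)
Lemma dense_sequence : exists xs : nat -> X, (forall k, K (xs k)) /\
  forall e, 0 < e -> exists s : seq nat, forall x, K x -> exists2 k, k \in s & dist x (xs k) < e.
Proof.
have nets n : {s : seq X | (forall x, x \in s -> K x) /\
    forall x, K x -> exists2 y, y \in s & dist x y < n.+1%:R^-1}.
  by apply: cid; apply: finite_net; rewrite invr_gt0.
pose net n := sval (nets n).
pose xs k := if (unpickle k : option (nat * nat)) is Some p then nth k0 (net p.1) p.2 else k0.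
exists xs; split.
  move=> k; rewrite /xs; case: unpickle => // -[n i] /=.
  have [ilt|ige] := ltnP i (size (net n)); last by rewrite nth_default.
  by apply: (proj1 (svalP (nets n))); exact: mem_nth.
move=> e e0; pose n := Num.bound e^-1.
have ne : n.+1%:R^-1 <= e.
  rewrite -[leRHS]invrK lef_pV2 ?posrE ?invr_gt0//.
  have := archi_boundP (ltW (_ : 0 < e^-1)); rewrite invr_gt0 => /(_ e0) h.
  by apply: le_trans (ltW h) _; rewrite ler_nat.
exists [seq pickle (n, i) | i <- iota 0 (size (net n))] => x Kx.
have [y ys xy] := proj2 (svalP (nets n)) x Kx.
exists (pickle (n, index y (net n))).
  by apply/mapP; exists (index y (net n)) => //; rewrite mem_iota/= index_mem.
by rewrite /xs pickleK/= nth_index// (lt_le_trans xy).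
Qed.

Lemma dense_le (xs : nat -> X) g h c :
  (forall e, 0 < e -> exists s : seq nat, forall x, K x -> exists2 k, k \in s & dist x (xs k) < e) ->
  (forall k, g (xs k) <= h (xs k) + c) -> forall x, K x -> g x <= h x + c.
Proof.
move=> dxs gh x Kx; apply/ler_addgt0Pr => e e0; have e2 : 0 < e / 2 by rewrite divr_gt0.
have [r r0 rg] := continuousT_dist g x e2; have [t t0 th] := continuousT_dist h x e2.
have [|s hs] := dxs (Num.min r t); first by rewrite lt_min r0 t0.
have [k _] := hs x Kx; rewrite lt_min => /andP[/rg g1 /th h1].
by move: g1 h1 (gh k); rewrite !ler_norml => /andP[? ?] /andP[? ?] ?; lra.
Qed.

(** The maximum of [b] and of finitely many cones of slope [N], with tip at a
point of the sequence and rational height: a countable supply of Lipschitz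
functions. *)
Fixpoint cones (xs : nat -> X) (N : R) (b : R) (l : seq (nat * rat)) (x : X) : R :=
  if l is p :: l' then Num.max (ratr p.2 - N * dist (xs p.1) x) (cones xs N b l' x) else b.

Lemma cones_continuous xs N b l : 0 <= N -> continuous (cones xs N b l).
Proof.
move=> N0; elim: l => [|[k q] l IH]; first by move=> x; exact: cvg_cst.
have cd : continuous (fun x => ratr q - N * dist (xs k) x).
  apply/continuous_distP => x e e0; exists (e / (N + 1)); first by rewrite divr_gt0// ltr_wpDl.
  move=> y xy; rewrite (_ : _ - _ = N * (dist (xs k) y - dist (xs k) x)); last by ring.
  rewrite normrM ger0_norm// !(dist_sym (xs k)); apply: le_trans (ler_wpM2l N0 (dist_lip _ _ _)) _.
  rewrite dist_sym; apply: le_trans (ler_wpM2l N0 (ltW xy)) _.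
  by rewrite mulrCA ler_piMr ?(ltW e0)// ler_pdivrMr ?ltr_wpDl// mul1r lerDl.
by move=> x; apply: (@continuous_max _ _ (fun x => ratr q - N * dist (xs k) x) (cones xs N b l)); [exact: cd|exact: IH].
Qed.

Lemma cones_ge xs N b l x p : p \in l -> ratr p.2 - N * dist (xs p.1) x <= cones xs N b l x.
Proof.
elim: l => [//|q l IH]; rewrite inE => /orP[/eqP ->|pl] /=; first by rewrite le_max lexx.
by rewrite le_max IH ?orbT.
Qed.

Lemma cones_le xs N b l x M : b <= M -> (forall p, p \in l -> ratr p.2 - N * dist (xs p.1) x <= M) ->
  cones xs N b l x <= M.
Proof.
move=> bM; elim: l => [//|q l IH] lM /=; rewrite ge_max lM ?mem_head//= IH// => p pl.
by apply: lM; rewrite inE pl orbT.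
Qed.

(** Put a cone under the graph of [g] at each point of a net. If [N] is so large
that a cone falls below the range of [g] within the distance on which [g] is
almost constant, the maximum of the cones is uniformly close to [g] on [K]. *)
Lemma countable_dense_family (xs : nat -> X) :
  (forall k, K (xs k)) ->
  (forall e, 0 < e -> exists s : seq nat, forall x, K x -> exists2 k, k \in s & dist x (xs k) < e) ->
  exists sf : nat -> continuousType X R,
    forall g e, 0 < e -> exists j, forall x, K x -> `|sf j x - g x| <= e.
Proof.
move=> Kxs dxs.
pose prm j : nat * nat * seq (nat * rat) := odflt (0%N, 0%N, [::]) (unpickle j).
have cs j : continuous (cones xs (prm j).1.1%:R (- (prm j).1.2%:R) (prm j).2) by apply: cones_continuous.
exists (fun j => mkcts (cs j)) => g e e0.
have e3 : 0 < e / 3 by rewrite divr_gt0.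
have [M M0 gM] := bounded_cts_on_compact g.
have [r r0 rg] := unif_cts_on_compact g e3.
pose N := (Num.bound (2 * M / r)).+1; pose B := Num.bound M.
have N0 : 0 < N%:R :> R by rewrite ltr0n.
have NM : 2 * M <= N%:R * r.
  rewrite -ler_pdivrMr//; apply: (le_trans (ltW (archi_boundP _))); last by rewrite ler_nat.
  by rewrite divr_ge0 ?mulr_ge0// ltW.
have BM : M <= B%:R by exact: ltW (archi_boundP M0).
pose t := Num.min r (e / 3 / N%:R).
have t0 : 0 < t by rewrite lt_min r0 divr_gt0.
have [s hs] := dxs t t0.
have qex k : {q : rat | g (xs k) - e / 3 < ratr q < g (xs k)}.
  apply: cid; have [|q] := @rat_in_itvoo R (g (xs k) - e / 3) (g (xs k)); first by rewrite ltrBlDr ltrDl.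
  by rewrite in_itv/= => hq; exists q.
pose q k := sval (qex k).
pose l := [seq (k, q k) | k <- s].
exists (pickle (N, B, l)) => x Kx.
rewrite /= /mkcts /prm pickleK/=.
have gx := gM x Kx; rewrite ler_norml in gx; have /andP[gx1 gx2] := gx.
rewrite ler_norml; apply/andP; split.
  have [k ks xk] := hs x Kx.
  have /(cones_ge xs N%:R (- B%:R) x) /= : (k, q k) \in l by apply/mapP; exists k.
  have /andP[q1 _] := svalP (qex k); rewrite -/(q k) in q1.
  move: xk; rewrite lt_min => /andP[xk1 xk2].
  have h1 : N%:R * dist (xs k) x <= e / 3.
    by rewrite dist_sym mulrC -ler_pdivlMr// ltW.
  have := rg x (xs k) Kx xk1; rewrite ler_norml => /andP[h2 h3] h4; lra.
rewrite lerBlDr; apply: cones_le; first by lra.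
move=> p /mapP[k ks ->] /=.
have /andP[_ q2] := svalP (qex k); rewrite -/(q k) in q2.
have [xk|xk] := ltP (dist x (xs k)) r.
  have := rg x (xs k) Kx xk; rewrite ler_norml => /andP[h2 h3].
  have : 0 <= N%:R * dist (xs k) x by rewrite mulr_ge0 ?dist_ge0// ltW.
  by lra.
have h1 : N%:R * r <= N%:R * dist (xs k) x by rewrite dist_sym ler_pM2l.
have := gM _ (Kxs k); rewrite ler_norml => /andP[_ h2]; lra.
Qed.

Definition infK (F : X -> R) : R := inf [set F y | y in K].

Lemma infK_has (F : X -> R) c : (forall y, K y -> c <= F y) -> has_inf [set F y | y in K].
Proof. by move=> cF; split; [exists (F k0); exists k0|exists c => _ [y Ky <-]; exact: cF]. Qed.

Lemma infK_le (F : X -> R) c y : (forall y, K y -> c <= F y) -> K y -> infK F <= F y.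
Proof. by move=> /infK_has[_ h] Ky; apply: ge_inf => //; exists y. Qed.

Lemma infK_ge (F : X -> R) c : (forall y, K y -> c <= F y) -> c <= infK F.
Proof.
move=> cF; apply: lb_le_inf; first by exists (F k0); exists k0.
by move=> _ [y Ky <-]; exact: cF.
Qed.

Lemma infK_approx (F : X -> R) c e : (forall y, K y -> c <= F y) -> 0 < e ->
  exists2 y, K y & F y < infK F + e.
Proof.
move=> /infK_has h e0; have [_ [y Ky <-] Fy] := inf_adherent e0 h.
by exists y.
Qed.

Lemma infK_lip (F G : X -> R) c e : (forall y, K y -> c <= F y) ->
  (forall y, K y -> F y <= G y + e) -> infK F <= infK G + e.
Proof.
move=> cF FG; rewrite -lerBlDr; apply: infK_ge => y Ky; rewrite lerBlDr.
by apply: le_trans (FG y Ky); exact: infK_le cF Ky.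
Qed.

Definition distK x : R := infK (dist x).

Let dist_lb x y : K y -> 0 <= dist x y. Proof. by move=> _; exact: dist_ge0. Qed.

Lemma distK_le x y : K y -> distK x <= dist x y.
Proof. exact: infK_le (dist_lb x). Qed.

Lemma distK_ge0 x : 0 <= distK x. Proof. exact: infK_ge (dist_lb x). Qed.

Lemma distK_eq0 x : K x -> distK x = 0.
Proof.
by move=> Kx; apply/eqP; rewrite eq_le distK_ge0 andbT -(dist_refl x) distK_le.
Qed.

Lemma distK_lip x z : `|distK x - distK z| <= dist x z.
Proof.
rewrite ler_norml lerBlDl lerNl opprB lerBlDl; apply/andP; split.
  apply: (infK_lip (dist_lb z)) => y _.
  by rewrite addrC (dist_sym x z); exact: dist_tri.
apply: (infK_lip (dist_lb x)) => y _.
by rewrite addrC; exact: dist_tri.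
Qed.

(** An extension operator from [K] that is 1-Lipschitz for uniform norms. Off
[K] it is an infimum of [g] penalised by the relative distance, so that the
near points of [K] dominate close to [K]; the smallest penalty is 1, whence
the final subtraction. *)
Definition extfun (g : X -> R) x : R :=
  if distK x == 0 then g x else infK (fun y => g y + dist x y / distK x) - 1.

Lemma extfun_id g x : K x -> extfun g x = g x.
Proof. by move=> Kx; rewrite /extfun distK_eq0 ?eqxx. Qed.

Let penalty_ge1 x y : 0 < distK x -> K y -> 1 <= dist x y / distK x.
Proof. by move=> x0 Ky; rewrite ler_pdivlMr// mul1r distK_le. Qed.

Let ext_lb g M x : (forall y, K y -> `|g y| <= M) -> forall y, K y -> - M <= g y + dist x y / distK x.
Proof.
move=> gM y Ky; have := gM y Ky; rewrite ler_norml => /andP[h _].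
by rewrite -[leLHS]addr0 lerD// divr_ge0 ?dist_ge0 ?distK_ge0.
Qed.

Lemma distK_eq0_approx x e : distK x = 0 -> 0 < e -> exists2 y, K y & dist x y < e.
Proof. by move=> x0 e0; have := infK_approx (dist_lb x) e0; rewrite -/(distK x) x0 add0r. Qed.

Lemma extfun_lip g h c : (forall y, K y -> `|g y - h y| <= c) ->
  forall x, `|extfun g x - extfun h x| <= c.
Proof.
move=> gh x; rewrite /extfun; case: eqP => [x0|x0].
  apply/ler_addgt0Pr => e e0; have e2 : 0 < e / 2 by rewrite divr_gt0.
  have [r r0 rg] := continuousT_dist g x e2; have [t t0 th] := continuousT_dist h x e2.
  have [|y Ky] := @distK_eq0_approx x (Num.min r t) x0; first by rewrite lt_min r0 t0.
  rewrite lt_min => /andP[/rg g1 /th h1].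
  rewrite (_ : g x - h x = (g x - g y) - (h x - h y) + (g y - h y)); last by ring.
  apply: le_trans (ler_normD _ _) _; rewrite addrC; apply: lerD; first exact: gh.
  by apply: le_trans (ler_normB _ _) _; lra.
have [M _ gM] := bounded_cts_on_compact g; have [M' _ hM] := bounded_cts_on_compact h.
rewrite (_ : _ - _ = infK (fun y => g y + dist x y / distK x) - infK (fun y => h y + dist x y / distK x)); last by ring.
rewrite ler_norml lerBlDl lerNl opprB lerBlDl; apply/andP; split.
  apply: (infK_lip (ext_lb x hM)) => y Ky.
  by have := gh y Ky; rewrite ler_norml => /andP[? ?]; lra.
apply: (infK_lip (ext_lb x gM)) => y Ky.
by have := gh y Ky; rewrite ler_norml => /andP[? ?]; lra.
Qed.

Let distK_gt0 x : distK x <> 0 -> 0 < distK x.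
Proof. by move/eqP => h; rewrite lt_neqAle eq_sym h distK_ge0. Qed.

(** At a limit point [x] of [K], the points of [K] at distance at least [r] from
[x] carry a penalty that exceeds the oscillation of [g], so that only the
values of [g] near [x] count. *)
Let extfun_cvg0 g x e : distK x = 0 -> 0 < e ->
  exists2 r : R, 0 < r & forall z, dist x z < r -> `|extfun g x - extfun g z| <= e.
Proof.
move=> x0 e0; have [M M0 gM] := bounded_cts_on_compact g.
have e2 : 0 < e / 2 by rewrite divr_gt0.
have [r r0 rg] := continuousT_dist g x e2.
have gxM : `|g x| <= M.
  apply/ler_addgt0Pr => t t0; have [r' r'0 rg'] := continuousT_dist g x t0.
  have [y Ky /rg' xy] := distK_eq0_approx x0 r'0.
  rewrite (_ : g x = g y + (g x - g y)); last by ring.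
  by apply: le_trans (ler_normD _ _) _; apply: lerD => //; exact: gM.
pose k := 3 + 2 * M + e.
have k0' : 0 < k by rewrite /k; lra.
exists (r / k); first by rewrite divr_gt0.
move=> z xz; rewrite {1}/extfun x0 eqxx /extfun.
have k3 : r / k <= r / 3 by rewrite ler_wpM2l ?(ltW r0)// lef_pV2 ?posrE// /k; lra.
case: eqP => [z0|/distK_gt0 z0].
  by apply: le_trans (rg z _) _; [apply: lt_le_trans xz _; lra|lra].
have zx : distK z <= dist x z.
  by have := distK_lip z x; rewrite x0 subr0 (dist_sym z x) ger0_norm ?distK_ge0.
have hz := ltW (lt_le_trans xz k3).
have gxb : - M <= g x <= M by rewrite -ler_norml.
have /andP[gx1 gx2] := gxb.
rewrite distrC ler_norml; apply/andP; split.
  rewrite lerBrDr lerBrDr; apply: infK_ge => y Ky.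
  have [xy|xy] := ltP (dist x y) r.
    have := rg y xy; rewrite ler_norml => /andP[h1 h2].
    have := penalty_ge1 z0 Ky; lra.
  have : k - 1 <= dist z y / distK z.
    rewrite ler_pdivlMr//.
    have h1 : dist x y - dist x z <= dist z y by have := dist_tri x z y; lra.
    apply: le_trans h1; apply: (@le_trans _ _ (r - dist x z)); last by rewrite lerB.
    rewrite mulrBl mul1r.
    have h3 : k * dist x z <= r by rewrite mulrC -ler_pdivlMr// ltW.
    have h4 : (k - 1) * distK z <= (k - 1) * dist x z by rewrite ler_wpM2l// /k; lra.
    rewrite mulrBl mul1r in h4; rewrite mulrBl mul1r in h4; lra.
  have := gM y Ky; rewrite ler_norml => /andP[h1 h2]; rewrite /k; lra.
have a0 : 0 < Num.min 1 (e / 2) by rewrite lt_min ltr01 e2.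
have [y Ky] := infK_approx (dist_lb z) (mulr_gt0 z0 a0); rewrite -/(distK z) => zy.
have p1 : dist z y / distK z <= 1 + e / 2.
  rewrite ler_pdivrMr// mulrDl mul1r; apply: le_trans (ltW zy) _.
  by rewrite lerD2l mulrC ler_pM2r// ge_min lexx orbT.
have xy : dist x y < r.
  have h1 : distK z * Num.min 1 (e / 2) <= distK z by rewrite ler_piMr ?ge_min ?lexx// ltW.
  have := dist_tri x z y; have : dist x z < r / 3 by exact: lt_le_trans xz k3.
  by lra.
have := rg y xy; rewrite ler_norml => /andP[h1 h2].
have := infK_le (ext_lb z gM) Ky; lra.
Qed.

Lemma extfun_continuous g : continuous (extfun g).
Proof.
apply/continuous_distP => x e e0.
have [/eqP x0|/eqP/distK_gt0 x0] := boolP (distK x == 0); first exact: extfun_cvg0.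
have [M M0 gM] := bounded_cts_on_compact g.
have [D D0 KD] : exists2 D : R, 0 <= D & forall y, K y -> dist x y <= D.
  have [|D D0 KD] := @bounded_on_compact (dist x).
    apply/continuous_distP => y r r0; exists r => // z /ltW; apply: le_trans.
    by rewrite !(dist_sym x); exact: dist_lip.
  by exists D => // y Ky; apply: le_trans (KD y Ky); exact: ler_norm.
(* [t] makes the penalty vary by at most [e], since [distK] stays above [rho / 2] *)
pose rho := distK x; pose t := e * (rho / 4) / (1 + D / rho).
have c1 : 0 < 1 + D / rho by rewrite ltr_pwDl// divr_ge0// ltW.
have t0 : 0 < t by rewrite divr_gt0 ?mulr_gt0.
exists (Num.min (rho / 2) t); first by rewrite lt_min divr_gt0.
move=> z; rewrite lt_min => /andP[z1 z2].
have zr : rho / 2 <= distK z.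
  have := distK_lip x z; rewrite ler_norml => /andP[_ h]; rewrite -/rho in h; lra.
have z0 : 0 < distK z by apply: lt_le_trans zr; rewrite divr_gt0.
rewrite /extfun !gt_eqF//.
have pen y : K y -> `|dist x y / distK x - dist z y / distK z| <= e.
  move=> Ky; rewrite -/rho; set s := distK z in zr z0 *.
  rewrite (_ : _ - _ = ((dist x y - dist z y) - dist x y / rho * (rho - s)) / s); last first.
    by field; rewrite !gt_eqF.
  rewrite normrM [X in _ * X]ger0_norm ?invr_ge0 ?(ltW z0)// ler_pdivrMr//.
  apply: le_trans (ler_normB _ _) _; rewrite normrM.
  have q0 : 0 <= dist x y / rho by rewrite divr_ge0 ?dist_ge0// ltW.
  rewrite (ger0_norm q0).
  have q1 : dist x y / rho <= D / rho by rewrite ler_wpM2r ?invr_ge0 ?(ltW x0)// KD.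
  have h1 := dist_lip x z y; have h2 : `|rho - s| <= dist x z by exact: distK_lip.
  apply: le_trans (lerD h1 (ler_pM q0 (normr_ge0 _) q1 h2)) _.
  rewrite -[X in X + _]mul1r -mulrDl.
  apply: le_trans (ler_wpM2l (ltW c1) (ltW z2)) _.
  have -> : (1 + D / rho) * t = e * (rho / 4).
    by rewrite /t mulrC divfK// gt_eqF.
  by rewrite ler_pM2l//; lra.
rewrite (_ : _ - _ = infK (fun y => g y + dist x y / distK x) - infK (fun y => g y + dist z y / distK z)); last by ring.
rewrite ler_norml lerBlDl lerNl opprB lerBlDl; apply/andP; split.
  apply: (infK_lip (ext_lb z gM)) => y Ky.
  by have := pen y Ky; rewrite ler_norml => /andP[? ?]; lra.
apply: (infK_lip (ext_lb x gM)) => y Ky.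
by have := pen y Ky; rewrite ler_norml => /andP[? ?]; lra.
Qed.

Definition extension g : continuousType X R := mkcts (@extfun_continuous g).

(** A function uniformly close to [g] still maps a compact set into any open set
that contains its image by [g]: the uniform filter at [g] refines the
compact-open one. *)
Lemma open_event_ball (U : set (continuousType X R)) :
  @open (initial_topology (id : continuousType X R -> {compact-open, X -> R})) U ->
  forall g, U g -> exists2 r : R, 0 < r & forall h, (forall x, `|h x - g x| <= r) -> U h.
Proof.
move=> [B oB <-] g Ug.
pose F : set_system (X -> R) := filter_from [set r : R | 0 < r]
   (fun r => [set h : X -> R | forall x, `|h x - g x| <= r]).
have FF : Filter F.
  apply: filter_from_filter; first by exists 1; rewrite /= ltr01.
  move=> r s r0 s0; exists (Num.min r s); first by rewrite /= lt_min r0 s0.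
  by move=> h hrs; split => x; apply: le_trans (hrs x) _; rewrite ge_min lexx ?orbT.
have cF : {compact-open, F --> (g : X -> R)}.
  apply/compact_open_cvgP => C V cC oV gCV.
  have /compact_near_coveringP nc := cC.
  pose Q (r : R) (x : X) := forall t, `|t - g x| <= r -> V t.
  have /(nc R (0^'+) Q _) h : forall x, C x -> \forall x' \near x & r \near 0^'+, Q r x'.
    move=> x Cx.
    have /nbhs_ballP[e /= e0 eV] : nbhs (g x) V by apply: open_nbhs_nbhs; split => //; apply: gCV; exists x.
    have e3 : 0 < e / 3 by rewrite divr_gt0.
    have [r r0 rg] := continuousT_dist g x e3.
    exists ([set y | dist x y < r], [set t : R | t < e / 3]) => /=.
      by split; [apply/nbhs_dist; exists r|exact: nbhs_right_lt].
    move=> [y s] /= [xy se] t ts; apply: eV; rewrite /ball/=.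
    rewrite (_ : g x - t = (g x - g y) - (t - g y)); last by ring.
    by apply: le_lt_trans (ler_normB _ _) _; have := rg y xy; lra.
  have [r [r0 rQ]] : exists r : R, 0 < r /\ C `<=` Q r.
    near (0 : R)^'+ => r; exists r; split => //.
    by near: r; exact: h.
  by exists r => // h' h'r _ [x Cx <-]; apply: (rQ x Cx).
have : F B by apply: cF; apply: open_nbhs_nbhs; split.
by move=> [r r0 rB]; exists r => // h hr; apply: rB.
Unshelve. all: by end_near. Qed.

Context {d} {Omega : measurableType d} (f : Omega -> continuousType X R).
Hypothesis mf : forall x, measurable_fun setT (fun w => f w x).

(** Extending from [K] turns the values on the sequence [xs] into a uniform
control on the whole space. Hence an open set is, along the process, a
countable union of events that only involve values on [xs]. *)
Lemma measurable_extension (A : set (continuousType X R)) :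
  event A -> measurable [set w | A (extension (f w))].
Proof.
have [xs [Kxs dxs]] := dense_sequence.
have [sf hsf] := countable_dense_family Kxs dxs.
apply: (@smallest_sub _ _ _ [set A | measurable [set w | A (extension (f w))]]).
  split => /=.
  - rewrite (_ : [set w | _] = set0)//; exact/seteqP.
  - move=> B mB; rewrite (_ : [set w | _] = ~` [set w | B (extension (f w))]).
      exact: measurableC.
    by apply/seteqP; split => w //= [].
  - move=> B mB; rewrite (_ : [set w | _] = \bigcup_k [set w | B k (extension (f w))]).
      exact: bigcup_measurable.
    by apply/seteqP; split => w //= [k].
move=> U oU /=.
pose near_sf j n := [set w | forall k, `|f w (xs k) - sf j (xs k)| <= n.+1%:R^-1].
pose good j n := forall h, (forall x, `|h x - extension (sf j) x| <= n.+1%:R^-1) -> U h.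
rewrite (_ : [set w | _] = \bigcup_j \bigcup_n if `[< good j n >] then near_sf j n else set0).
  apply: bigcup_measurable => j _; apply: bigcup_measurable => n _.
  case: asboolP => // _.
  rewrite (_ : near_sf j n = \bigcap_k [set w | `|f w (xs k) - sf j (xs k)| <= n.+1%:R^-1]); last first.
    by apply/seteqP; split => [w h k _|w h k]; apply: h.
  apply: bigcap_measurable => [|k _]; first by exists 0%N.
  rewrite -[X in measurable X]setTI.
  have mk : measurable_fun setT (fun w => `|f w (xs k) - sf j (xs k)|).
    apply: measurableT_comp => //; apply: measurable_funB => //.
  rewrite [X in _ `&` X](_ : _ = (fun w => `|f w (xs k) - sf j (xs k)|) @^-1` `]-oo, n.+1%:R^-1]).
    exact: mk measurableT _ (measurable_itv _).
  by apply/seteqP; split => w /=; rewrite in_itv.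
have close (w : Omega) j c : (forall k, `|f w (xs k) - sf j (xs k)| <= c) ->
    forall x, `|extension (f w) x - extension (sf j) x| <= c.
  move=> h; apply: extfun_lip => y Ky; rewrite ler_norml lerBlDl lerNl opprB lerBlDl; apply/andP; split.
    by apply: (dense_le dxs) => // k; have := h k; rewrite ler_norml => /andP[? ?]; lra.
  by apply: (dense_le dxs) => // k; have := h k; rewrite ler_norml => /andP[? ?]; lra.
apply/seteqP; split => w /=; last first.
  move=> [j _ [n _]]; case: asboolP => // gd h; apply: gd.
  exact: close.
move=> Uw; have [r r0 rU] := open_event_ball oU Uw.
pose n := Num.bound (2 / r).
have nr : n.+1%:R^-1 <= r / 2.
  rewrite -[leRHS]invrK lef_pV2 ?posrE ?invr_gt0 ?divr_gt0// invf_div.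
  apply: le_trans (ltW (archi_boundP _)) _; last by rewrite ler_nat.
  by rewrite divr_ge0// ltW.
have n0 : 0 < n.+1%:R^-1 :> R by rewrite invr_gt0.
have [j hj] := hsf (f w) _ n0.
have fj k : `|f w (xs k) - sf j (xs k)| <= n.+1%:R^-1 by rewrite distrC; exact: hj.
exists j => //; exists n => //; rewrite asboolT; first exact: fj.
move=> h hh; apply: rU => x.
rewrite (_ : _ - _ = (h x - extension (sf j) x) - (extension (f w) x - extension (sf j) x)); last by ring.
apply: le_trans (ler_normB _ _) _.
apply: le_trans (lerD (hh x) (close w j _ fj x)) _.
by rewrite [leRHS](splitr r) lerD.
Qed.

End Nonempty.

(** An event supported on [K] does not distinguish a function from the extension
of its restriction to [K]. *)
Lemma measurable_event d (Omega : measurableType d) (f : Omega -> continuousType X R)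
    (A : set (continuousType X R)) :
  (forall x, measurable_fun setT (fun w => f w x)) -> event A -> supported A K ->
  measurable [set w | A (f w)].
Proof.
move=> mf eA sA.
have supE g h : (forall x, K x -> g x = h x) -> A g <-> A h.
  move=> gh.
  have cgh : continuous (fun x => h x - g x).
    by move=> x; apply: cvgB; exact: cts_fun.
  have := sA g (mkcts cgh) _; rewrite (_ : contfun_add g (mkcts cgh) = h).
    by apply => x Kx; rewrite /= /mkcts gh// subrr.
  by apply/continuousEP => x /=; rewrite /mkcts addrC subrK.
have [[k0 Kk0]|K0] := pselect (exists x, K x).
  rewrite (_ : [set w | A (f w)] = [set w | A (extension Kk0 (f w))]).
    exact: measurable_extension.
  by apply/seteqP; split => w /=; apply: (supE _ _ _).1 => x Kx; rewrite /= /mkcts (extfun_id Kk0).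
have [[g Ag]|nA] := pselect (exists g, A g).
  rewrite (_ : [set w | _] = setT); first exact: measurableT.
  apply/seteqP; split => w //= _; apply/(supE g) => // x Kx.
  by exfalso; apply: K0; exists x.
rewrite (_ : [set w | _] = set0); first exact: measurable0.
by apply/seteqP; split => w //= Aw; apply: nA; exists (f w).
Qed.

End CompactMetric.

(** * Contractive functionals as limits of lattice polynomials *)

Section LatticeApproximation.
Context {R : realType} {d} {T : measurableType d} (P : probability T R).

(** The limit over [k] exists by monotonicity and lies at or below [U w]; the
lower bound, uniform in [k], makes it tend to [U w] as [j] grows. *)
Definition decreasing_increasing_cvg (a : nat -> nat -> T -> R) (U : T -> R) : Prop :=
  [/\ forall k j w, a k.+1 j w <= a k j w,
      forall j w e, 0 < e -> exists k, a k j w <= U w + e &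
      forall w e, 0 < e -> exists j0, forall j k, (j0 <= j)%N -> U w - e <= a k j w].

Lemma decreasing_increasing_limits a U M :
  (forall k j w, `|a k j w| <= M) -> decreasing_increasing_cvg a U ->
  exists b : nat -> T -> R, (forall j w, a ^~ j ^~ w @ \oo --> b j w) /\ (forall w, b ^~ w @ \oo --> U w).
Proof.
move=> aM [dec up low].
have ndec j w : nonincreasing_seq (fun k => a k j w) by apply/nonincreasing_seqP => k; exact: dec.
have cvgb j w : cvgn (fun k => a k j w).
  apply: nonincreasing_is_cvgn => //; exists (- M) => _ [k _ <-].
  by have := aM k j w; rewrite ler_norml => /andP[].
exists (fun j w => limn (fun k => a k j w)); split; first by move=> j w; exact: cvgb.
move=> w; apply/cvgrPdist_le => e e0; have [j0 hj] := low w e e0.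
near=> j.
have j0j : (j0 <= j)%N by near: j; exact: nbhs_infty_ge.
rewrite distrC ler_norml; apply/andP; split.
  rewrite lerBrDr addrC; apply: limr_ge; first exact: cvgb.
  by apply: nearW => k; exact: hj.
have [k hk] := up j w e e0; rewrite lerBlDl; apply: le_trans hk.
exact: nonincreasing_cvgn_ge (ndec j w) (cvgb j w) k.
Unshelve. all: by end_near. Qed.

Lemma double_limit_itv (a1 a2 : nat -> nat -> T -> R) (U1 U2 : T -> R) (M lo hi : R) :
  (forall k j, measurable_fun setT (a1 k j)) -> (forall k j, measurable_fun setT (a2 k j)) ->
  (forall k j w, `|a1 k j w| <= M) -> (forall k j w, `|a2 k j w| <= M) ->
  decreasing_increasing_cvg a1 U1 -> decreasing_increasing_cvg a2 U2 ->
  (forall k j, lo <= rvcov P (a1 k j) (a2 k j) <= hi) ->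
  [/\ bounded_rv U1, bounded_rv U2 & lo <= rvcov P U1 U2 <= hi].
Proof.
move=> m1 m2 M1 M2 c1 c2 cov.
have [b1 [ab1 bU1]] := decreasing_increasing_limits M1 c1.
have [b2 [ab2 bU2]] := decreasing_increasing_limits M2 c2.
have bb1 j : bounded_rv (b1 j) := bounded_cvg (fun k => m1 k j) (fun k => M1 k j) (ab1 j).
have bb2 j : bounded_rv (b2 j) := bounded_cvg (fun k => m2 k j) (fun k => M2 k j) (ab2 j).
have lim_le (u : nat -> R) l : u @ \oo --> l -> (forall k, `|u k| <= M) -> `|l| <= M.
  move=> ul uM; rewrite -(cvg_lim _ (cvg_norm ul))//.
  by apply: limr_le; [apply: cvgP; exact: cvg_norm ul|exact: nearW].
have B1 j w : `|b1 j w| <= M by apply: lim_le (ab1 j w) _ => k.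
have B2 j w : `|b2 j w| <= M by apply: lim_le (ab2 j w) _ => k.
split.
- exact: bounded_cvg (fun j => (bb1 j).1) B1 bU1.
- exact: bounded_cvg (fun j => (bb2 j).1) B2 bU2.
apply: (rvcov_lim_itv (fun j => (bb1 j).1) (fun j => (bb2 j).1) B1 B2 bU1 bU2) => j.
exact: (rvcov_lim_itv (fun k => m1 k j) (fun k => m2 k j) (fun k => M1 k j) (fun k => M2 k j) (ab1 j) (ab2 j)).
Qed.

End LatticeApproximation.

Section EnvelopeRepresentation.
Context {R : realType} {X : topologicalType}.
Implicit Types (g h : continuousType X R).

(** Taking [c = 0] shows that [G] is nondecreasing and depends only on the
values on [K]. *)
Definition sup_contractive (K : set X) (M : R) (G : continuousType X R -> R) : Prop :=
  (forall g, 0 <= G g <= M) /\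
  forall g h c, 0 <= c -> (forall x, K x -> g x <= h x + c) -> G g <= G h + c.

Lemma soft_meet_dec gm c k (x : nat -> R) : soft_meet 0 gm c k.+1 x <= soft_meet 0 gm c k x.
Proof. by rewrite /= soft_min ge_min lexx. Qed.

Lemma soft_join_dec gm c k j (x : nat -> R) : soft_join 0 gm c k.+1 j x <= soft_join 0 gm c k j x.
Proof.
elim: j => [//|j IH]; rewrite [soft_join _ _ _ _ j.+1 _]/= [leRHS]/= !soft_max.
by rewrite ge_max !le_max IH/= soft_meet_dec orbT.
Qed.

Lemma soft_join_dec_le gm c k l j (x : nat -> R) : (k <= l)%N ->
  soft_join 0 gm c l j x <= soft_join 0 gm c k j x.
Proof.
move=> /subnK <-; elim: (l - k)%N => [//|n IH].
by apply: le_trans IH; exact: soft_join_dec.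
Qed.

Lemma soft_meet_dec_le gm c k l (x : nat -> R) : (k <= l)%N ->
  soft_meet 0 gm c l x <= soft_meet 0 gm c k x.
Proof.
move=> /subnK <-; elim: (l - k)%N => [//|n IH].
by apply: le_trans IH; exact: soft_meet_dec.
Qed.

Lemma soft_meet_le_join gm c k i j (x : nat -> R) : (i < j)%N ->
  soft_meet 0 (gm i) (c i) k x <= soft_join 0 gm c k j x.
Proof.
elim: j => [//|j IH]; rewrite ltnS leq_eqVlt /= soft_max le_max => /predU1P[->|/IH ->//].
by rewrite lexx orbT.
Qed.

Lemma soft_meet_ge gm c k (x : nat -> R) b : b <= gm -> (forall i, b <= x i + c i) ->
  b <= soft_meet 0 gm c k x.
Proof. by move=> bg bx; elim: k => [//|k IH] /=; rewrite soft_min le_min IH bx. Qed.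

(** A contractive functional is the upper envelope
[G g = sup_j min (G s_j) (G s_j + inf_K (g - s_j))] over a dense family [s_j],
and the infimum over [K] is the infimum over a dense sequence. Truncating both
gives the lattice polynomials. *)
Lemma envelope_approximation d (T : measurableType d) (f : T -> continuousType X R)
    (K : set X) M G (xs : nat -> X) (sf : nat -> continuousType X R) :
  sup_contractive K M G ->
  (forall k, K (xs k)) ->
  (forall g h c, (forall k, g (xs k) <= h (xs k) + c) -> forall x, K x -> g x <= h x + c) ->
  (forall g e, 0 < e -> exists j, forall x, K x -> `|sf j x - g x| <= e) ->
  decreasing_increasing_cvg
    (fun k j w => soft_join 0 (G \o sf) (fun j k => G (sf j) - sf j (xs k)) k j (fun i => f w (xs i)))
    (fun w => G (f w)).
Proof.
move=> [Gb GL] Kxs dxs dsf; pose c j k := G (sf j) - sf j (xs k).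
split.
- by move=> k j w; exact: soft_join_dec.
- move=> j w e e0; elim: j => [|j [k hk]].
    by exists 0%N => /=; rewrite addr_ge0 ?(ltW e0)//; case/andP: (Gb (f w)).
  have [k' hk'] : exists k, soft_meet 0 (G (sf j)) (c j) k (fun i => f w (xs i)) <= G (f w) + e.
    have [le|gt] := leP (G (sf j)) (G (f w) + e); first by exists 0%N.
    have [[i hi]|ni] := pselect (exists i, f w (xs i) + c j i <= G (f w) + e).
      by exists i.+1; rewrite /= soft_min ge_min hi orbT.
    exfalso.
    have c0 : 0 <= G (sf j) - G (f w) - e by lra.
    suff h : forall x, K x -> sf j x <= f w x + (G (sf j) - G (f w) - e).
      by have := GL (sf j) (f w) _ c0 h; lra.
    apply: dxs => i; have [hi|hi] := leP (f w (xs i) + c j i) (G (f w) + e).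
      by exfalso; apply: ni; exists i.
    by move: hi; rewrite /c; lra.
  exists (maxn k k'); rewrite /= soft_max ge_max.
  rewrite (le_trans (soft_join_dec_le _ _ _ _ (leq_maxl k k')) hk)/=.
  exact: le_trans (soft_meet_dec_le _ _ _ (leq_maxr k k')) hk'.
- move=> w e e0; have e2 : 0 < e / 2 by rewrite divr_gt0.
  have [j hj] := dsf (f w) (e / 2) e2.
  exists j.+1 => j' k jj'; apply: le_trans (soft_meet_le_join _ _ _ _ jj').
  have h1 : G (f w) <= G (sf j) + e / 2.
    apply: GL => [|x Kx]; first exact: ltW.
    by have := hj x Kx; rewrite ler_norml => /andP[? ?]; lra.
  apply: soft_meet_ge => [|i] /=; first by lra.
  by have := hj _ (Kxs i); rewrite /c ler_norml => /andP[? ?]; lra.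
Qed.

End EnvelopeRepresentation.

(** * Finite families of values of a Gaussian process *)

Section GaussianVectors.
Context {R : realType} {d} {T : measurableType d} (P : probability T R).
Context {X : topologicalType} (f : T -> continuousType X R).
Hypothesis gf : gaussian_process P f.

Lemma gaussian_eval x : gaussian_rv P (fun w => f w x).
Proof.
have := gf (fun _ : 'I_1 => x) (fun=> 1).
by congr gaussian_rv; apply/funext => w; rewrite big_ord1 mul1r.
Qed.

Lemma measurable_eval x : measurable_fun setT (fun w => f w x).
Proof. by have [] := gaussian_eval x. Qed.

Definition centred x w : R := f w x - mean P (fun w => f w x).

Lemma measurable_centred x : measurable_fun setT (centred x).
Proof. by apply: measurable_funB => //; exact: measurable_eval. Qed.

Lemma centred_integrable4 x : P.-integrable setT (EFin \o (fun w => centred x w ^+ 4)).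
Proof.
have [mY [m [s sh]]] := gaussian_rv_shift (gaussian_eval x).
by rewrite /centred (gaussian_mean mY sh); exact: gaussian_integrable4 sh.
Qed.

Lemma integrable_of_pow4 (F Y : T -> R) k : measurable_fun setT F ->
  P.-integrable setT (EFin \o (fun w => Y w ^+ 4)) ->
  (forall w, `|F w| <= k * (1 + Y w ^+ 4)) -> P.-integrable setT (EFin \o F).
Proof.
move=> mF iY FY; apply: (le_integrable measurableT (g := EFin \o (fun w => k * (1 + Y w ^+ 4)))).
- exact/measurable_EFinP.
- by move=> w _ /=; rewrite lee_fin (le_trans (FY w))// ler_norm.
- apply: integrable_scale; apply: integrable_add => //.
  by apply: bounded_rv_integrable; exact: bounded_rv_cst.
Qed.

Lemma integrable_eval x : P.-integrable setT (EFin \o (fun w => f w x)).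
Proof.
have -> : (fun w => f w x) = (fun w => centred x w + mean P (fun w => f w x)).
  by apply/funext => w; rewrite /centred subrK.
apply: integrable_add; last by apply: bounded_rv_integrable; exact: bounded_rv_cst.
apply: (integrable_of_pow4 (k := 1) (measurable_centred x) (centred_integrable4 x)) => w.
rewrite mul1r; have h : centred x w ^+ 4 = (centred x w ^+ 2) ^+ 2 by rewrite -exprM.
rewrite h; rewrite ler_norml; apply/andP.
by have := sqr_ge0 (centred x w ^+ 2 - 1); have := sqr_ge0 (centred x w + 1);
   have := sqr_ge0 (centred x w - 1) => ? ? ?; split; nra.
Qed.

Lemma mean_centred x : mean P (centred x) = 0.
Proof.
rewrite /centred integrable_meanB ?mean_cst ?subrr//; first exact: integrable_eval.
by apply: bounded_rv_integrable; exact: bounded_rv_cst.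
Qed.

Lemma centred_integrableM x y : P.-integrable setT (EFin \o (fun w => centred x w * centred y w)).
Proof.
apply: (le_integrable measurableT (g := EFin \o (fun w => (1 + centred x w ^+ 4) + (1 + centred y w ^+ 4)))).
- by apply/measurable_EFinP; apply: measurable_funM; exact: measurable_centred.
- move=> w _ /=; rewrite lee_fin [leRHS]ger0_norm; last first.
    by rewrite !addr_ge0// -[4%N]/(2 * 2)%N exprM sqr_ge0.
  rewrite ler_norml -[4%N]/(2 * 2)%N !exprM; set a := centred x w; set b := centred y w.
  have := sqr_ge0 (a - b); have := sqr_ge0 (a + b).
  have := sqr_ge0 (a ^+ 2 - 1); have := sqr_ge0 (b ^+ 2 - 1) => ? ? ? ?.
  by apply/andP; split; nra.
- have i1 : P.-integrable setT (EFin \o (fun _ : T => 1)) by apply: bounded_rv_integrable; exact: bounded_rv_cst.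
  by apply: integrable_add; apply: integrable_add => //; exact: centred_integrable4.
Qed.

Lemma cov_kernelE x y : cov_kernel P f x y = (mean P (fun w => centred x w * centred y w))%:E.
Proof.
rewrite /cov_kernel covariance.unlock expectation.unlock /mean /Rintegral fineK//.
exact: integrable_fin_num (centred_integrableM x y).
Qed.

Lemma gaussian_comb_char n (x : 'I_n -> X) (th : 'I_n -> R) : exists s : R, forall t c,
  mean P (fun w => cos (t * (\sum_(i < n) th i * centred (x i) w) + c)) =
  expR (- (s ^+ 2 * t ^+ 2 / 2)) * cos c.
Proof.
have [mY [m [s sh]]] := gaussian_rv_shift (gf x th).
exists s => t c; rewrite -(gaussian_char mY sh c t).
apply: eq_mean => w; congr (cos (t * _ + c)).
have -> : m = \sum_(i < n) th i * mean P (fun w => f w (x i)).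
  rewrite -(gaussian_mean mY sh).
  have [|_ ->] := @integrable_mean_sum _ _ _ P _ (index_enum 'I_n) (fun i w => th i * f w (x i)).
    by move=> i; apply: integrable_scale; exact: integrable_eval.
  by apply: eq_bigr => i _; rewrite integrable_meanZ//; exact: integrable_eval.
by rewrite -sumrB; apply: eq_bigr => i _; rewrite /centred mulrBr.
Qed.

Variables (xs ys : nat -> X) (N : nat).

(** The points of the first block are followed by those of the second one, as the
halving argument works with a single vector. *)
Definition two_points i : X := if (i < N)%N then xs i else ys (i - N)%N.
Definition two_blocks w i : R := centred (two_points i) w.

Lemma two_blocks_tail w i : tail N (two_blocks w) i = centred (ys i) w.
Proof. by rewrite /tail /two_blocks /two_points ltnNge leq_addr/= addKn. Qed.

Lemma two_blocks_head w i : (i < N)%N -> two_blocks w i = centred (xs i) w.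
Proof. by rewrite /two_blocks /two_points => ->. Qed.

Lemma l1norm_pow4 n (z : nat -> X) : P.-integrable setT (EFin \o (fun w => l1norm n (fun i => centred (z i) w) ^+ 4)).
Proof.
elim: n => [|n IH].
  rewrite (_ : _ \o _ = EFin \o (fun _ : T => 0)); last first.
    by apply/funext => w /=; rewrite /l1norm big_ord0 expr0n.
  by apply: bounded_rv_integrable; exact: bounded_rv_cst.
apply: (le_integrable measurableT (g := EFin \o (fun w =>
   8 * (l1norm n (fun i => centred (z i) w) ^+ 4 + centred (z n) w ^+ 4)))).
- apply/measurable_EFinP; apply: measurable_funX; apply: measurable_sum => i.
  by apply: measurableT_comp => //; exact: measurable_centred.
- move=> w _ /=; rewrite lee_fin.
  rewrite [leRHS]ger0_norm; last by rewrite mulr_ge0// addr_ge0// -[4%N]/(2 * 2)%N exprM sqr_ge0.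
  rewrite ger0_norm; last by rewrite -[4%N]/(2 * 2)%N exprM sqr_ge0.
  rewrite /l1norm big_ord_recr/=; set a := \sum_(i < n) _; set b := centred _ _.
  have -> : b ^+ 4 = `|b| ^+ 4 by rewrite -[4%N]/(2 * 2)%N !exprM real_normK ?num_real.
  set c := `|b|.
  have h (u v : R) : (u + v) ^+ 2 <= 2 * (u ^+ 2 + v ^+ 2).
    by have := sqr_ge0 (u - v); rewrite !expr2; nra.
  have a0 : 0 <= a by apply: sumr_ge0.
  have c0 : 0 <= c by exact: normr_ge0.
  rewrite -[4%N]/(2 * 2)%N !exprM.
  apply: (@le_trans _ _ ((2 * (a ^+ 2 + c ^+ 2)) ^+ 2)).
    by rewrite lerXn2r ?nnegrE ?sqr_ge0 ?mulr_ge0 ?addr_ge0 ?sqr_ge0// h.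
  rewrite exprMn; have := h (a ^+ 2) (c ^+ 2); rewrite [2 ^+ 2]expr2; lra.
- by apply: integrable_scale; apply: integrable_add => //; exact: centred_integrable4.
Qed.

Lemma two_blocks_pow4 : P.-integrable setT
  (fun w => ((1 + l1norm N (two_blocks w) + l1norm N (tail N (two_blocks w))) ^+ 4)%:E).
Proof.
apply: (le_integrable measurableT (g := EFin \o (fun w => 8 * (1 + l1norm (N + N) (fun i => centred (two_points i) w) ^+ 4)))).
- apply/measurable_EFinP; apply: measurable_funX; apply: measurable_funD.
    apply: measurable_funD => //; apply: measurable_sum => i.
    by apply: measurableT_comp => //; exact: measurable_centred.
  apply: measurable_sum => i.
  by apply: measurableT_comp => //; exact: measurable_centred.
- move=> w _ /=; rewrite lee_fin.
  have -> : 1 + l1norm N (two_blocks w) + l1norm N (tail N (two_blocks w)) =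
      1 + l1norm (N + N) (two_blocks w) by rewrite /l1norm big_split_ord/= addrA.
  rewrite -/(two_blocks w); set a := l1norm _ _.
  rewrite [leRHS]ger0_norm; last by rewrite mulr_ge0// addr_ge0// -[4%N]/(2 * 2)%N exprM sqr_ge0.
  rewrite ger0_norm -[4%N]/(2 * 2)%N exprM ?sqr_ge0// exprM.
  have h (u v : R) : (u + v) ^+ 2 <= 2 * (u ^+ 2 + v ^+ 2).
    by have := sqr_ge0 (u - v); rewrite !expr2; nra.
  apply: (@le_trans _ _ ((2 * (1 + a ^+ 2)) ^+ 2)).
    rewrite lerXn2r ?nnegrE ?sqr_ge0 ?mulr_ge0 ?addr_ge0 ?sqr_ge0//.
    by have := h 1 a; rewrite expr1n.
  rewrite exprMn; have := h 1 (a ^+ 2); rewrite expr1n [2 ^+ 2]expr2; lra.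
- apply: integrable_scale; apply: integrable_add; last exact: l1norm_pow4.
  by apply: bounded_rv_integrable; exact: bounded_rv_cst.
Qed.

(** Linear combinations of the centred values are centred Gaussian variables, and
the characteristic function of such a variable at [t] is the square of its value at [t / sqrt 2]. *)
Lemma two_blocks_stable th c :
  mean P (fun w => cos (linform (N + N) th (two_blocks w) + c)) =
  mean (P \x P)%E (fun w => cos (linform (N + N) th (half_mix (two_blocks w.1) (two_blocks w.2)) + c)).
Proof.
have [s hs] := gaussian_comb_char (fun i : 'I_(N + N) => two_points i) (fun i => th i).
pose u w := linform (N + N) th (two_blocks w).
have {}hs t b : mean P (fun w => cos (t * u w + b)) = expR (- (s ^+ 2 * t ^+ 2 / 2)) * cos b.
  exact: hs.
have mu : measurable_fun setT u by apply: measurable_linform => i; exact: measurable_centred.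
have r0 := @sqrt2_gt0 R; pose t : R := (Num.sqrt 2)^-1.
have t2 : t ^+ 2 = 2^-1 by rewrite /t exprVn sqr_sqrtr.
have mixE w : linform (N + N) th (half_mix (two_blocks w.1) (two_blocks w.2)) = t * u w.2 + t * u w.1.
  rewrite -mulrDr /u /linform -big_split/= mulr_sumr; apply: eq_bigr => i _.
  by rewrite /half_mix /t; ring.
have bm : bounded_rv (fun w : T * T => cos (t * u w.2 + (t * u w.1 + c))).
  split; last by exists 1 => w; exact: cos_max.
  apply: measurableT_comp; first by apply: continuous_measurable_fun; exact: continuous_cos.
  apply: measurable_funD; first by apply: measurable_funM => //; exact: (measurableT_comp mu measurable_snd).
  by apply: measurable_funD => //; apply: measurable_funM => //; exact: (measurableT_comp mu measurable_fst).
transitivity (mean (P \x P)%E (fun w => cos (t * u w.2 + (t * u w.1 + c)))); last first.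
  by apply: eq_mean => w; rewrite mixE addrA.
rewrite mean_prod//.
transitivity (mean P (fun w => cos (1 * u w + c))); first by apply: eq_mean => w; rewrite mul1r.
transitivity (mean P (fun w => expR (- (s ^+ 2 * t ^+ 2 / 2)) * cos (t * u w + c))); last first.
  by apply: eq_mean => w; rewrite /= hs.
rewrite meanZ; last first.
  split; last by exists 1 => w; exact: cos_max.
  apply: measurableT_comp; first by apply: continuous_measurable_fun; exact: continuous_cos.
  by apply: measurable_funD => //; exact: measurable_funM.
rewrite !hs mulrA -expRD t2 expr1n; congr (expR _ * _); by field.
Qed.

Variables (lo hi : R).
Hypothesis lo0 : lo <= 0.
Hypothesis hi0 : 0 <= hi.
Hypothesis cov_itv : forall i j : 'I_N, (lo%:E <= cov_kernel P f (xs i) (ys j) <= hi%:E)%E.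

Lemma two_blocks_cov_bound (p q : nat -> R) :
  (forall i, 0 <= p i) -> (forall i, 0 <= q i) ->
  \sum_(i < N) p i <= 1 -> \sum_(i < N) q i <= 1 ->
  lo <= \sum_(i < N) \sum_(j < N) p i * q j * mean P (fun w => two_blocks w i * two_blocks w (N + j)%N) <= hi.
Proof.
move=> p0 q0 p1 q1.
have kij (i j : 'I_N) : lo <= mean P (fun w => two_blocks w i * two_blocks w (N + j)%N) <= hi.
  have := cov_itv i j; rewrite cov_kernelE !lee_fin.
  rewrite (_ : mean P (fun w => two_blocks w i * _) = mean P (fun w => centred (xs i) w * centred (ys j) w))//.
  apply: eq_mean => w; rewrite two_blocks_head//; congr (_ * _).
  exact: two_blocks_tail.
have Q0 : 0 <= \sum_(j < N) q j by apply: sumr_ge0.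
have S0 : 0 <= \sum_(i < N) \sum_(j < N) p i * q j by apply: sumr_ge0 => i _; apply: sumr_ge0 => j _; rewrite mulr_ge0.
have S1 : \sum_(i < N) \sum_(j < N) p i * q j <= 1.
  under eq_bigr do rewrite -mulr_sumr.
  by rewrite -mulr_suml mulr_ile1// sumr_ge0.
apply/andP; split.
  apply: (@le_trans _ _ (lo * \sum_(i < N) \sum_(j < N) p i * q j)).
    by rewrite -[leLHS]mulr1 ler_wnM2l.
  rewrite mulr_sumr; apply: ler_sum => i _; rewrite mulr_sumr; apply: ler_sum => j _.
  by rewrite mulrC ler_wpM2l ?mulr_ge0//; case/andP: (kij i j).
apply: (@le_trans _ _ (hi * \sum_(i < N) \sum_(j < N) p i * q j)); last by rewrite ler_piMr.
rewrite mulr_sumr; apply: ler_sum => i _; rewrite mulr_sumr; apply: ler_sum => j _.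
by rewrite [leRHS]mulrC ler_wpM2l ?mulr_ge0//; case/andP: (kij i j).
Qed.

Lemma soft_join_shift sg gm (c : nat -> nat -> R) k j (x y m : nat -> R) :
  (forall i, (i < k)%N -> x i = y i + m i) ->
  soft_join sg gm c k j x = soft_join sg gm (fun j i => m i + c j i) k j y.
Proof.
move=> xy; elim: j => [//|j IH] /=; rewrite IH; congr soft.
elim: k xy {IH} => [//|k IH] xy /=; rewrite IH; last by move=> i ik; apply: xy; rewrite ltnS ltnW.
by rewrite xy// addrA.
Qed.

Lemma smooth_leC (C C' : R) (g : (nat -> R) -> R) : C <= C' -> smooth N C g -> smooth N C' g.
Proof.
move=> CC' [[mg gL [p [mp p0 p1 gp]]] bg]; split => //; split => //.
exists p; split => // x v; apply: le_trans (gp x v) _.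
by rewrite ler_wpM2r ?sqr_ge0.
Qed.

Lemma measurable_soft_join_eval gm c (z : nat -> X) j :
  measurable_fun setT (fun w => soft_join 0 gm c N j (fun i => f w (z i))).
Proof.
elim: j => [|j IH] /=; first exact: measurable_cst.
under eq_fun do rewrite soft_max; apply: measurable_maxr => //.
elim: N => [|n IHn] /=; first exact: measurable_cst.
under eq_fun do rewrite soft_min; apply: measurable_minr => //.
by apply: measurable_funD => //; exact: measurable_eval.
Qed.

(** The covariance bound for smooth functions passes to lattice polynomials by
letting the smoothing parameter [n.+1^-1] tend to 0. *)
Lemma gaussian_lattice_cov gm1 gm2 c1 c2 M j :
  0 <= M -> (forall j, gm1 j <= M) -> (forall j, gm2 j <= M) ->
  lo <= rvcov P (fun w => soft_join 0 gm1 c1 N j (fun i => f w (xs i)))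
                (fun w => soft_join 0 gm2 c2 N j (fun i => f w (ys i))) <= hi.
Proof.
move=> M0 gM1 gM2.
pose m1 i := mean P (fun w => f w (xs i)); pose m2 i := mean P (fun w => f w (ys i)).
pose b1 (j k : nat) := m1 k + c1 j k; pose b2 (j k : nat) := m2 k + c2 j k.
pose g n x := soft_join n.+1%:R^-1 gm1 b1 N j x.
pose h n x := soft_join n.+1%:R^-1 gm2 b2 N j x.
have e1 w : soft_join 0 gm1 c1 N j (fun i => f w (xs i)) = soft_join 0 gm1 b1 N j (two_blocks w).
  by apply: soft_join_shift => i iN; rewrite two_blocks_head// /centred subrK.
have e2 w : soft_join 0 gm2 c2 N j (fun i => f w (ys i)) = soft_join 0 gm2 b2 N j (tail N (two_blocks w)).
  by apply: soft_join_shift => i iN; rewrite two_blocks_tail /centred subrK.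
have n0 n : 0 < n.+1%:R^-1 :> R by rewrite invr_gt0.
have mb i : measurable_fun setT (two_blocks ^~ i) by exact: measurable_centred.
have mt i : measurable_fun setT (fun w => tail N (two_blocks w) i) by exact: measurable_centred.
have near0 (c : nat -> nat -> R) gm n x : `|soft_join n.+1%:R^-1 gm c N j x - soft_join 0 gm c N j x| <= (N + j)%:R / n.+1%:R.
  by apply: soft_join_close; exact: ltW.
have bnd (c : nat -> nat -> R) gm n x : (forall j, gm j <= M) -> `|soft_join n.+1%:R^-1 gm c N j x| <= M + (N + j)%:R.
  move=> gM; rewrite -[soft_join _ _ _ _ _ _](subrK (soft_join 0 gm c N j x)).
  apply: le_trans (ler_normD _ _) _; rewrite addrC; apply: lerD.
    by have /andP[a0 aM] := soft_join_itv c N j x M0 gM; rewrite ger0_norm.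
  apply: le_trans (near0 c gm n x) _; rewrite ler_pdivrMr// ler_peMr// ler1n//.
have cv (c : nat -> nat -> R) gm x : soft_join n.+1%:R^-1 gm c N j x @[n --> \oo] --> soft_join 0 gm c N j x.
  apply/cvgrPdist_le => e e0; near=> n.
  rewrite distrC; apply: le_trans (near0 c gm n x) _.
  rewrite ler_pdivrMr// mulrC -ler_pdivrMr//.
  apply: (@le_trans _ _ n%:R); last by rewrite ler_nat.
  by near: n; exact: nbhs_infty_ger.
have sg n : exists2 C, 0 <= C & smooth N C (g n) by exact: (smooth_soft_join _ _ (n0 n) (leqnn N) M0).
have sh n : exists2 C, 0 <= C & smooth N C (h n) by exact: (smooth_soft_join _ _ (n0 n) (leqnn N) M0).
have -> : (fun w => soft_join 0 gm1 c1 N j (fun i => f w (xs i))) = (fun w => soft_join 0 gm1 b1 N j (two_blocks w)).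
  by apply/funext.
have -> : (fun w => soft_join 0 gm2 c2 N j (fun i => f w (ys i))) = (fun w => soft_join 0 gm2 b2 N j (tail N (two_blocks w))).
  by apply/funext.
apply: (@rvcov_lim_itv _ _ _ P (fun n w => g n (two_blocks w)) (fun n w => h n (tail N (two_blocks w))) _ _ (M + (N + j)%:R)).
- by move=> n; have [C _ /(smooth_bounded_rv mb)[]] := sg n.
- by move=> n; have [C _ /(smooth_bounded_rv mt)[]] := sh n.
- by move=> n w; exact: bnd.
- by move=> n w; exact: bnd.
- by move=> w; exact: cv.
- by move=> w; exact: cv.
move=> n; have [C C0 sgn] := sg n; have [C' C'0 shn] := sh n.
apply: (cov_smooth mb two_blocks_pow4 _ two_blocks_stable two_blocks_cov_bound (C := C + C')).
- by move=> i; exact: mean_centred.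
- exact: addr_ge0.
- by apply: smooth_leC sgn; rewrite lerDl.
- by apply: smooth_leC shn; rewrite lerDr.
Unshelve. all: by end_near. Qed.

End GaussianVectors.

(** * The covariance inequality for contractive functionals *)

Section CovarianceInequality.
Context {R : realType} {d} {T : measurableType d} (P : probability T R).
Context {X : topologicalType} (dist : X -> X -> R).
Hypothesis dist_refl : forall x, dist x x = 0.
Hypothesis dist_sym : forall x y, dist x y = dist y x.
Hypothesis dist_tri : forall x y z, dist x z <= dist x y + dist y z.
Hypothesis nbhs_dist : forall x (A : set X),
  nbhs x A <-> exists2 r : R, 0 < r & forall y, dist x y < r -> A y.
Variable (f : T -> continuousType X R).
Hypothesis gf : gaussian_process P f.

Lemma sup_contractive_empty (K : set X) (M : R) (G : continuousType X R -> R) : sup_contractive K M G -> ~ (exists x, K x) ->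
  forall g h, G g = G h.
Proof.
move=> [_ GL] K0 g h; apply/eqP; rewrite eq_le.
have le g' h' : G g' <= G h'.
  by rewrite -[leRHS]addr0; apply: GL => // x Kx; exfalso; apply: K0; exists x.
by rewrite !le.
Qed.

(** The functionals are iterated limits of lattice polynomials, to which
[gaussian_lattice_cov] applies, and covariances are continuous along bounded
pointwise limits. The upper bound may be infinite, which lets a lower bound on
the kernel be used alone. *)
Lemma gaussian_cov_inequality (K1 K2 : set X) (M lo : R) (hi : \bar R) (G1 G2 : continuousType X R -> R) :
  compact K1 -> compact K2 -> 0 <= M -> lo <= 0 -> (0 <= hi)%E ->
  (forall x y, K1 x -> K2 y -> (lo%:E <= cov_kernel P f x y <= hi)%E) ->
  sup_contractive K1 M G1 -> sup_contractive K2 M G2 ->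
  [/\ bounded_rv (fun w => G1 (f w)), bounded_rv (fun w => G2 (f w)) &
      (lo%:E <= (rvcov P (fun w => G1 (f w)) (fun w => G2 (f w)))%:E <= hi)%E].
Proof.
move=> cK1 cK2 M0 lo0 hi0 cov sG1 sG2.
have lattice (K : set X) (G : continuousType X R -> R) : compact K -> sup_contractive K M G -> (exists x, K x) ->
  exists xs gm c, [/\ forall k, K (xs k), forall j, gm j <= M, forall j, 0 <= gm j &
    decreasing_increasing_cvg (fun k j w => soft_join 0 gm c k j (fun i => f w (xs i))) (fun w => G (f w))].
  move=> cK sG [k0 Kk0].
  have [xs [Kxs dxs]] := dense_sequence dist_sym nbhs_dist cK Kk0.
  have [sf hsf] := countable_dense_family dist_refl dist_sym dist_tri nbhs_dist cK Kxs dxs.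
  exists xs, (G \o sf), (fun j k => G (sf j) - sf j (xs k)); split => //.
  - by move=> j; case/andP: (sG.1 (sf j)).
  - by move=> j; case/andP: (sG.1 (sf j)).
  - apply: (envelope_approximation f sG Kxs) => // g h c.
    exact: (dense_le nbhs_dist dxs).
have bounded_const (G : continuousType X R -> R) (g : continuousType X R) : (forall g h, G g = G h) -> bounded_rv (fun w => G (f w)).
  by move=> Gc; rewrite (_ : (fun w => _) = cst (G g)); [exact: bounded_rv_cst|apply/funext => w; exact: Gc].
have g0 : continuousType X R := cst 0.
have bG (K : set X) (G : continuousType X R -> R) : compact K -> sup_contractive K M G -> bounded_rv (fun w => G (f w)).
  move=> cK sG; have [K0|K0] := pselect (exists x, K x); last first.
    by apply: (bounded_const _ g0); exact: sup_contractive_empty sG K0.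
  have [xs [gm [c [Kxs gM gm0 cvg]]]] := lattice K G cK sG K0.
  have ms k j : measurable_fun setT (fun w => soft_join 0 gm c k j (fun i => f w (xs i))).
    exact: (measurable_soft_join_eval gf k gm c xs j).
  have bs k j w : `|soft_join 0 gm c k j (fun i => f w (xs i))| <= M.
    by have /andP[a0 aM] := soft_join_itv c k j (fun i => f w (xs i)) M0 gM; rewrite ger0_norm.
  have [b [ab bU]] := decreasing_increasing_limits bs cvg.
  have bb j : bounded_rv (b j) := bounded_cvg (fun k => ms k j) (fun k => bs k j) (ab j).
  split; last by exists M => w; have /andP[a0 aM] := sG.1 (f w); rewrite ger0_norm.
  by apply: (measurable_fun_cvg (fun j => (bb j).1)) => w _; exact: bU.
have b1 := bG _ _ cK1 sG1; have b2 := bG _ _ cK2 sG2.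
split => //.
have cov_cst (U : T -> R) k : bounded_rv U -> rvcov P U (fun=> k) = 0.
  move=> bU; rewrite /rvcov mean_cst.
  have -> : mean P (fun w => U w * k) = mean P (fun w => k * U w) by apply: eq_mean => w; exact: mulrC.
  by rewrite meanZ// mulrC subrr.
have covC (U V : T -> R) : rvcov P U V = rvcov P V U.
  rewrite /rvcov mulrC; congr (_ - _); apply: eq_mean => w; exact: mulrC.
have [K10|K10] := pselect (exists x, K1 x); last first.
  rewrite (_ : (fun w => G1 (f w)) = cst (G1 g0)).
    by rewrite covC cov_cst// hi0 lee_fin lo0.
  by apply/funext => w; exact: sup_contractive_empty sG1 K10 _ _.
have [K20|K20] := pselect (exists x, K2 x); last first.
  rewrite (_ : (fun w => G2 (f w)) = cst (G2 g0)).
    by rewrite cov_cst// hi0 lee_fin lo0.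
  by apply/funext => w; exact: sup_contractive_empty sG2 K20 _ _.
have [xs [gm1 [c1 [Kxs gM1 g10 cvg1]]]] := lattice K1 G1 cK1 sG1 K10.
have [ys [gm2 [c2 [Kys gM2 g20 cvg2]]]] := lattice K2 G2 cK2 sG2 K20.
pose a1 k j w := soft_join 0 gm1 c1 k j (fun i => f w (xs i)).
pose a2 k j w := soft_join 0 gm2 c2 k j (fun i => f w (ys i)).
have a1M k j w : 0 <= a1 k j w <= M by exact: soft_join_itv.
have a2M k j w : 0 <= a2 k j w <= M by exact: soft_join_itv.
have normM (x : R) : 0 <= x <= M -> `|x| <= M by move=> /andP[x0 xM]; rewrite ger0_norm.
have m1 k j : measurable_fun setT (a1 k j) by exact: (measurable_soft_join_eval gf k gm1 c1 xs j).
have m2 k j : measurable_fun setT (a2 k j) by exact: (measurable_soft_join_eval gf k gm2 c2 ys j).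
have limit b : (forall k j, lo <= rvcov P (a1 k j) (a2 k j) <= b) ->
    lo <= rvcov P (fun w => G1 (f w)) (fun w => G2 (f w)) <= b.
  move=> h; have [_ _ //] := double_limit_itv m1 m2 (fun k j w => normM _ (a1M k j w))
    (fun k j w => normM _ (a2M k j w)) cvg1 cvg2 h.
case: hi hi0 cov => [b b0|_|//] cov.
  rewrite !lee_fin; apply: limit => k j.
  by apply: (gaussian_lattice_cov gf lo0 b0 _ c1 c2 j M0 gM1 gM2) => i i'; exact: cov.
rewrite leey andbT lee_fin; suff /limit/andP[] : forall k j, lo <= rvcov P (a1 k j) (a2 k j) <= M * M by [].
move=> k j; apply/andP; split.
  (* only finitely many points occur at stage [k], so some finite bound [b] is available *)
  pose v i i' := `|fine (cov_kernel P f (xs i) (ys i'))|.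
  pose b := \sum_(i < k) \sum_(i' < k) v i i'.
  have v0 i i' : 0 <= v i i' by exact: normr_ge0.
  have b0 : 0 <= b by apply: sumr_ge0 => i _; apply: sumr_ge0 => i' _.
  suff /andP[] : lo <= rvcov P (a1 k j) (a2 k j) <= b by [].
  apply: (gaussian_lattice_cov gf lo0 b0 _ c1 c2 j M0 gM1 gM2) => i i'.
  have /andP[-> _] := cov (xs i) (ys i') (Kxs i) (Kys i') => /=.
  have : v i i' <= b.
    rewrite /b (bigD1 i)//= (bigD1 i')//= -addrA lerDl addr_ge0//; first by apply: sumr_ge0.
    by apply: sumr_ge0 => l _; apply: sumr_ge0.
  by rewrite /v cov_kernelE//= lee_fin; apply: le_trans; exact: ler_norm.
have ba1 : bounded_rv (a1 k j) by split => //; exists M => w; exact: normM.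
have ba2 : bounded_rv (a2 k j) by split => //; exists M => w; exact: normM.
have /andP[e1 _] := mean_itv P ba1 (a1M k j); have /andP[e2 _] := mean_itv P ba2 (a2M k j).
have /andP[_ e12] : 0 <= mean P (fun w => a1 k j w * a2 k j w) <= M * M.
  apply: mean_itv => [|w]; first exact: bounded_rvM.
  by have /andP[? ?] := a1M k j w; have /andP[? ?] := a2M k j w; rewrite mulr_ge0//= ler_pM.
by rewrite /rvcov lerBlDr (le_trans e12)// lerDl mulr_ge0.
Qed.

End CovarianceInequality.

(** * Increasing events and their level functionals *)

Section LevelFunctional.
Context {R : realType} {X : topologicalType}.
Implicit Types (g h : continuousType X R) (A : set (continuousType X R)).

(** The point 0 makes the set nonempty when no shift of [g] up to [eps] is in [A]. *)
Definition level_set A (eps : R) g : set R :=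
  [set u | u = 0 \/ (0 <= u <= eps /\ A (contfun_shift g (eps - u)))].

(** For an increasing [A] this is the length of the set of [s] in [0, eps] for
which [g + s] is in [A]. *)
Definition level A eps g : R := sup (level_set A eps g).

Lemma level_has_sup A eps g : 0 <= eps -> has_sup (level_set A eps g).
Proof.
move=> e0; split; first by exists 0; left.
by exists eps => u [->|[/andP[]]].
Qed.

Lemma level_ge A eps g u : 0 <= eps -> level_set A eps g u -> u <= level A eps g.
Proof. by move=> e0; apply: ub_le_sup; case: (level_has_sup A g e0). Qed.

Lemma level_le A eps g b : 0 <= eps -> (forall u, level_set A eps g u -> u <= b) -> level A eps g <= b.
Proof. by move=> e0 h; apply: ge_sup => //; case: (level_has_sup A g e0). Qed.

Lemma level_itv A eps g : 0 <= eps -> 0 <= level A eps g <= eps.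
Proof.
move=> e0; rewrite level_ge//=; last by left.
by apply: level_le => // u [->//|[/andP[]]].
Qed.

Lemma increasing_supported A (K : set X) g h : increasing A -> supported A K ->
  (forall x, K x -> g x <= h x) -> A g -> A h.
Proof.
move=> iA sA gh Ag.
have c1 : continuous (fun x => Num.max (h x - g x) 0).
  move=> x; apply: (@continuous_max _ _ (fun x => h x - g x) (cst 0)).
    by apply: cvgB; exact: cts_fun.
  exact: cvg_cst.
have c2 : continuous (fun x => h x - g x - Num.max (h x - g x) 0).
  by move=> x; apply: cvgB; [apply: cvgB; exact: cts_fun|exact: c1].
have A1 : A (contfun_add g (mkcts c1)).
  by apply: iA => // x; rewrite /= /mkcts le_max lexx orbT.
have := (sA _ (mkcts c2) _).1 A1.
rewrite (_ : contfun_add _ _ = h); last first.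
  by apply/continuousEP => x; rewrite /= /mkcts; ring.
by apply => x Kx; rewrite /= /mkcts max_l ?subrr// subr_ge0 gh.
Qed.

(** If [g <= h + c] on [K] then [h + (s + c)] is in [A] as soon as [g + s] is, so
at most a length [c] of shifts is lost. *)
Lemma level_contractive A (K : set X) eps : 0 <= eps -> increasing A -> supported A K ->
  sup_contractive K eps (level A eps).
Proof.
move=> e0 iA sA; split; first by move=> g; exact: level_itv.
move=> g h c c0 gh; apply: level_le => // u.
have l0 : 0 <= level A eps h by case/andP: (level_itv A h e0).
move=> [->|[/andP[u0 ue] Au]]; first exact: addr_ge0.
have [uc|cu] := leP u c; first by rewrite (le_trans uc)// lerDr.
rewrite -lerBlDr; apply: level_ge => //; right; split.
  by apply/andP; split; lra.
apply: (increasing_supported iA sA _ Au) => x Kx /=.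
by rewrite /mkcts /=; have := gh x Kx; lra.
Qed.

Lemma contfun_shift0 g : contfun_shift g 0 = g.
Proof. by apply/continuousEP => x; rewrite /= /mkcts addr0. Qed.

Lemma contfun_shiftD g a b : contfun_shift (contfun_shift g a) b = contfun_shift g (a + b).
Proof. by apply/continuousEP => x; rewrite /= /mkcts addrA. Qed.

Lemma level_full A eps g : 0 <= eps -> A g -> level A eps g = eps.
Proof.
move=> e0 Ag; apply/eqP; rewrite eq_le; case/andP: (level_itv A g e0) => _ -> /=.
by apply: level_ge => //; right; rewrite subrr contfun_shift0 lexx e0.
Qed.

Lemma level_empty A eps g : 0 <= eps -> increasing A -> ~ A (contfun_shift g eps) -> level A eps g = 0.
Proof.
move=> e0 iA nA; apply/eqP; rewrite eq_le; case/andP: (level_itv A g e0) => -> _.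
rewrite andbT; apply: level_le => // u [->//|[/andP[u0 ue] Au]].
exfalso; apply: nA; rewrite (_ : contfun_shift g eps = contfun_add (contfun_shift g (eps - u)) (cst u)).
  exact: iA.
by apply/continuousEP => x; rewrite /= /mkcts /=; ring.
Qed.

Lemma sup_contractive_shift (K : set X) (M : R) (G : continuousType X R -> R) a : sup_contractive K M G ->
  sup_contractive K M (fun g => G (contfun_shift g a)).
Proof.
move=> [Gb GL]; split => [g|g h c c0 gh]; first exact: Gb.
by apply: GL => // x Kx; rewrite /= /mkcts; have := gh x Kx; lra.
Qed.

End LevelFunctional.

Section SubsetMetric.
Context {R : realType} (n : nat) (D : set 'rV[R]_n).

Definition sub_dist (x y : set_type D) : R := `|set_val x - set_val y|.

Lemma nbhs_sub_dist (x : set_type D) (A : set (set_type D)) :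
  nbhs x A <-> exists2 r : R, 0 < r & forall y, sub_dist x y < r -> A y.
Proof.
have bE (y : set_type D) r : ball x r y = (sub_dist x y < r) :> Prop.
  rewrite /ball/= /initial_ball mx_norm_ball /ball_ /sub_dist //.
split; first by move=> /nbhs_ballP[r /= r0 rA]; exists r => // y xy; apply: rA; rewrite bE.
by move=> [r r0 rA]; apply/nbhs_ballP; exists r => // y; rewrite bE; exact: rA.
Qed.

End SubsetMetric.

(** * Sprinkled decoupling *)

Section EventProbabilities.
Context {R : realType} {d} {T : measurableType d} (P : probability T R).

Definition pr (A : set T) : R := fine (P A).

Lemma mean_indic A : measurable A -> bounded_rv (\1_A : T -> R) /\ mean P \1_A = pr A.
Proof.
move=> mA; split.
  split; first exact: measurable_indic.
  by exists 1 => w; rewrite indicE; case: (w \in A); rewrite ?normr1 ?normr0.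
by rewrite /mean /Rintegral /pr integral_indic// setIT.
Qed.

Lemma mean_ge_indic (U : T -> R) A eps : measurable A -> bounded_rv U -> 
  (forall w, 0 <= U w) -> (forall w, A w -> eps <= U w) -> eps * pr A <= mean P U.
Proof.
move=> mA bU U0 UA; have [b <-] := mean_indic mA; rewrite -meanZ//.
apply: mean_le => // [|w]; first exact: bounded_rvZ.
rewrite indicE; case: (boolP (w \in A)) => wA; last by rewrite mulr0.
by rewrite mulr1; apply: UA; exact: set_mem.
Qed.

Lemma mean_le_indic (U : T -> R) A eps : measurable A -> bounded_rv U ->
  (forall w, U w <= eps) -> (forall w, ~ A w -> U w <= 0) -> mean P U <= eps * pr A.
Proof.
move=> mA bU Ue UA; have [b <-] := mean_indic mA; rewrite -meanZ//.
apply: mean_le => // [|w]; first exact: bounded_rvZ.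
rewrite indicE; case: (boolP (w \in A)) => wA; first by rewrite mulr1.
by rewrite mulr0; apply: UA => Aw; move/negP: wA; apply; exact: mem_set.
Qed.

Lemma pr_ge0 A : 0 <= pr A.
Proof. exact: fine_ge0. Qed.

Lemma prE A : measurable A -> P A = (pr A)%:E.
Proof. by move=> mA; rewrite /pr fineK// fin_num_measure. Qed.

End EventProbabilities.

Section SprinkledDecoupling.
Context {R : realType} {n : nat} (D : set 'rV[R]_n) {dO : measure_display}
  {Omega : measurableType dO} (P : probability Omega R)
  (f : Omega -> continuousType (set_type D) R).
Hypothesis gf : gaussian_process P f.
Variables (D1 D2 : set D) (A1 A2 : set (continuousType (set_type D) R)).
Hypotheses (cD1 : compact D1) (cD2 : compact D2).
Hypotheses (eA1 : event A1) (iA1 : increasing A1) (sA1 : supported A1 D1).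
Hypotheses (eA2 : event A2) (iA2 : increasing A2) (sA2 : supported A2 D2).
Variable eps : R.
Hypothesis eps0 : 0 < eps.

Let dr (x : set_type D) : sub_dist x x = 0.
Proof. by rewrite /sub_dist subrr normr0. Qed.

Let ds (x y : set_type D) : sub_dist x y = sub_dist y x.
Proof. by rewrite /sub_dist distrC. Qed.

Let dt (x y z : set_type D) : sub_dist x z <= sub_dist x y + sub_dist y z.
Proof. exact: ler_distD. Qed.

Let shifted a w := contfun_shift (f w) a.

Let mev (A : set (continuousType (set_type D) R)) (K : set D) a :
  compact K -> event A -> supported A K -> measurable [set w | A (shifted a w)].
Proof.
move=> cK eA sA; apply: (measurable_event dr ds dt (@nbhs_sub_dist _ _ D) cK _ eA sA) => x.
by apply: measurable_funD => //; exact: measurable_eval.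
Qed.

Let m1 a : measurable [set w | A1 (shifted a w)]. Proof. exact: mev cD1 eA1 sA1. Qed.
Let m2 a : measurable [set w | A2 (shifted a w)]. Proof. exact: mev cD2 eA2 sA2. Qed.

(** The level functional lies between [eps] times the indicators of [A] and of its
shift by [eps]. Sandwich the product and the means of the two functionals, and
compare them with the covariance inequality. The shift [a] is 0 for the upper
bound on the intersection and [- eps] for the lower one. *)
Let decoupling a lo (hi : \bar R) : lo <= 0 -> (0 <= hi)%E ->
  (forall x y, D1 x -> D2 y -> (lo%:E <= cov_kernel P f x y <= hi)%E) ->
  ((eps ^+ 2 * (pr P ([set w | A1 (shifted a w)] `&` [set w | A2 (shifted a w)]) -
    pr P [set w | A1 (shifted (a + eps) w)] * pr P [set w | A2 (shifted (a + eps) w)]))%:E <= hi)%E /\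
  lo <= eps ^+ 2 * (pr P ([set w | A1 (shifted (a + eps) w)] `&` [set w | A2 (shifted (a + eps) w)]) -
    pr P [set w | A1 (shifted a w)] * pr P [set w | A2 (shifted a w)]).
Proof.
move=> lo0 hi0 cov; have e0 := ltW eps0.
pose U1 w := level A1 eps (shifted a w); pose U2 w := level A2 eps (shifted a w).
have [b1 b2 /andP[c1 c2]] := gaussian_cov_inequality dr ds dt (@nbhs_sub_dist _ _ D) gf cD1 cD2 e0 lo0 hi0 cov
  (sup_contractive_shift a (level_contractive e0 iA1 sA1))
  (sup_contractive_shift a (level_contractive e0 iA2 sA2)).
rewrite -/U1 -/U2 in b1 b2 c1 c2.
have U1b w : 0 <= U1 w <= eps by exact: level_itv.
have U2b w : 0 <= U2 w <= eps by exact: level_itv.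
have U10 w : 0 <= U1 w by case/andP: (U1b w).
have U20 w : 0 <= U2 w by case/andP: (U2b w).
have U1e w : U1 w <= eps by case/andP: (U1b w).
have U2e w : U2 w <= eps by case/andP: (U2b w).
have full1 w : A1 (shifted a w) -> U1 w = eps by move=> h; exact: level_full.
have full2 w : A2 (shifted a w) -> U2 w = eps by move=> h; exact: level_full.
have emp1 w : ~ A1 (shifted (a + eps) w) -> U1 w = 0.
  by move=> h; apply: level_empty => //; rewrite contfun_shiftD.
have emp2 w : ~ A2 (shifted (a + eps) w) -> U2 w = 0.
  by move=> h; apply: level_empty => //; rewrite contfun_shiftD.
have b12 := bounded_rvM b1 b2.
have U12e w : U1 w * U2 w <= eps ^+ 2 by rewrite expr2 ler_pM.
have lo12 : eps ^+ 2 * pr P ([set w | A1 (shifted a w)] `&` [set w | A2 (shifted a w)]) <= mean P (fun w => U1 w * U2 w).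
  apply: mean_ge_indic => //; first exact: measurableI.
    by move=> w; exact: mulr_ge0.
  by move=> w [/= /full1 -> /full2 ->]; rewrite expr2.
have hi12 : mean P (fun w => U1 w * U2 w) <= eps ^+ 2 * pr P ([set w | A1 (shifted (a + eps) w)] `&` [set w | A2 (shifted (a + eps) w)]).
  apply: mean_le_indic => //; first exact: measurableI.
  move=> w /not_andP[] /=; first by move/emp1 => ->; rewrite mul0r.
  by move/emp2 => ->; rewrite mulr0.
have lo1 : eps * pr P [set w | A1 (shifted a w)] <= mean P U1.
  by apply: mean_ge_indic => // w /full1 ->.
have lo2 : eps * pr P [set w | A2 (shifted a w)] <= mean P U2.
  by apply: mean_ge_indic => // w /full2 ->.
have hi1 : mean P U1 <= eps * pr P [set w | A1 (shifted (a + eps) w)].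
  by apply: mean_le_indic => // w /emp1 ->.
have hi2 : mean P U2 <= eps * pr P [set w | A2 (shifted (a + eps) w)].
  by apply: mean_le_indic => // w /emp2 ->.
have nn (V : Omega -> R) : (forall w, 0 <= V w) -> 0 <= mean P V by move=> V0; rewrite /mean Rintegral_ge0.
have p0 A : 0 <= eps * pr P A by rewrite mulr_ge0// pr_ge0.
have hh := ler_pM (nn _ U10) (nn _ U20) hi1 hi2.
have ll := ler_pM (p0 _) (p0 _) lo1 lo2.
rewrite lee_fin /rvcov in c1; rewrite /rvcov in c2; rewrite !mulrBr.
rewrite mulrACA -expr2 in hh; rewrite mulrACA -expr2 in ll.
split; last by lra.
by apply: le_trans c2; rewrite lee_fin; lra.
Qed.

Let kernel_norm_ge0 : (0 <= kernel_norm P f D1 D2)%E.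
Proof. by rewrite /kernel_norm le_max lexx. Qed.

Let kernel_norm_ub x y : D1 x -> D2 y -> (`|cov_kernel P f x y| <= kernel_norm P f D1 D2)%E.
Proof.
move=> Dx Dy; rewrite /kernel_norm le_max; apply/orP; right.
by apply: ereal_sup_ubound; exists x => //; exists y.
Qed.

Let mf1 : measurable [set w | A1 (f w)].
Proof. by have := m1 0; rewrite /shifted; under eq_fun do rewrite contfun_shift0. Qed.

Let mf2 : measurable [set w | A2 (f w)].
Proof. by have := m2 0; rewrite /shifted; under eq_fun do rewrite contfun_shift0. Qed.

Let scale_le (x y : R) : eps ^+ 2 * x <= y -> x <= 1 / eps ^+ 2 * y.
Proof. by move=> h; rewrite div1r -[leLHS](mulKf (lt0r_neq0 (exprn_gt0 2 eps0))) ler_pM2l ?invr_gt0 ?exprn_gt0. Qed.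

Let upper_of lo hi : lo <= 0 -> 0 <= hi ->
  (forall x y, D1 x -> D2 y -> (lo%:E <= cov_kernel P f x y <= hi%:E)%E) ->
  (P [set w | A1 (f w) /\ A2 (f w)]
    - P [set w | A1 (contfun_shift (f w) eps)] * P [set w | A2 (contfun_shift (f w) eps)]
    <= (1 / eps ^+ 2 * hi)%:E)%E.
Proof.
move=> lo0 hi0 cov; have hi0' : (0 <= hi%:E)%E by rewrite lee_fin.
have [h _] := decoupling 0 lo0 hi0' cov; rewrite lee_fin in h.
have s0 A : [set w | A (shifted 0 w)] = [set w | A (f w)].
  by rewrite /shifted; under eq_fun do rewrite contfun_shift0.
rewrite add0r !s0 in h.
rewrite (prE _ (measurableI _ _ mf1 mf2)) (prE _ (m1 eps)) (prE _ (m2 eps)).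
by rewrite -EFinM -EFinB lee_fin; exact: scale_le.
Qed.

Let lower_of lo (hi : \bar R) : lo <= 0 -> (0 <= hi)%E ->
  (forall x y, D1 x -> D2 y -> (lo%:E <= cov_kernel P f x y <= hi)%E) ->
  (P [set w | A1 (contfun_shift (f w) (- eps))] * P [set w | A2 (contfun_shift (f w) (- eps))]
    - P [set w | A1 (f w) /\ A2 (f w)]
    <= (1 / eps ^+ 2 * (- lo))%:E)%E.
Proof.
move=> lo0 hi0 cov; have [_ h] := decoupling (- eps) lo0 hi0 cov.
have s0 A : [set w | A (shifted 0 w)] = [set w | A (f w)].
  by rewrite /shifted; under eq_fun do rewrite contfun_shift0.
rewrite addNr !s0 in h.
rewrite (prE _ (measurableI _ _ mf1 mf2)) (prE _ (m1 (- eps))) (prE _ (m2 (- eps))).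
rewrite -EFinM -EFinB lee_fin; apply: scale_le.
by rewrite -[leLHS]opprK -mulrN opprB lerN2.
Qed.

(** When the norm is infinite both inequalities with a positive constant are void. *)
Let kernel_norm_cases : kernel_norm P f D1 D2 = +oo%E \/
  exists2 k : R, 0 <= k & kernel_norm P f D1 D2 = k%:E /\
    forall x y, D1 x -> D2 y -> ((- k)%:E <= cov_kernel P f x y <= k%:E)%E.
Proof.
have := kernel_norm_ge0; have := kernel_norm_ub; case: (kernel_norm P f D1 D2) => [k ub k0||//].
- right; exists k; first by rewrite -lee_fin.
  split=> // x y Dx Dy; have := ub x y Dx Dy.
  by rewrite (cov_kernelE gf) /= !lee_fin ler_norml.
- by left.
Qed.

Let scaled_infty (x : \bar R) : (x <= (1 / eps ^+ 2)%:E * +oo)%E.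
Proof. by rewrite gt0_muley ?leey// lte_fin divr_gt0// exprn_gt0. Qed.

Lemma sprinkled_upper_gaussian : sprinkled_upper P f D1 D2 A1 A2 eps 1.
Proof.
rewrite /sprinkled_upper; have [->|[k k0 [-> cov]]] := kernel_norm_cases; first exact: scaled_infty.
by rewrite -EFinM; apply: upper_of cov => //; rewrite oppr_le0.
Qed.

Lemma sprinkled_lower_gaussian : sprinkled_lower P f D1 D2 A1 A2 eps 1.
Proof.
rewrite /sprinkled_lower; have [->|[k k0 [-> cov]]] := kernel_norm_cases; first exact: scaled_infty.
by rewrite -EFinM -[X in _ * X]opprK; apply: lower_of cov => //; rewrite oppr_le0.
Qed.

Lemma sprinkled_lower_positive :
  (forall x y : D, D1 x -> D2 y -> (0 <= cov_kernel P f x y)%E) ->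
  sprinkled_lower P f D1 D2 A1 A2 eps 0.
Proof.
move=> K0; rewrite /sprinkled_lower mul0r mul0e.
have := @lower_of 0 +oo%E; rewrite oppr0 mulr0; apply => // x y Dx Dy.
by rewrite K0//= leey.
Qed.

End SprinkledDecoupling.

Theorem theorem1p5 (R : realType) :
  exists2 c : R, 0 < c &
  forall (n : nat) (D : set 'rV[R]_n)
    (dO : measure_display) (Omega : measurableType dO) (P : probability Omega R)
    (f : Omega -> continuousType (set_type D) R),
  gaussian_process P f ->
  forall D1 D2 : set D, compact D1 -> compact D2 ->
  forall A1 A2 : set (continuousType (set_type D) R),
  event A1 -> increasing A1 -> supported A1 D1 ->
  event A2 -> increasing A2 -> supported A2 D2 ->
  forall eps : R, 0 < eps ->
  [/\ sprinkled_upper P f D1 D2 A1 A2 eps c,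
      sprinkled_lower P f D1 D2 A1 A2 eps c &
      (forall x y : D, D1 x -> D2 y -> (0 <= cov_kernel P f x y)%E) ->
      sprinkled_upper P f D1 D2 A1 A2 eps 1 /\
      sprinkled_lower P f D1 D2 A1 A2 eps 0].
Proof.
exists 1 => // n D dO Omega P f gf D1 D2 cD1 cD2 A1 A2 eA1 iA1 sA1 eA2 iA2 sA2 eps eps0.
have up := sprinkled_upper_gaussian gf cD1 cD2 eA1 iA1 sA1 eA2 iA2 sA2 eps0.
split=> // [|K0]; first exact: sprinkled_lower_gaussian.
by split=> //; exact: sprinkled_lower_positive.
Qed.
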